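(* Let $G$ be a topological group that has a finite Kazhdan set. Let $p\in[1,\infty)$, let $\Omega$ be a standard Borel space and $\mu$ a finite measure on $\Omega$. Let $\pi:G\curvearrowright L_p(\Omega,\mu)$ be a linear isometric action whose associated Banach--Lamperti (BL) action $G\curvearrowright(\Omega,\mu)$ is ergodic and measure preserving (for $p=2$: let $\pi$ be a unitary representation of $G$ on $L_2(\Omega,\mu)$ arising from an ergodic measure-preserving action $G\curvearrowright(\Omega,\mu)$). Then $H^1(G,\pi)=0$. Equivalently, every affine isometric action of $G$ on $L_p(\Omega,\mu)$ with linear part $\pi$ has a fixed point.
   Context: Kazhdan set: a subset $S\subset G$ of a topological group is a Kazhdan set if there is $\varepsilon>0$ such that for every strongly continuous unitary representation $\sigma$ of $G$ on a Hilbert space $H$ without nonzero invariant vectors one has $\sup_{\gamma\in S}\|\sigma(\gamma)\xi-\xi\|\ge\varepsilon\|\xi\|$ for all $\xi\in H$. The hypothesis is that $G$ has a Kazhdan set that is finite. A linear isometric action $\pi:G\curvearrowright X$ on a Banach space $X$ is a strongly continuous group homomorphism $\gamma\mapsto\pi_\gamma$ from $G$ to the group of all invertible linear isometries of $X$. BL action: by the Banach--Lamperti theorem, for $1\le p<\infty$, $p\ne2$, every linear isometric action $\pi$ of $G$ on $L_p(\Omega,\mu)$ induces a measure-class preserving action of $G$ on $(\Omega,\mu)$ (understood up to null sets), called the BL action, and measurable functions $\chi^{(\gamma)}$ on $\Omega$ with $|\chi^{(\gamma)}|=1$ a.e. ($\gamma\in G$), such that for all $f\in L_p(\Omega,\mu)$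 and $\gamma\in G$, $\pi_\gamma(f)(\omega)=\chi^{(\gamma)}(\omega)f(\gamma^{-1}\omega)\big[\frac{d\gamma\mu}{d\mu}(\omega)\big]^{1/p}$ for a.e. $\omega$. If the BL action is measure preserving, this reads $\pi_\gamma(f)(\omega)=\chi^{(\gamma)}(\omega)f(\gamma^{-1}\omega)$. For $p=2$, a unitary representation ''arising from'' a measure-preserving action $G\curvearrowright(\Omega,\mu)$ is a strongly continuous unitary representation on $L_2(\Omega,\mu)$ of this same form $\pi_\gamma(f)(\omega)=\chi^{(\gamma)}(\omega)f(\gamma^{-1}\omega)$ with $|\chi^{(\gamma)}|=1$ a.e. The action is ergodic if every measurable $A\subset\Omega$ with $\mu(\gamma A\,\triangle\,A)=0$ for all $\gamma\in G$ satisfies $\mu(A)=0$ or $\mu(\Omega\setminus A)=0$. Cohomology: a $\pi$-cocycle is a continuous map $b:G\to L_p(\Omega,\mu)$, $\gamma\mapsto b_\gamma$, with $b_{\gamma\gamma'}=b_\gamma+\pi_\gamma b_{\gamma'}$ for all $\gamma,\gamma'\in G$; a $\pi$-coboundary is a cocycle of the form $b_\gamma=\pi_\gamma f-f$ for some $f\in L_p(\Omega,\mu)$. $Z^1(G,\pi)$ and $B^1(G,\pi)$ denote the groups of cocycles and coboundaries, and $H^1(G,\pi)=Z^1(G,\pi)/B^1(G,\pi)$. Affine isometric actions with linear part $\pi$ are the maps $x\mapsto\pi_\gamma x+b_\gamma$ with $b$ a $\pi$-cocycle. *)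

(* Defs.v *)
From HB Require Import structures.
From mathcomp Require Import all_boot all_order all_algebra.
From mathcomp Require Import sesquilinear ring_quotient generic_quotient complex.
From mathcomp Require Import all_classical all_reals all_analysis measurable_realfun.

Set Implicit Arguments.
Unset Strict Implicit.
Unset Printing Implicit Defensive.

Import Order.TTheory GRing.Theory Num.Def Num.Theory.
Import numFieldNormedType.Exports.

Local Open Scope classical_set_scope.
Local Open Scope ring_scope.
Local Open Scope quotient_scope.
Local Open Scope charge_scope.

HB.mixin Record isTopologicalGroup G of Topological G & Group G := {
  mulg_continuous : continuous (fun x : G * G => (x.1 * x.2)%g) ;
  invg_continuous : continuous (fun x : G => x^-1%g)
}.
#[short(type="topologicalGroupType")]
HB.structure Definition TopologicalGroup :=
  {G of Topological G & Group G & isTopologicalGroup G}.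

Section linear_isometric_actions.
Context (G : topologicalGroupType) (K : numFieldType) (X : normedModType K).

(* Invertibility of each [lia_fun g] follows from [lia1] and [liaM]. *)
Record linIsomAction := LinIsomAction {
  lia_fun :> G -> X -> X ;
  lia_linear : forall g, linear (lia_fun g) ;
  lia_isometry : forall g x, `|lia_fun g x| = `|x| ;
  lia1 : forall x, lia_fun 1%g x = x ;
  liaM : forall g h x, lia_fun (g * h)%g x = lia_fun g (lia_fun h x) ;
  lia_continuous : forall x, continuous (fun g => lia_fun g x)
}.
End linear_isometric_actions.

Section image_measure.
Context d (T : measurableType d) (R : realType)
  (mu : {finite_measure set T -> \bar R}) (f : {mfun T >-> T}).

(* [pushforward mu f], whose charge instance takes an explicit measurability
   proof, repackaged so that it can be used in ['d _ '/d mu]. *)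
Definition image_measure : set T -> \bar R := pushforward mu f.

Let image_measure0 : image_measure set0 = 0%E.
Proof. by rewrite /image_measure /pushforward preimage_set0 measure0. Qed.

Let image_measure_ge0 A : (0 <= image_measure A)%E.
Proof. exact: measure_ge0. Qed.

Let image_measure_sigma_additive : semi_sigma_additive image_measure.
Proof.
pose m := @measure_function_pushforward__canonical__measure_function_Measure _ _ _ _ _ mu f (measurable_funPT f).
exact: (@measure_semi_sigma_additive _ _ _ m).
Qed.

HB.instance Definition _ := isMeasure.Build _ _ _ image_measure
  image_measure0 image_measure_ge0 image_measure_sigma_additive.

Let image_measure_fin : fin_num_fun image_measure.
Proof.
move=> A mA; rewrite /image_measure /pushforward.
by apply: fin_num_measure; rewrite -[_ @^-1` _]setTI; exact: (measurable_funPT f).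
Qed.

HB.instance Definition _ := Measure_isFinite.Build _ _ _ image_measure image_measure_fin.
End image_measure.

Section real_norm.
Context (R : realType) (V : normedZmodType R[i]).

(* In a normed space over [R[i]], [`|x|] is an element of [R[i]]. *)
Definition rnorm (x : V) : R := complex.Re `|x|.

Lemma rnormE x : `|x| = ((rnorm x)%:C)%C.
Proof. by rewrite RRe_real// normr_real. Qed.

Lemma rnorm_ge0 x : 0 <= rnorm x.
Proof. by rewrite -ler0c -rnormE. Qed.

Lemma ler_rnormD x y : rnorm (x + y) <= rnorm x + rnorm y.
Proof. by rewrite -lecR rmorphD/= -!rnormE ler_normD. Qed.

Lemma rnorm0 : rnorm 0 = 0.
Proof. by rewrite /rnorm normr0. Qed.

Lemma rnorm0_eq0 x : rnorm x = 0 -> x = 0.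
Proof. by move=> x0; apply/eqP; rewrite -normr_eq0 rnormE x0. Qed.
End real_norm.

Lemma rnormM (R : realType) (x y : R[i]) : rnorm (x * y) = rnorm x * rnorm y.
Proof. by apply: complexI; rewrite rmorphM/= -!rnormE normrM. Qed.

Section complex_Lp.
Context d (T : measurableType d) (R : realType)
  (mu : {measure set T -> \bar R}).
Implicit Types f g : T -> R[i].

Definition cmeasurable f :=
  measurable_fun setT (@complex.Re R \o f) /\
  measurable_fun setT (@complex.Im R \o f).

Lemma cmeasurable_rnorm f : cmeasurable f ->
  measurable_fun setT (fun x => rnorm (f x)).
Proof.
move=> [mr mi].
have -> : (fun x => rnorm (f x)) =
    (@Num.sqrt R) \o (fun x => (complex.Re (f x)) ^+ 2 + (complex.Im (f x)) ^+ 2).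
  by apply/funext => x /=; rewrite /rnorm; case: (f x).
apply: measurableT_comp.
  by apply: continuous_measurable_fun; exact: sqrt_continuous.
by apply: measurable_funD; apply: measurable_funX.
Qed.

Lemma cmeasurable_lin a f g : cmeasurable f -> cmeasurable g ->
  cmeasurable (a *: f + g).
Proof.
case: a => a b [fr fi] [gr gi]; split.
  have -> : (@complex.Re R \o ((a +i* b)%C *: f + g)) =
     (fun x => (a * complex.Re (f x) - b * complex.Im (f x)) + complex.Re (g x)).
    by apply/funext => x /=; rewrite fctE /= scalrfctE; case: (f x) (g x) => ? ? [].
  by apply: measurable_funD => //; apply: measurable_funB;
     apply: measurable_funM => //.
have -> : (@complex.Im R \o ((a +i* b)%C *: f + g)) =
   (fun x => (a * complex.Im (f x) + b * complex.Re (f x)) + complex.Im (g x)).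
  by apply/funext => x /=; rewrite fctE /= scalrfctE; case: (f x) (g x) => ? ? [].
by apply: measurable_funD => //; apply: measurable_funD;
   apply: measurable_funM => //.
Qed.

Variable (p : R) (p1 : 1 <= p).

Definition cLnorm f : \bar R := ('N[mu]_(p%:E) [(fun x => (rnorm (f x))%:E)])%E.

Lemma cLnorm_ge0 f : (0 <= cLnorm f)%E.
Proof. exact: Lnorm_ge0. Qed.

Let p0 : 0 < p. Proof. exact: lt_le_trans p1. Qed.

Let mpow (h : T -> \bar R) : measurable_fun setT h ->
  measurable_fun setT (fun x => (`|h x| `^ p)%E).
Proof.
move=> mh; apply: (@measurableT_comp _ _ _ _ _ _ (fun x => x `^ p)%E) => //=.
  exact: measurable_poweR.
exact: measurableT_comp.
Qed.

Let le_N (h k : T -> R) : measurable_fun setT h -> measurable_fun setT k ->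
  (forall x, 0 <= h x <= k x) ->
  ('N[mu]_(p%:E) [EFin \o h] <= 'N[mu]_(p%:E) [EFin \o k])%E.
Proof.
move=> mh mk hk; rewrite unlock /Lnorm; apply: gt0_ler_poweR.
- by rewrite invr_ge0 ltW.
- by rewrite in_itv/= leey andbT integral_ge0// => x _; exact: poweR_ge0.
- by rewrite in_itv/= leey andbT integral_ge0// => x _; exact: poweR_ge0.
apply: ge0_le_integral => //.
- by move=> x _; exact: poweR_ge0.
- by apply: (@mpow (EFin \o h)); exact/measurable_EFinP.
- by apply: (@mpow (EFin \o k)); exact/measurable_EFinP.
move=> x _ /=; have /andP[h0 hkx] := hk x.
have k0 := le_trans h0 hkx.
rewrite lee_fin !ger0_norm//; apply: ge0_ler_powR => //.
exact: ltW.
Qed.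

Lemma cLnormD f g : cmeasurable f -> cmeasurable g ->
  (cLnorm (f + g)%R <= cLnorm f + cLnorm g)%E.
Proof.
move=> mf mg; have mf' := cmeasurable_rnorm mf; have mg' := cmeasurable_rnorm mg.
apply: (@le_trans _ _ ('N[mu]_(p%:E)
    [EFin \o ((fun x => rnorm (f x)) \+ (fun x => rnorm (g x)))%R])%E).
  apply: le_N => [| |x].
  - by apply: cmeasurable_rnorm; rewrite -[f]scale1r; exact: cmeasurable_lin.
  - exact: measurable_funD.
  - by rewrite rnorm_ge0/= ler_rnormD.
exact: minkowski_EFin.
Qed.

Lemma cLnorm_ae f g : {ae mu, forall x, f x = g x} ->
  cmeasurable f -> cmeasurable g -> cLnorm f = cLnorm g.
Proof.
move=> fg mf mg; rewrite /cLnorm unlock /Lnorm; congr (_ `^ _)%E.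
apply: ge0_ae_eq_integral => //; last 3 first.
- by move=> x _; exact: poweR_ge0.
- by move=> x _; exact: poweR_ge0.
- by apply: filterS fg => x -> _.
- by apply: (@mpow (fun x => (rnorm (f x))%:E)); apply/measurable_EFinP;
     exact: cmeasurable_rnorm.
- by apply: (@mpow (fun x => (rnorm (g x))%:E)); apply/measurable_EFinP;
     exact: cmeasurable_rnorm.
Qed.

Lemma cLnormZ a f : cmeasurable f ->
  (cLnorm (a *: f)%R = (rnorm a)%:E * cLnorm f)%E.
Proof.
move=> mf; rewrite /cLnorm unlock /Lnorm.
have -> : (\int[mu]_x (`|(rnorm ((a *: f) x))%:E| `^ p) =
   ((rnorm a) `^ p)%:E * \int[mu]_x (`|(rnorm (f x))%:E| `^ p))%E.
  rewrite -ge0_integralZl//.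
  - apply: eq_integral => x _.
    rewrite scalrfctE rnormM /= !ger0_norm ?rnorm_ge0 ?mulr_ge0 ?rnorm_ge0//.
    by rewrite -EFinM powRM ?rnorm_ge0.
  - by apply: (@mpow (fun x => (rnorm (f x))%:E)); apply/measurable_EFinP;
     exact: cmeasurable_rnorm.
  - by move=> x _; exact: poweR_ge0.
  - by rewrite lee_fin powR_ge0.
have I0 : (0 <= \int[mu]_x (`|(rnorm (f x))%:E| `^ p))%E.
  by apply: integral_ge0 => x _; exact: poweR_ge0.
rewrite poweRM ?lee_fin ?powR_ge0//.
by rewrite poweR_EFin -powRrM mulfV ?gt_eqF// powRr1// rnorm_ge0.
Qed.

Lemma cLnorm_eq0 f : cmeasurable f -> cLnorm f = 0%E ->
  {ae mu, forall x, f x = 0}.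
Proof.
move=> mf /Lnorm_eq0_eq0 H.
have : (fun x => (rnorm (f x))%:E) = \0%E %[ae mu].
  apply: H; last by rewrite lte_fin.
  by apply/measurable_EFinP; exact: cmeasurable_rnorm.
by apply: filterS => x /(_ I) [] /rnorm0_eq0.
Qed.

Lemma cLnorm0 : cLnorm 0 = 0%E.
Proof.
rewrite /cLnorm (_ : (fun x => _) = cst 0%E) ?Lnorm0// ?eqe ?gt_eqF//.
by apply/funext => x; rewrite /rnorm fctE normr0.
Qed.

Definition cLfun of 1 <= p : {pred (T -> R[i])} :=
  fun f => `[< cmeasurable f /\ (cLnorm f < +oo)%E >].

Lemma cmeasurable0 : cmeasurable (0 : T -> R[i]).
Proof. by split; exact: measurable_cst. Qed.

Lemma cLfun_submod_closed : submod_closed (cLfun p1).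
Proof.
split; first by apply/asboolP; split; [exact: cmeasurable0|rewrite cLnorm0].
move=> a f g /asboolP[mf lf] /asboolP[mg lg]; apply/asboolP.
split; first exact: cmeasurable_lin.
have maf : cmeasurable (a *: f).
  by rewrite -[_ *: _]addr0; apply: cmeasurable_lin => //; exact: cmeasurable0.
apply: le_lt_trans (cLnormD maf mg) _.
by rewrite cLnormZ// lte_add_pinfty// lte_mul_pinfty// lee_fin rnorm_ge0.
Qed.

HB.instance Definition _ := GRing.isSubmodClosed.Build _ _ (cLfun p1)
  cLfun_submod_closed.

End complex_Lp.

Section complex_Lp_space.
Context d (T : measurableType d) (R : realType)
  (mu : {measure set T -> \bar R}) (p : R) (p1 : 1 <= p).

Record cLfunType := CLfun {
  cLfun_val :> T -> R[i] ;
  cLfunP : cLfun_val \in cLfun mu p1 }.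

HB.instance Definition _ := [isSub for cLfun_val].
HB.instance Definition _ := [Choice of cLfunType by <:].
HB.instance Definition _ := [SubChoice_isSubLmodule of cLfunType by <:].

Lemma cLfunDE (f g : cLfunType) x : (f + g) x = f x + g x.
Proof. by []. Qed.

Lemma cLfunZE a (f : cLfunType) x : (a *: f) x = a * f x.
Proof. by []. Qed.

Definition cLnull : {pred cLfunType} :=
  fun f => `[< {ae mu, forall x, f x = 0} >].

Lemma cLnull_submod_closed : submod_closed cLnull.
Proof.
split; first by apply/asboolP; apply: nearW.
move=> a f g /asboolP f0 /asboolP g0; apply/asboolP.
by apply: filterS2 f0 g0 => x /= fx gx; rewrite fctE scalrfctE fx gx scaler0 addr0.
Qed.

HB.instance Definition _ := GRing.isSubmodClosed.Build _ _ cLnull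
  cLnull_submod_closed.

Definition Lp : Type := Quotient.quot cLnull.

HB.instance Definition _ := GRing.Zmodule.on Lp.
HB.instance Definition _ := EqQuotient.on Lp.

Lemma Lp_eqP (f g : cLfunType) :
  \pi_Lp f = \pi_Lp g <-> {ae mu, forall x, f x = g x}.
Proof.
split=> [/eqP|fg]; last first.
  apply/eqP; rewrite -Quotient.idealrBE; apply/asboolP.
  by apply: filterS fg => x fgx /=; rewrite !fctE fgx subrr.
rewrite -Quotient.idealrBE => /asboolP; apply: filterS => x /=.
by rewrite !fctE => /eqP; rewrite subr_eq0 => /eqP.
Qed.

Definition Lp_scale (a : R[i]) (f : Lp) : Lp := \pi_Lp (a *: repr f).

Lemma Lp_scaleE a (f : cLfunType) : Lp_scale a (\pi_Lp f) = \pi_Lp (a *: f).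
Proof.
apply/Lp_eqP; have /Lp_eqP : \pi_Lp (repr (\pi_Lp f)) = \pi_Lp f by rewrite reprK.
by apply: filterS => x fx; rewrite !cLfunZE fx.
Qed.

Let scaleA a b (v : Lp) : Lp_scale a (Lp_scale b v) = Lp_scale (a * b) v.
Proof. elim/quotW: v => v; by rewrite (Lp_scaleE b) (Lp_scaleE a) (Lp_scaleE (a * b)) scalerA. Qed.

Let scale1 : left_id 1 Lp_scale.
Proof. by elim/quotW => v; rewrite Lp_scaleE scale1r. Qed.

Let scaleDr : right_distributive Lp_scale +%R.
Proof.
move=> a; elim/quotW => v; elim/quotW => w.
by rewrite -raddfD !Lp_scaleE scalerDr raddfD.
Qed.

Let scaleDl v : {morph Lp_scale^~ v : a b / a + b}.
Proof. by elim/quotW: v => v a b; rewrite !Lp_scaleE scalerDl raddfD. Qed.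

HB.instance Definition _ :=
  GRing.Zmodule_isLmodule.Build R[i] Lp scaleA scale1 scaleDr scaleDl.

Definition Lp_norm (f : Lp) : R[i] := ((fine (cLnorm mu p (repr f)))%:C)%C.

Lemma cLfun_fin (f : cLfunType) : (fine (cLnorm mu p f))%:E = cLnorm mu p f.
Proof.
have /asboolP[_ lf] := cLfunP f.
by rewrite fineK// ge0_fin_numE// cLnorm_ge0.
Qed.

Lemma Lp_normE (f : cLfunType) :
  Lp_norm (\pi_Lp f) = ((fine (cLnorm mu p f))%:C)%C.
Proof.
rewrite /Lp_norm; congr (real_complex _ (fine _)).
have /asboolP[mf _] := cLfunP f.
have /asboolP[mg _] := cLfunP (repr (\pi_Lp f)).
by apply: cLnorm_ae => //; apply/Lp_eqP; rewrite reprK.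
Qed.

Let normD v w : Lp_norm (v + w) <= Lp_norm v + Lp_norm w.
Proof.
elim/quotW: v => v; elim/quotW: w => w.
rewrite -raddfD !Lp_normE -rmorphD/= lecR.
have /asboolP[mv _] := cLfunP v; have /asboolP[mw _] := cLfunP w.
rewrite -lee_fin EFinD (cLfun_fin v) (cLfun_fin w) (cLfun_fin (v + w)).
exact: (cLnormD mu p1 mv mw).
Qed.

Let normZ a v : Lp_norm (a *: v) = `|a| * Lp_norm v.
Proof.
elim/quotW: v => v; have /asboolP[mv _] := cLfunP v.
rewrite -[a *: _]/(Lp_scale _ _) Lp_scaleE !Lp_normE rnormE -rmorphM/=.
by congr (real_complex _ _); apply: EFin_inj; rewrite EFinM (cLfun_fin v) (cLfun_fin (a *: v)); exact: (cLnormZ mu p1 a mv).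
Qed.

Let norm0_eq0 v : Lp_norm v = 0 -> v = 0.
Proof.
elim/quotW: v => v; rewrite Lp_normE => -[v0].
have /asboolP[mv _] := cLfunP v.
rewrite -(raddf0 \pi_Lp); apply/Lp_eqP; apply: (cLnorm_eq0 (mu := mu) p1 mv).
by rewrite -cLfun_fin v0.
Qed.

HB.instance Definition _ :=
  Lmodule_isNormed.Build R[i] Lp normD normZ norm0_eq0.

End complex_Lp_space.

(* An arbitrary representative of the class; only used under [{ae mu, _}]. *)
Definition Lp_fun d (T : measurableType d) (R : realType)
    (mu : {measure set T -> \bar R}) (p : R) (p1 : 1 <= p) (f : Lp mu p1) :
    T -> R[i] := cLfun_val (repr f).
Coercion Lp_fun : Lp >-> Funclass.

Section cohomology.
Context (G : topologicalGroupType) (K : numFieldType) (X : normedModType K)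
  (pi : linIsomAction G X).

Definition cocycle : {pred (G -> X)} := fun b =>
  `[< continuous b /\ forall g h, b (g * h)%g = b g + pi g (b h) >].

Lemma linIsomActionB g : {morph pi g : x y / x - y}.
Proof.
by move=> x y; rewrite addrC -scaleN1r lia_linear scaleN1r addrC.
Qed.

Lemma linIsomAction0 g : pi g 0 = 0.
Proof. by rewrite -[0 in LHS](subrr 0) linIsomActionB subrr. Qed.

Lemma cocycle_zmod_closed : zmod_closed cocycle.
Proof.
split.
  apply/asboolP; split=> [x|g h]; first exact: cvg_cst.
  by rewrite -[LHS]/(0 : X) -[RHS]/(0 + pi g 0) linIsomAction0 addr0.
move=> a b /asboolP[ca ha] /asboolP[cb hb]; apply/asboolP; split=> [x|g h].
  by apply: cvgB; [exact: ca|exact: cb].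
rewrite -[LHS]/(a (g * h)%g - b (g * h)%g).
rewrite -[RHS]/((a g - b g) + pi g (a h - b h)).
by rewrite ha hb linIsomActionB opprD addrACA.
Qed.

HB.instance Definition _ := GRing.isZmodClosed.Build _ cocycle
  cocycle_zmod_closed.

Record Z1 := MkZ1 { Z1_val :> G -> X ; Z1P : Z1_val \in cocycle }.

HB.instance Definition _ := [isSub for Z1_val].
HB.instance Definition _ := [Choice of Z1 by <:].
HB.instance Definition _ := [SubChoice_isSubZmodule of Z1 by <:].

Definition B1 : {pred Z1} := fun b =>
  `[< exists f : X, forall g, b g = pi g f - f >].

Lemma B1_zmod_closed : zmod_closed B1.
Proof.
split.
  by apply/asboolP; exists 0 => g; rewrite linIsomAction0 subrr.
move=> a b /asboolP[f af] /asboolP[h bh]; apply/asboolP; exists (f - h) => g.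
rewrite linIsomActionB -[LHS]/(a g - b g) af bh.
by rewrite !opprD !opprK addrACA.
Qed.

HB.instance Definition _ := GRing.isZmodClosed.Build _ B1 B1_zmod_closed.

Definition H1 : Type := Quotient.quot B1.
HB.instance Definition _ := GRing.Zmodule.on H1.

Definition affine_action_with_linear_part (alpha : G -> X -> X) : Prop :=
  exists b : Z1, forall g x, alpha g x = pi g x + b g.

End cohomology.

(* A unitary representation on a Hilbert space is the same thing as a strongly
   continuous action by invertible linear isometries. *)
Definition kazhdan_set (R : realType) (G : topologicalGroupType)
    (S : set G) : Prop :=
  exists2 eps : R, 0 < eps &
  forall (H : completeNormedModType R[i]) (dot : {dot H for conjC}),
    (forall x, `|x| ^+ 2 = dot x x) ->
  forall sigma : linIsomAction G H,
    (forall xi, (forall g, sigma g xi = xi) -> xi = 0) ->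
  forall xi : H,
    eps * rnorm xi <= sup [set rnorm (sigma g xi - xi) | g in S].

(* The Borel space of a Polish space, up to isomorphism. *)
Definition standard_borel (R : realType) d (T : measurableType d) : Prop :=
  exists (X : completePseudoMetricType R) (f : T -> X),
    [/\ hausdorff_space X, @second_countable X, bijective f &
        @measurable d T = [set f @^-1` B | B in <<s @open X >>]].

Section actions_on_measure_spaces.
Context (R : realType) (G : topologicalGroupType) d (T : measurableType d)
  (mu : {finite_measure set T -> \bar R}).
Implicit Types (act : G -> {mfun T >-> T}) (chi : G -> T -> R[i]).

(* An action up to null sets: the action laws hold almost everywhere, with an
   exceptional set that may depend on the group elements. *)
Definition ae_action act : Prop :=
  {ae mu, forall w, act 1%g w = w} /\
  forall g h, {ae mu, forall w, act (g * h)%g w = act g (act h w)}.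

Definition measure_class_preserving act : Prop :=
  forall g A, measurable A -> mu (act g @^-1` A) = 0%E <-> mu A = 0%E.

Definition measure_preserving act : Prop :=
  forall g A, measurable A -> mu (act g @^-1` A) = mu A.

(* [act g^-1 @^-1` A] is the image [g A], up to a null set. *)
Definition ergodic act : Prop :=
  forall A, measurable A ->
    (forall g, mu ((act g^-1%g @^-1` A) `+` A) = 0%E) ->
    mu A = 0%E \/ mu (~` A) = 0%E.

Definition unimodular_family chi : Prop :=
  forall g, cmeasurable (chi g) /\ {ae mu, forall w, `|chi g w| = 1}.

Context (p : R) (p1 : 1 <= p).

(* [image_measure mu (act g)] is the measure [A |-> mu (g^-1 A)]. *)
Definition BL_action (pi : linIsomAction G (Lp mu p1)) act chi : Prop :=
  [/\ ae_action act, measure_class_preserving act, unimodular_family chi &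
      forall g (f : Lp mu p1), {ae mu, forall w,
        (pi g f : Lp mu p1) w = chi g w * f (act g^-1%g w) *
          ((fine (('d (image_measure mu (act g)) '/d mu) w) `^ p^-1)%:C)%C}].

Definition arises_from_action (pi : linIsomAction G (Lp mu p1)) act chi : Prop :=
  [/\ ae_action act, measure_preserving act, unimodular_family chi &
      forall g (f : Lp mu p1), {ae mu, forall w,
        (pi g f : Lp mu p1) w = chi g w * f (act g^-1%g w)}].

End actions_on_measure_spaces.

(* Main.v *)
From HB Require Import structures.
Require Import Defs.
From mathcomp Require Import all_boot all_order all_algebra.
From mathcomp Require Import complex ring lra.
From mathcomp Require Import all_classical all_reals all_analysis measurable_realfun.

Set Implicit Arguments.
Unset Strict Implicit.
Unset Printing Implicit Defensive.

Import Order.TTheory GRing.Theory Num.Def Num.Theory.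
Import numFieldNormedType.Exports.

Local Open Scope classical_set_scope.
Local Open Scope ring_scope.
Local Open Scope charge_scope.

(** Why every affine isometric action with linear part [pi] has a fixed point.

    The measure being preserved, the densities in the Banach-Lamperti form are
    1 ([BL_arises_from_action]), so [pi] multiplies by [chi] and translates,
    whatever [p] is. A cocycle is then a family of complex functions [b g] with
    [b (g * h) w = b g w + chi g w * b h (act g^-1 w)], and a fixed point is a
    [c] in L_p with [c w = chi g w * c (act g^-1 w) + b g w].

    Property (T) enters only through positive definite functions: there are a
    constant [C] and a finite list [s] such that every continuous positive
    definite [phi : G -> R] satisfies
    [phi 1 - phi g <= C * \sum_(t <- s) (phi 1 - phi t)] for all [g]
    ([kazhdan_set_positive_definite]). To see this, subtract from [phi] the
    largest constant that leaves it positive definite, and let [G] act by left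
    translations on the Hilbert space of functions whose reproducing kernel is
    [phi (x^-1 y)]. Invariant vectors are constant functions, and a nonzero
    constant in this space would allow a larger constant to be subtracted.
    The Kazhdan inequality for the kernel function at 1 gives the claim.

    Boundedness. The functions [g |-> \int expR (- (|b g| / 2 ^ n) ^ 2)] are
    positive definite, as the Gaussian kernel is. Summing the inequality above
    over [n] with weights [2 ^ n] turns the Gaussians into a function comparable
    to [|b g|], so that [\int |b g|] is bounded in [g] ([bounded_cocycle]).

    A measurable solution. Let [rho z = sqrt (1 + |z| ^ 2)], a strictly convex
    function of linear growth. A family of functions bounded in L_1 has a unique
    circumcenter for the gauge [\int rho (c - b g)] ([ex_circumcenter],
    [circumcenter_unique]). As L_1 is not uniformly convex this needs a measure
    theoretic argument: nearly optimal centers are close in measure. The affine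
    action permutes the family [b g], so it fixes the circumcenter [c]
    ([equivariant_center]).

    Integrability. It remains to prove that [|c|] is in L_p. Applied to the orbit
    of a function [f] with [0 <= f <= 1], the circumcenter is invariant, hence
    constant by ergodicity, and the gap inequality for the matrix coefficient of
    [f] gives a Poincare inequality: if [f = 1] is not more likely than [f = 0],
    then [mu (f = 1)] is at most a constant times the sum over [t] in [s] of
    [\int |f \o act t^-1 - f| ^ 2] ([koopman_gap], [koopman_level]). Take for [f]
    a ramp that is 0 where [|c| <= 2 ^ n] and 1 where [|c| >= 2 ^ n.+1]. Since
    [|c|] moves by at most [|b t|] under [t], this bounds
    [mu (|c| > 2 ^ n.+1)] by a small multiple of [mu (|c| > 2 ^ n)] plus a
    multiple of [\sum_(t <- s) mu (|b t| > e * 2 ^ n)] ([level_decay]). Multiplied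
    by [2 ^ (n p)] the last terms are summable because [b t] is in L_p, and the
    sum over [n] shows that so is [c] ([solution_integrable]). *)

(** * The energy of a function relative to a positive semidefinite kernel *)

Lemma cvg_sumr (R : realType) (I T : Type) (F : set_system T) {FF : Filter F} (r : seq I)
    (f : I -> T -> R) (l : I -> R) : (forall i, f i x @[x --> F] --> l i) ->
  \sum_(i <- r) f i x @[x --> F] --> \sum_(i <- r) l i.
Proof.
move=> fl; elim: r => [|i r IH].
  by under eq_fun do rewrite big_nil; rewrite big_nil; exact: cvg_cst.
by under eq_fun do rewrite big_cons; rewrite big_cons; exact: cvgD.
Qed.

Section kernel_energy.
Context (R : realType) (X : Type) (K : X -> X -> R).
Implicit Types (F G : X -> R) (w v : seq (R * X)) (t : R).

Definition pairing F w := \sum_(p <- w) p.1 * F p.2.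
Definition wscale t w := [seq (t * p.1, p.2) | p <- w].
Definition kspan w : X -> R := fun x => \sum_(p <- w) p.1 * K p.2 x.
Definition qform w := pairing (kspan w) w.
Definition psd_kernel := (forall x y, K x y = K y x) /\ forall w, 0 <= qform w.

(** For [F] in the Hilbert space with reproducing kernel [K] the supremum of
    [2 <F, w> - <w, w>] over finite combinations [w] of kernel functions is the
    squared norm of [F]. Taken as a definition it needs neither an inner product
    nor a completion. *)
Definition energy_at F w := 2 * pairing F w - qform w.
Definition finite_energy F := exists M, forall w, energy_at F w <= M.
Definition energy F : R := sup [set energy_at F w | w in setT].

Lemma pairing_cat F w v : pairing F (w ++ v) = pairing F w + pairing F v.
Proof. exact: big_cat. Qed.

Lemma pairing_wscale F t w : pairing F (wscale t w) = t * pairing F w.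
Proof.
by rewrite /pairing big_map mulr_sumr; apply: eq_bigr => p _; rewrite mulrA.
Qed.

Lemma pairingP t F G w : pairing (t *: F + G) w = t * pairing F w + pairing G w.
Proof.
rewrite /pairing mulr_sumr -big_split; apply: eq_bigr => p _ /=.
by rewrite fctE/= scalrfctE mulrDr mulrCA.
Qed.

Lemma kspan_cat w v : kspan (w ++ v) = kspan w + kspan v.
Proof. by apply/funext => x; rewrite /kspan big_cat fctE. Qed.

Lemma kspan_wscale t w : kspan (wscale t w) = t *: kspan w.
Proof.
apply/funext => x; rewrite /kspan big_map scalrfctE [RHS]mulr_sumr.
by apply: eq_bigr => p _; rewrite mulrA.
Qed.

Lemma pairingD F G w : pairing (F + G) w = pairing F w + pairing G w.
Proof. by rewrite -{1}[F]scale1r pairingP mul1r. Qed.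

Lemma pairingZ t F w : pairing (t *: F) w = t * pairing F w.
Proof.
rewrite /pairing mulr_sumr; apply: eq_bigr => p _; by rewrite scalrfctE mulrCA.
Qed.

Lemma pairingB F G w : pairing (F - G) w = pairing F w - pairing G w.
Proof. by rewrite -scaleN1r pairingD pairingZ mulN1r. Qed.

Lemma pairing_nil F : pairing F [::] = 0.
Proof. exact: big_nil. Qed.

Hypothesis Kpsd : psd_kernel.

Lemma kspanC w v : pairing (kspan w) v = pairing (kspan v) w.
Proof.
rewrite /pairing /kspan; under eq_bigr do rewrite mulr_sumr.
rewrite exchange_big/=; apply: eq_bigr => p _; rewrite mulr_sumr.
by apply: eq_bigr => r _; rewrite Kpsd.1 mulrCA.
Qed.

Lemma qformD t w v :
  qform (w ++ wscale t v) = qform w + 2 * t * pairing (kspan w) v + t ^+ 2 * qform v.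
Proof.
rewrite /qform kspan_cat kspan_wscale pairing_cat pairing_wscale !pairingD !pairingZ.
by rewrite (kspanC v w); ring.
Qed.

Lemma qformZ t w : qform (wscale t w) = t ^+ 2 * qform w.
Proof. by rewrite /qform kspan_wscale pairing_wscale pairingZ; ring. Qed.

Lemma qform_nil : qform [::] = 0.
Proof. exact: pairing_nil. Qed.

Lemma energy_at_le F w : finite_energy F -> energy_at F w <= energy F.
Proof.
move=> [M FM]; apply: ub_le_sup; last by exists w.
by exists M => _ [v _ <-].
Qed.

Lemma energy_le F M : (forall w, energy_at F w <= M) -> energy F <= M.
Proof.
move=> FM; apply: ge_sup; first by exists (energy_at F [::]), [::].
by move=> _ [w _ <-].
Qed.

Lemma energy_ge0 F : finite_energy F -> 0 <= energy F.
Proof.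
move=> /(energy_at_le [::]); apply: le_trans.
by rewrite /energy_at pairing_nil qform_nil mulr0 subr0.
Qed.

Lemma energy_atZ t F w : t != 0 -> energy_at (t *: F) w = t ^+ 2 * energy_at F (wscale t^-1 w).
Proof.
by move=> t0; rewrite /energy_at pairingZ pairing_wscale qformZ; field.
Qed.

Lemma energy_at0 w : energy_at 0 w <= 0.
Proof.
have -> : (0 : X -> R) = 0 *: 0 by rewrite scaler0.
by rewrite /energy_at pairingZ mul0r mulr0 sub0r oppr_le0 Kpsd.2.
Qed.

Lemma finite_energy0 : finite_energy 0.
Proof. by exists 0 => w; exact: energy_at0. Qed.

Lemma energy0 : energy 0 = 0.
Proof.
apply/eqP; rewrite eq_le energy_ge0 ?andbT; last exact: finite_energy0.
by apply: energy_le; exact: energy_at0.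
Qed.

Lemma finite_energyZ t F : finite_energy F -> finite_energy (t *: F).
Proof.
have [->|t0] := eqVneq t 0; first by rewrite scale0r => _; exact: finite_energy0.
move=> [M FM]; exists (t ^+ 2 * M) => w; rewrite energy_atZ//.
by rewrite ler_wpM2l ?sqr_ge0.
Qed.

Lemma energyZ t F : finite_energy F -> energy (t *: F) = t ^+ 2 * energy F.
Proof.
have [->|t0] := eqVneq t 0; first by rewrite scale0r energy0 expr0n mul0r.
have le s G : s != 0 -> finite_energy G -> energy (s *: G) <= s ^+ 2 * energy G.
  move=> s0 fG; apply: energy_le => w; rewrite energy_atZ// ler_wpM2l ?sqr_ge0//.
  exact: energy_at_le.
move=> fF; apply/eqP; rewrite eq_le le//=.
have := le t^-1 (t *: F); rewrite invr_eq0 t0 scalerA mulVf// scale1r.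
move=> /(_ isT (finite_energyZ _ fF)).
by rewrite exprVn mulrC ler_pdivlMr ?exprn_even_gt0// mulrC.
Qed.

Lemma finite_energyD F G : finite_energy F -> finite_energy G -> finite_energy (F + G).
Proof.
move=> /(finite_energyZ 2)[M FM] /(finite_energyZ 2)[N GN].
exists ((M + N) / 2) => w; have := FM w; have := GN w.
by rewrite /energy_at pairingD !pairingZ; lra.
Qed.

Lemma ler_wpM_energy c F M : 0 <= c ->
  (forall w, c * energy_at F w <= M) -> c * energy F <= M.
Proof.
move=> c0 FM; have [c00|cn0] := eqVneq c 0.
  by have := FM [::]; rewrite c00 !mul0r.
have cp : 0 < c by rewrite lt_def cn0.
by rewrite -ler_pdivlMl//; apply: energy_le => w; rewrite ler_pdivlMl.
Qed.

Lemma energyD_le F G a c M : 0 <= a -> 0 <= c ->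
  (forall w v, a * energy_at F w + c * energy_at G v <= M) ->
  a * energy F + c * energy G <= M.
Proof.
move=> a0 c0 FG; rewrite -lerBrDr; apply: ler_wpM_energy => // w.
by rewrite lerBrDl -lerBrDr; apply: ler_wpM_energy => // v; rewrite lerBrDr addrC.
Qed.

Lemma energy_atDZ t F w v : energy_at F (w ++ wscale t v) =
  energy_at F w + t * (2 * pairing F v) - 2 * t * pairing (kspan w) v - t ^+ 2 * qform v.
Proof. by rewrite /energy_at pairing_cat pairing_wscale qformD; ring. Qed.

Lemma finite_energyB F G : finite_energy F -> finite_energy G -> finite_energy (F - G).
Proof.
by move=> fF fG; rewrite -scaleN1r; apply: finite_energyD => //; exact: finite_energyZ.
Qed.

(** The identity that makes the energy quadratic. Testing the two functions on the
    left with [w] and [v] amounts to testing [F] with [w + (1 - l) v] and [G] with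
    [w - l v]; this change of variables is invertible, so both sides are suprema of
    the same expressions. *)
Lemma energy_convexE (l : R) F G : 0 <= l <= 1 -> finite_energy F -> finite_energy G ->
  energy (l *: F + (1 - l) *: G) + l * (1 - l) * energy (F - G) =
  l * energy F + (1 - l) * energy G.
Proof.
move=> /andP[l0 l1] fF fG; have l1' : 0 <= 1 - l by rewrite subr_ge0.
have fFG := finite_energyB fF fG.
have fl : finite_energy (l *: F + (1 - l) *: G).
  by apply: finite_energyD; exact: finite_energyZ.
have ll : 0 <= l * (1 - l) by rewrite mulr_ge0.
apply/eqP; rewrite eq_le; apply/andP; split.
- rewrite -[energy _]mul1r; apply: energyD_le => // w v.
  have := ler_wpM2l l0 (energy_at_le (w ++ wscale (1 - l) v) fF).
  have := ler_wpM2l l1' (energy_at_le (w ++ wscale (- l) v) fG).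
  rewrite !energy_atDZ /energy_at !(pairingB, pairingD) !pairingZ; lra.
- apply: energyD_le => // w v.
  have := energy_at_le (wscale l w ++ wscale (1 - l) v) fl.
  have := ler_wpM2l ll (energy_at_le (w ++ wscale (-1) v) fFG).
  rewrite !energy_atDZ /energy_at !pairing_wscale qformZ !kspan_wscale.
  rewrite !(pairingB, pairingD) !pairingZ; lra.
Qed.

Definition polar F G := (energy (F + G) - energy F - energy G) / 2.

Lemma polarC F G : polar F G = polar G F.
Proof. by rewrite /polar [G + F]addrC; congr (_ / _); rewrite addrAC. Qed.

Lemma polarFF F : finite_energy F -> polar F F = energy F.
Proof.
by move=> fF; rewrite /polar -mulr2n -[F *+ 2]scaler_nat energyZ//; field.
Qed.

Lemma parallelogram F G : finite_energy F -> finite_energy G ->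
  energy (F + G) + energy (F - G) = 2 * (energy F + energy G).
Proof.
move=> fF fG; have := @energy_convexE 2^-1 F G.
have -> : 1 - 2^-1 = 2^-1 :> R by field.
rewrite -scalerDr energyZ; last exact: finite_energyD.
move=> /(_ _ fF fG) H; have : 0 <= (2^-1 : R) <= 1 by lra.
by move=> /H; lra.
Qed.

Lemma polarNr F G : finite_energy F -> finite_energy G -> polar F (- G) = - polar F G.
Proof.
move=> fF fG; have := parallelogram fF fG.
rewrite /polar; have := energyZ (-1) fG; rewrite scaleN1r; lra.
Qed.

(** The convexity identity between [F + G] and [F] gives homogeneity for scalars in
    the unit interval; inversion and the parallelogram law extend it to all reals. *)
Lemma polarZr t F G : finite_energy F -> finite_energy G -> polar F (t *: G) = t * polar F G.
Proof.
have unit s H : 0 <= s <= 1 -> finite_energy F -> finite_energy H ->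
    polar F (s *: H) = s * polar F H.
  move=> s01 fF fH; rewrite /polar energyZ//.
  have := energy_convexE s01 (finite_energyD fF fH) fF.
  rewrite [F + H - F]addrC addKr scalerDr addrAC -scalerDl subrKC scale1r => H1.
  by have := H1; lra.
have nneg s H : 0 <= s -> finite_energy F -> finite_energy H ->
    polar F (s *: H) = s * polar F H.
  move=> s0 fF fH; have [s1|s1] := leP s 1; first by apply: unit => //; rewrite s0.
  have sn0 : s != 0 by rewrite gt_eqF// (lt_trans _ s1).
  have := unit s^-1 (s *: H); rewrite scalerA mulVf// scale1r => -> //; last first.
  - exact: finite_energyZ.
  - by rewrite invr_ge0 s0/= invf_le1 ?(lt_trans _ s1)// ltW.
  - by rewrite mulrA divff// mul1r.
move=> fF fG; have [t0|t0] := leP 0 t; first exact: nneg.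
have := polarNr fF (finite_energyZ t fG).
by rewrite -scaleNr nneg ?oppr_ge0 ?ltW//; lra.
Qed.

Lemma polarDr F G H : finite_energy F -> finite_energy G -> finite_energy H ->
  polar F (G + H) = polar F G + polar F H.
Proof.
move=> fF fG fH; have half : 0 <= (2^-1 : R) <= 1 by lra.
have halfE : 1 - 2^-1 = 2^-1 :> R by field.
have := energy_convexE half (finite_energyD fF fG) (finite_energyD fF fH).
have := energy_convexE half fG fH; rewrite halfE -!scalerDr.
have -> : F + G - (F + H) = G - H by rewrite opprD addrACA subrr add0r.
have -> : 2^-1 *: (F + G + (F + H)) = F + 2^-1 *: (G + H).
  by apply/funext => x; rewrite !fctE /GRing.scale/=; field.
move=> E1 E2.
have := polarZr 2^-1 fF (finite_energyD fG fH).
move: E1 E2; rewrite /polar /GRing.scale/=; lra.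
Qed.

Lemma polarDl F G H : finite_energy F -> finite_energy G -> finite_energy H ->
  polar (F + G) H = polar F H + polar G H.
Proof. by move=> fF fG fH; rewrite polarC polarDr// polarC (polarC H). Qed.

Lemma polarZl t F G : finite_energy F -> finite_energy G -> polar (t *: F) G = t * polar F G.
Proof. by move=> fF fG; rewrite polarC polarZr// polarC. Qed.

Lemma energyD F G : finite_energy F -> finite_energy G ->
  energy (F + G) = energy F + 2 * polar F G + energy G.
Proof. by move=> fF fG; rewrite /polar; field. Qed.

Lemma energy_at_sub_kspan F w v :
  energy_at (F - kspan w) v = energy_at F (v ++ wscale 1 w) - 2 * pairing F w + qform w.
Proof. by rewrite energy_atDZ /energy_at pairingB (kspanC v w); ring. Qed.

Lemma finite_energy_kspan w : finite_energy (kspan w).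
Proof.
rewrite -[kspan w]opprK -[- kspan w]sub0r -scaleN1r.
apply: finite_energyZ; exists (qform w) => v.
rewrite energy_at_sub_kspan -[X in 2 * pairing X _](scale0r 0) pairingZ mul0r mulr0 subr0.
by rewrite gerDr energy_at0.
Qed.

(** Test combinations that nearly attain the supremum approximate [F] itself. *)
Lemma energy_sub_kspan F w : finite_energy F ->
  energy (F - kspan w) <= energy F - energy_at F w.
Proof.
move=> fF; apply: energy_le => v; rewrite energy_at_sub_kspan.
have := energy_at_le (v ++ wscale 1 w) fF; rewrite /(energy_at F w); lra.
Qed.

Lemma kspan_dense F e : finite_energy F -> 0 < e -> exists w, energy (F - kspan w) < e.
Proof.
move=> fF e0.
have hs : has_sup [set energy_at F w | w in setT].
  by split; [exists (energy_at F [::]), [::]|case: fF => M FM; exists M => _ [w _ <-]].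
have [_ [w _ <-] ltw] := sup_adherent e0 hs; exists w.
apply: le_lt_trans (energy_sub_kspan w fF) _.
by rewrite ltrBlDr -ltrBlDl.
Qed.

Lemma energy_kspan w : energy (kspan w) <= qform w.
Proof.
apply: energy_le => v; have := Kpsd.2 (v ++ wscale (-1) w).
by rewrite qformD /energy_at (kspanC v w); lra.
Qed.

Lemma energy_kspanE w : energy (kspan w) = qform w.
Proof.
apply/eqP; rewrite eq_le energy_kspan/=.
apply: le_trans (energy_at_le w (finite_energy_kspan w)).
by rewrite /energy_at -/(qform w); lra.
Qed.

(** The Cauchy-Schwarz inequality: test [F] against all multiples of [w]. *)
Lemma sqr_pairing_le F w : finite_energy F -> pairing F w ^+ 2 <= energy F * qform w.
Proof.
move=> fF.
have E s : 2 * s * pairing F w - s ^+ 2 * qform w <= energy F.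
  have := energy_at_le (wscale s w) fF.
  by rewrite /energy_at pairing_wscale qformZ mulrA.
have [q0|qn0] := eqVneq (qform w) 0.
  rewrite q0 mulr0; have [->|F0] := eqVneq (pairing F w) 0; first by rewrite expr0n.
  have := E ((energy F + 1) / (2 * pairing F w)); rewrite q0 mulr0 subr0.
  have -> : 2 * ((energy F + 1) / (2 * pairing F w)) * pairing F w = energy F + 1 by field.
  by lra.
have qp : 0 < qform w by rewrite lt_def qn0 Kpsd.2.
rewrite -ler_pdivrMr//; apply: le_trans (E (pairing F w / qform w)).
by rewrite le_eqVlt; apply/orP; left; apply/eqP; field.
Qed.

Lemma qform1 x : qform [:: (1, x)] = K x x.
Proof. by rewrite /qform /pairing /kspan !big_seq1/= !mul1r. Qed.

Lemma psd_kernel_ge0 x : 0 <= K x x.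
Proof. by rewrite -qform1; exact: Kpsd.2. Qed.

(** Evaluation at a point is a bounded functional. *)
Lemma sqr_eval_le F x : finite_energy F -> F x ^+ 2 <= energy F * K x x.
Proof.
by move/(sqr_pairing_le [:: (1, x)]); rewrite qform1 /pairing big_seq1/= mul1r.
Qed.

Lemma energyD_le2 F G : finite_energy F -> finite_energy G ->
  energy (F + G) <= 2 * (energy F + energy G).
Proof.
move=> fF fG; rewrite -parallelogram// lerDl energy_ge0//; exact: finite_energyB.
Qed.

Lemma qformE w : qform w = \sum_(r <- w) \sum_(p <- w) r.1 * p.1 * K p.2 r.2.
Proof.
by apply: eq_bigr => r _; rewrite /kspan mulr_sumr; apply: eq_bigr => p _; rewrite mulrA.
Qed.

Section kernel_symmetry.
Variables (T T' : X -> X).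
Hypotheses (TK : cancel T T') (T'K : cancel T' T) (KT : forall x y, K (T x) (T y) = K x y).

Definition wmap (f : X -> X) w := [seq (p.1, f p.2) | p <- w].

Lemma energy_at_comp F w : energy_at (F \o T) w = energy_at F (wmap T w).
Proof.
rewrite /energy_at; congr (2 * _ - _); first by rewrite /pairing big_map.
rewrite !qformE big_map; apply: eq_bigr => r _; rewrite big_map.
by apply: eq_bigr => p _ /=; rewrite KT.
Qed.

Lemma finite_energy_comp F : finite_energy F -> finite_energy (F \o T).
Proof. by move=> [M FM]; exists M => w; rewrite energy_at_comp. Qed.

Lemma energy_comp F : finite_energy F -> energy (F \o T) = energy F.
Proof.
move=> fF; apply/eqP; rewrite eq_le; apply/andP; split; apply: energy_le => w.
  by rewrite energy_at_comp; exact: energy_at_le.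
have {1}-> : w = wmap T (wmap T' w).
  rewrite /wmap -map_comp -[LHS]map_id; apply/eq_map => p.
  by rewrite /= T'K -surjective_pairing.
by rewrite -energy_at_comp; exact/energy_at_le/finite_energy_comp.
Qed.

Lemma kspan_comp w : kspan w \o T = kspan (wmap T' w).
Proof.
apply/funext => x; rewrite /kspan big_map/=; apply: eq_bigr => p _.
by rewrite -{1}(T'K p.2) KT.
Qed.

End kernel_symmetry.

End kernel_energy.

(** * The complex Hilbert space of a kernel *)

Section rkhs_module.
Context (R : realType) (X : Type) (K : X -> X -> R).
Implicit Types f g : X -> R[i].

Definition re f : X -> R := fun x => complex.Re (f x).
Definition im f : X -> R := fun x => complex.Im (f x).

Lemma reP (a : R[i]) f g :
  re (a *: f + g) = (complex.Re a *: re f - complex.Im a *: im f) + re g.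
Proof.
by apply/funext => x; rewrite /re /im !fctE /GRing.scale/=; case: a (f x) (g x) => ? ? [? ?] [].
Qed.

Lemma imP (a : R[i]) f g :
  im (a *: f + g) = (complex.Re a *: im f + complex.Im a *: re f) + im g.
Proof.
by apply/funext => x; rewrite /re /im !fctE /GRing.scale/=; case: a (f x) (g x) => ? ? [? ?] [].
Qed.

Lemma re0 : re 0 = 0. Proof. by []. Qed.
Lemma im0 : im 0 = 0. Proof. by []. Qed.

Lemma reB f g : re (f - g) = re f - re g.
Proof. by apply/funext => x; rewrite /re !fctE/=; case: (f x) (g x) => ? ? []. Qed.

Lemma imB f g : im (f - g) = im f - im g.
Proof. by apply/funext => x; rewrite /im !fctE/=; case: (f x) (g x) => ? ? []. Qed.

Definition rkhs_pred of psd_kernel K : {pred (X -> R[i])} :=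
  fun f => `[< finite_energy K (re f) /\ finite_energy K (im f) >].

Variable Kpsd : psd_kernel K.

Lemma rkhs_submod_closed : submod_closed (rkhs_pred Kpsd).
Proof.
split; first by apply/asboolP; rewrite re0 im0; split; exact: finite_energy0.
move=> a f g /asboolP[fr fi] /asboolP[gr gi]; apply/asboolP.
rewrite reP imP; split.
  apply: finite_energyD => //; apply: finite_energyB => //; exact: finite_energyZ.
by apply: finite_energyD => //; apply: finite_energyD => //; exact: finite_energyZ.
Qed.

HB.instance Definition _ := GRing.isSubmodClosed.Build _ _ (rkhs_pred Kpsd)
  rkhs_submod_closed.

Record rkhs := Rkhs { rkhs_val :> X -> R[i] ; rkhsP : rkhs_val \in rkhs_pred Kpsd }.

HB.instance Definition _ := [isSub for rkhs_val].
HB.instance Definition _ := [Choice of rkhs by <:].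
HB.instance Definition _ := [SubChoice_isSubLmodule of rkhs by <:].

Implicit Types u v w : rkhs.

Lemma rkhs_re u : finite_energy K (re u). Proof. by have /asboolP[] := rkhsP u. Qed.
Lemma rkhs_im u : finite_energy K (im u). Proof. by have /asboolP[] := rkhsP u. Qed.
Hint Resolve rkhs_re rkhs_im : core.

Definition rkhs_dot u v : R[i] :=
  ((polar K (re u) (re v) + polar K (im u) (im v)) +i*
   (polar K (im u) (re v) - polar K (re u) (im v)))%C.

Lemma rkhs_dotC u v : rkhs_dot u v = conjC (rkhs_dot v u).
Proof.
rewrite /rkhs_dot -[RHS]/(_ +i* _)%C; congr (_ +i* _)%C.
  by rewrite polarC [polar K (im u) _]polarC.
by rewrite opprB polarC [polar K (re u) _]polarC.
Qed.

Lemma polar_linear a b F G H L : finite_energy K F -> finite_energy K G ->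
    finite_energy K H -> finite_energy K L ->
  polar K (a *: F + b *: G + H) L = a * polar K F L + b * polar K G L + polar K H L.
Proof.
move=> fF fG fH fL; have fa := finite_energyZ Kpsd a fF; have fb := finite_energyZ Kpsd b fG.
by rewrite polarDl ?polarDl ?polarZl//; exact: finite_energyD.
Qed.

Lemma rkhs_dotP a u v w : rkhs_dot (a *: u + v) w = a * rkhs_dot u w + rkhs_dot v w.
Proof.
rewrite /rkhs_dot.
have -> : re (a *: u + v) = re (a *: (u : X -> R[i]) + v) by [].
have -> : im (a *: u + v) = im (a *: (u : X -> R[i]) + v) by [].
rewrite reP imP -scaleNr !polar_linear//.
by case: a => a b /=; congr (_ +i* _)%C; ring.
Qed.

Lemma rkhs_dot_bilinear : bilinear_for (GRing.Scale.Law.clone _ _ *%R _)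
  (GRing.Scale.Law.clone _ _ (conjC \; *%R) _) rkhs_dot.
Proof.
split=> u a v w /=; first exact: rkhs_dotP.
by rewrite rkhs_dotC rkhs_dotP rmorphD rmorphM/= -!rkhs_dotC.
Qed.

HB.instance Definition _ := bilinear_isBilinear.Build R[i] rkhs rkhs _ _ _ rkhs_dot
  rkhs_dot_bilinear.

Lemma rkhs_dot_hermitian u v : rkhs_dot u v = (-1) ^+ false * conjC (rkhs_dot v u).
Proof. by rewrite expr0 mul1r; exact: rkhs_dotC. Qed.

HB.instance Definition _ := isHermitianSesquilinear.Build R[i] rkhs false conjC rkhs_dot
  rkhs_dot_hermitian.

Definition rkhs_energy u : R := energy K (re u) + energy K (im u).

Lemma rkhs_dotuu u : rkhs_dot u u = (rkhs_energy u)%:C%C.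
Proof.
by rewrite /rkhs_dot !polarFF// [polar K (im u) _]polarC subrr.
Qed.

Lemma rkhs_energy_ge0 u : 0 <= rkhs_energy u.
Proof. by rewrite addr_ge0// energy_ge0. Qed.

Lemma sqr_rkhs_re_le u x : complex.Re (u x) ^+ 2 <= rkhs_energy u * K x x.
Proof.
apply: le_trans (sqr_eval_le Kpsd x (rkhs_re u)) _.
rewrite /rkhs_energy mulrDl lerDl; apply: le_trans (sqr_eval_le Kpsd x (rkhs_im u)).
exact: sqr_ge0.
Qed.

Lemma sqr_rkhs_im_le u x : complex.Im (u x) ^+ 2 <= rkhs_energy u * K x x.
Proof.
apply: le_trans (sqr_eval_le Kpsd x (rkhs_im u)) _.
rewrite /rkhs_energy mulrDl lerDr; apply: le_trans (sqr_eval_le Kpsd x (rkhs_re u)).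
exact: sqr_ge0.
Qed.

Lemma rkhs_energy_eq0 u : rkhs_energy u = 0 -> u = 0.
Proof.
move=> u0; apply/val_inj/funext => x /=.
have := sqr_rkhs_re_le u x; have := sqr_rkhs_im_le u x; rewrite u0 mul0r !real_exprn_even_le0//=.
by case: (rkhs_val u x) => a b /= /eqP-> /eqP->.
Qed.

Lemma rkhs_energyZ a u : rkhs_energy (a *: u) = (complex.Re a ^+ 2 + complex.Im a ^+ 2) * rkhs_energy u.
Proof.
have := rkhs_dotuu (a *: u).
rewrite linearZl_LR/= linearZr_LR/= rkhs_dotuu mulrA -normCK -add_Re2_Im2 -rmorphM/=.
by move=> /complexI <-.
Qed.

Lemma rkhs_dot_pos u : u != 0 -> 0 < rkhs_dot u u.
Proof.
move=> u0; rewrite rkhs_dotuu -[0]/(0%:C)%C ltcR lt_def rkhs_energy_ge0 andbT.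
by apply: contra u0 => /eqP/rkhs_energy_eq0 ->.
Qed.

HB.instance Definition _ := isDotProduct.Build R[i] rkhs rkhs_dot rkhs_dot_pos.

Lemma rkhs_energyD t u v : rkhs_energy (u + (t%:C)%C *: v) =
  rkhs_energy u + 2 * t * complex.Re (rkhs_dot u v) + t ^+ 2 * rkhs_energy v.
Proof.
have E (F G : X -> R) : finite_energy K F -> finite_energy K G ->
    energy K (t *: F + G) = energy K G + 2 * t * polar K G F + t ^+ 2 * energy K F.
  move=> fF fG; have ft := finite_energyZ Kpsd t fF.
  by rewrite addrC energyD// polarZr// energyZ// mulrA.
rewrite addrC /rkhs_energy.
have -> : re ((t%:C)%C *: v + u) = re ((t%:C)%C *: (v : X -> R[i]) + u) by [].
have -> : im ((t%:C)%C *: v + u) = im ((t%:C)%C *: (v : X -> R[i]) + u) by [].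
by rewrite reP imP/= scale0r subr0 scale0r addr0 !E//; ring.
Qed.

Definition rkhs_rnorm u : R := Num.sqrt (rkhs_energy u).

(** The discriminant of the nonnegative quadratic [t |-> rkhs_energy (u + t v)] gives
    Cauchy-Schwarz, hence the triangle inequality. *)
Lemma rkhs_rnormD u v : rkhs_rnorm (u + v) <= rkhs_rnorm u + rkhs_rnorm v.
Proof.
have [v0|vn0] := eqVneq (rkhs_energy v) 0.
  by rewrite (rkhs_energy_eq0 v0) addr0 lerDl sqrtr_ge0.
have vp : 0 < rkhs_energy v by rewrite lt_def vn0 rkhs_energy_ge0.
set c := complex.Re (rkhs_dot u v).
have cuv : c ^+ 2 <= rkhs_energy u * rkhs_energy v.
  have := mulr_ge0 (ltW vp) (rkhs_energy_ge0 (u + ((- c / rkhs_energy v)%:C)%C *: v)).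
  rewrite rkhs_energyD -/c -[c ^+ 2 <= _]subr_ge0; congr (is_true (_ <= _)).
  by field.
rewrite -(ler_pXn2r (ltn0Sn 1)) ?nnegrE ?addr_ge0 ?sqrtr_ge0//.
rewrite sqrrD !sqr_sqrtr ?rkhs_energy_ge0//.
have := rkhs_energyD 1 u v; rewrite scale1r => ->.
rewrite -/c mulr1 expr1n mul1r lerD2r lerD2l -[leRHS]mulr_natl ler_pM2l//.
rewrite (le_trans (ler_norm _))//.
rewrite -(ler_pXn2r (ltn0Sn 1)) ?nnegrE ?mulr_ge0 ?sqrtr_ge0//.
by rewrite exprMn !sqr_sqrtr ?rkhs_energy_ge0// real_normK// num_real.
Qed.

Definition rkhs_norm u : R[i] := (rkhs_rnorm u)%:C%C.

Let normD u v : rkhs_norm (u + v) <= rkhs_norm u + rkhs_norm v.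
Proof. by rewrite -rmorphD/= lecR rkhs_rnormD. Qed.

Let normZ a u : rkhs_norm (a *: u) = `|a| * rkhs_norm u.
Proof.
rewrite /rkhs_norm /rkhs_rnorm rkhs_energyZ sqrtrM ?addr_ge0 ?sqr_ge0// rmorphM/=.
by rewrite normc_def.
Qed.

Let norm_eq0 u : rkhs_norm u = 0 -> u = 0.
Proof.
move=> /complexI/eqP; rewrite sqrtr_eq0 => u0; apply: rkhs_energy_eq0.
by apply/eqP; rewrite eq_le u0 rkhs_energy_ge0.
Qed.

HB.instance Definition _ := Lmodule_isNormed.Build R[i] rkhs normD normZ norm_eq0.

Lemma rkhs_normE u : `|u| = ((rkhs_rnorm u)%:C)%C. Proof. by []. Qed.

Lemma rkhs_norm_sqr u : `|u| ^+ 2 = rkhs_dot u u.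
Proof.
by rewrite rkhs_normE -rmorphXn/= sqr_sqrtr ?rkhs_energy_ge0// rkhs_dotuu.
Qed.

Lemma rkhs_rnorm_le_energy u e : 0 <= e -> (rkhs_rnorm u <= e) = (rkhs_energy u <= e ^+ 2).
Proof.
by move=> e0; rewrite -{1}(ler_pXn2r (ltn0Sn 1)) ?nnegrE ?sqrtr_ge0// sqr_sqrtr ?rkhs_energy_ge0.
Qed.

Lemma rkhs_rnorm_re u x : `|complex.Re (u x)| <= rkhs_rnorm u * Num.sqrt (K x x).
Proof.
rewrite -(ler_pXn2r (ltn0Sn 1)) ?nnegrE ?mulr_ge0 ?sqrtr_ge0//.
have K0 := psd_kernel_ge0 Kpsd x.
by rewrite exprMn !sqr_sqrtr ?rkhs_energy_ge0// real_normK ?num_real// sqr_rkhs_re_le.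
Qed.

Lemma rkhs_rnorm_im u x : `|complex.Im (u x)| <= rkhs_rnorm u * Num.sqrt (K x x).
Proof.
rewrite -(ler_pXn2r (ltn0Sn 1)) ?nnegrE ?mulr_ge0 ?sqrtr_ge0//.
have K0 := psd_kernel_ge0 Kpsd x.
by rewrite exprMn !sqr_sqrtr ?rkhs_energy_ge0// real_normK ?num_real// sqr_rkhs_im_le.
Qed.

Lemma rkhs_ballE u (e : R) v : ball u (e%:C)%C v <-> rkhs_rnorm (u - v) < e.
Proof.
by rewrite -ball_normE /ball_/= rkhs_normE ltcR.
Qed.

(** The image of a Cauchy filter by a Lipschitz function is Cauchy, and the reals are
    complete. *)
Lemma cauchy_functional_cvg (F : set_system rkhs) (FF : ProperFilter F) (L : rkhs -> R) C :
  (forall e : R, 0 < e -> exists u, F [set v | rkhs_rnorm (u - v) < e]) ->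
  (forall u v, `|L u - L v| <= rkhs_rnorm (u - v) * C) ->
  cvg (L @ F).
Proof.
move=> Fc LC; apply: R_complete; apply: cauchy_exP => e e0.
have C1 : 0 < `|C| + 1 by rewrite ltr_wpDl.
have [u Fu] := Fc _ (divr_gt0 e0 C1); exists (L u).
change (F (L @^-1` ball (L u) e)).
apply: filterS Fu => v /= uv; rewrite -ball_normE /ball_/=.
apply: le_lt_trans (LC _ _) _; rewrite ltr_pdivlMr// in uv.
apply: le_lt_trans uv; rewrite ler_wpM2l ?sqrtr_ge0// (le_trans (ler_norm _))//.
by rewrite lerDl.
Qed.

Lemma cvg_energy_at (F : set_system rkhs) (FF : ProperFilter F) (L : X -> rkhs -> R)
    (l : X -> R) (G : X -> R) (w : seq (R * X)) :
  (forall x, L x u @[u --> F] --> l x) ->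
  energy_at K (fun x => G x - L x u) w @[u --> F] --> energy_at K (fun x => G x - l x) w.
Proof.
move=> Ll; rewrite /energy_at; apply: cvgB; last exact: cvg_cst.
apply: cvgMr; elim: w => [|p w IH].
  by under eq_fun do rewrite pairing_nil; rewrite pairing_nil; exact: cvg_cst.
have E (H : X -> R) : pairing H (p :: w) = p.1 * H p.2 + pairing H w.
  by rewrite /pairing big_cons.
under eq_fun do rewrite E; rewrite E; apply: cvgD => //; apply: cvgMr.
by apply: cvgB => //; exact: cvg_cst.
Qed.

(** Evaluations are bounded, so a Cauchy filter has a pointwise limit [l]. For fixed
    test data [energy_at] depends on finitely many values, so energy bounds pass to
    the limit: [l] has finite energy and is the limit in norm. *)
Lemma rkhs_complete (F : set_system rkhs) : ProperFilter F -> cauchy F -> cvg F.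
Proof.
move=> FF /cauchyP Fcau.
have Fc (e : R) : 0 < e -> exists u, F [set v | rkhs_rnorm (u - v) < e].
  move=> e0; have ec0 : 0 < (e%:C)%C :> R[i] by rewrite ltcR.
  have [u Fu] := Fcau _ ec0; exists u; apply: filterS Fu => v.
  by move/rkhs_ballE.
have reB' (u v : rkhs) : re (u - v) = re u - re v by exact: (reB (u : X -> R[i])).
have imB' (u v : rkhs) : im (u - v) = im u - im v by exact: (imB (u : X -> R[i])).
have cvr x : cvg (complex.Re ((u : rkhs) x) @[u --> F]).
  apply: (@cauchy_functional_cvg F FF (fun u : rkhs => complex.Re (u x)) (Num.sqrt (K x x)) Fc) => u v.
  have := rkhs_rnorm_re (u - v) x.
  have -> : complex.Re ((u - v) x) = complex.Re (u x) - complex.Re (v x).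
    exact: (congr1 (@^~ x) (reB' u v)).
  by [].
have cvi x : cvg (complex.Im ((u : rkhs) x) @[u --> F]).
  apply: (@cauchy_functional_cvg F FF (fun u : rkhs => complex.Im (u x)) (Num.sqrt (K x x)) Fc) => u v.
  have := rkhs_rnorm_im (u - v) x.
  have -> : complex.Im ((u - v) x) = complex.Im (u x) - complex.Im (v x).
    exact: (congr1 (@^~ x) (imB' u v)).
  by [].
pose lr x := lim (complex.Re ((u : rkhs) x) @[u --> F]).
pose li x := lim (complex.Im ((u : rkhs) x) @[u --> F]).
pose l : X -> R[i] := fun x => (lr x +i* li x)%C.
have bnd (e : R) (u : rkhs) : 0 < e -> F [set v | rkhs_rnorm (u - v) < e] ->
    (forall w : seq (R * X), energy_at K (re u - lr) w <= e ^+ 2) /\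
    (forall w : seq (R * X), energy_at K (im u - li) w <= e ^+ 2).
  move=> e0 Fu; split=> w.
    apply: (cvgr_to_le (@cvg_energy_at F FF (fun x u => re (u : rkhs) x) lr (re u) w cvr)).
    apply: filterS Fu => v /= uv.
    apply: (@le_trans _ _ (rkhs_energy (u - v))); last first.
      by rewrite -rkhs_rnorm_le_energy ltW.
    rewrite /rkhs_energy ler_wpDr ?energy_ge0//.
    by have := energy_at_le w (rkhs_re (u - v)); rewrite {1}reB'.
  apply: (cvgr_to_le (@cvg_energy_at F FF (fun x u => im (u : rkhs) x) li (im u) w cvi)).
  apply: filterS Fu => v /= uv.
  apply: (@le_trans _ _ (rkhs_energy (u - v))); last first.
    by rewrite -rkhs_rnorm_le_energy ltW.
  rewrite /rkhs_energy ler_wpDl ?energy_ge0//.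
  by have := energy_at_le w (rkhs_im (u - v)); rewrite {1}imB'.
have lP : l \in rkhs_pred Kpsd.
  have [u Fu] := Fc 1 ltr01; have [br bi] := bnd _ _ ltr01 Fu.
  apply/asboolP; split.
    have -> : re l = re u - (re u - lr) by rewrite subKr.
    by apply: finite_energyB => //; exists (1 ^+ 2).
  have -> : im l = im u - (im u - li) by rewrite subKr.
  by apply: finite_energyB => //; exists (1 ^+ 2).
apply/cvg_ex; exists (Rkhs lP); apply/cvg_ballP => eps eps0.
have epsE : eps = ((complex.Re eps)%:C)%C by rewrite RRe_real// gtr0_real.
have e0 : 0 < complex.Re eps / 4 by rewrite divr_gt0// -ltcR -epsE.
have [u Fu] := Fc _ e0; have [br bi] := bnd _ _ e0 Fu.
apply: filterS Fu => v /= uv; rewrite epsE; apply/rkhs_ballE.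
have -> : Rkhs lP - v = (Rkhs lP - u) + (u - v) by rewrite addrA subrK.
apply: le_lt_trans (rkhs_rnormD _ _) _.
have ul : rkhs_rnorm (u - Rkhs lP) <= 2 * (complex.Re eps / 4).
  have e20 : 0 <= 2 * (complex.Re eps / 4) by rewrite mulr_ge0// ltW.
  rewrite rkhs_rnorm_le_energy// /rkhs_energy reB' imB'.
  have := energy_le br; have := energy_le bi; rewrite exprMn; have := sqr_ge0 (complex.Re eps / 4).
  by rewrite /lr /li /re /im/=; lra.
have -> : rkhs_rnorm (Rkhs lP - u) = rkhs_rnorm (u - Rkhs lP).
  by apply: complexI; rewrite -!rkhs_normE distrC.
by lra.
Qed.

HB.instance Definition _ := Uniform_isComplete.Build rkhs rkhs_complete.

Definition rkhs_space : completeNormedModType R[i] := rkhs.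

End rkhs_module.

(** * Kazhdan sets and positive definite functions *)

Section left_invariant_kernel.
Context (R : realType) (G : topologicalGroupType).
Implicit Types (phi : G -> R) (x y g : G).

Definition gkernel phi x y := phi (x^-1 * y)%g.
Definition positive_definite phi := psd_kernel (gkernel phi).

Lemma gkernel_mul phi g x y : gkernel phi (g * x)%g (g * y)%g = gkernel phi x y.
Proof. by rewrite /gkernel invgM -mulgA mulKg. Qed.

Variables (phi : G -> R) (Kpsd : positive_definite phi) (phic : continuous phi).
Let K := gkernel phi.

Let mulK g : cancel (fun x => g * x)%g (fun x => g^-1 * x)%g.
Proof. exact: mulKg. Qed.

Let KV g x y : K (g^-1 * x)%g (g^-1 * y)%g = K x y.
Proof. exact: gkernel_mul. Qed.

Definition ltrans T g (f : G -> T) : G -> T := fun x => f (g^-1 * x)%g.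

Lemma finite_energy_ltrans g F : finite_energy K F -> finite_energy K (ltrans g F).
Proof. exact: (finite_energy_comp (KV g)). Qed.

Lemma energy_ltrans g F : finite_energy K F -> energy K (ltrans g F) = energy K F.
Proof. exact: (energy_comp (@mulK g) (KV g)). Qed.

Lemma ltrans_kspan g w : ltrans g (kspan K w) = kspan K (wmap (fun x => g * x)%g w).
Proof. exact: (kspan_comp (@mulK g) (KV g)). Qed.

(** On combinations of kernel functions the squared distance between two translates
    is a finite sum of values of [phi]. *)
Lemma cvg_kspan_ltrans w g0 :
  energy K (ltrans g (kspan K w) - ltrans g0 (kspan K w)) @[g --> g0] --> (0 : R).
Proof.
pose psi g := 2 * qform K w - 2 * \sum_(r <- w) \sum_(p <- w) r.1 * p.1 *
      phi ((g * p.2)^-1 * (g0 * r.2))%g.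
have gK : (fun g => energy K (ltrans g (kspan K w) - ltrans g0 (kspan K w))) = psi.
  apply/funext => g; rewrite /psi.
  rewrite !ltrans_kspan -scaleN1r -kspan_wscale -kspan_cat energy_kspanE//.
  rewrite qformD//.
  have qg h : qform K (wmap (fun x => h * x)%g w) = qform K w.
    rewrite !qformE big_map; apply: eq_bigr => r _; rewrite big_map.
    by apply: eq_bigr => p _ /=; rewrite /K gkernel_mul.
  rewrite !qg; suff -> : pairing (kspan K (wmap (fun x => (g * x)%g) w))
      (wmap (fun x => (g0 * x)%g) w) = \sum_(r <- w) \sum_(p <- w) r.1 * p.1 *
      phi ((g * p.2)^-1 * (g0 * r.2))%g by lra.
  rewrite /pairing big_map; apply: eq_bigr => r _; rewrite /kspan big_map mulr_sumr.
  by apply: eq_bigr => p _ /=; rewrite mulrA.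
have psi0 : psi g0 = 0 by rewrite -gK subrr energy0.
suff : psi g @[g --> g0] --> psi g0 by rewrite gK psi0.
apply: cvgB; first exact: cvg_cst.
apply: cvgMr; apply: cvg_sumr => r; apply: cvg_sumr => p; apply: cvgMr.
apply: (@continuous_comp _ _ _ (fun g : G => (g * p.2)^-1 * (g0 * r.2))%g phi); last exact: phic.
have mulr_cont (c : G) : continuous (fun g : G => g * c)%g.
  move=> g; apply: (@continuous_comp _ _ _ (fun g : G => (g, c)) (fun x : G * G => x.1 * x.2)%g).
    by apply: cvg_pair; [exact: cvg_id|exact: cvg_cst].
  exact: mulg_continuous.
apply: (@continuous_comp _ _ _ (fun g : G => (g * p.2)^-1)%g
  (fun g : G => g * (g0 * r.2))%g); last exact: mulr_cont.
apply: (@continuous_comp _ _ _ (fun g : G => g * p.2)%g (fun g : G => g^-1)%g); first exact: mulr_cont.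
exact: invg_continuous.
Qed.

(** Translations are isometries, so strong continuity extends from the dense
    combinations of kernel functions to all functions of finite energy. *)
Lemma cvg_energy_ltrans F g0 : finite_energy K F ->
  energy K (ltrans g F - ltrans g0 F) @[g --> g0] --> (0 : R).
Proof.
move=> fF; apply/cvgrPdist_lt => e e0.
have e16 : 0 < e / 16 by rewrite divr_gt0.
have [w wF] := kspan_dense Kpsd fF e16.
set k := kspan K w in wF.
have fk : finite_energy K k by exact: finite_energy_kspan.
have fr : finite_energy K (F - k) by exact: finite_energyB.
have e4 : 0 < e / 4 by rewrite divr_gt0.
have := cvg_kspan_ltrans w g0; rewrite -/k => /cvgrPdist_lt/(_ _ e4).
apply: filterS => g; rewrite !sub0r !normrN => /(le_lt_trans (ler_norm _)) kg.
have fl h H : finite_energy K H -> finite_energy K (ltrans h H) by exact: finite_energy_ltrans.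
rewrite ger0_norm ?energy_ge0//; last by apply: finite_energyB => //; exact: fl.
have -> : ltrans g F - ltrans g0 F =
    (ltrans g k - ltrans g0 k) + (ltrans g (F - k) - ltrans g0 (F - k)).
  by apply/funext => x; rewrite /ltrans !fctE; ring.
apply: le_lt_trans (energyD_le2 Kpsd _ _) _.
- by apply: finite_energyB => //; exact: fl.
- by apply: finite_energyB => //; exact: fl.
have := energyD_le2 Kpsd (fl g _ fr) (finite_energyZ Kpsd (-1) (fl g0 _ fr)).
rewrite scaleN1r -[- ltrans g0 _]scaleN1r energyZ ?energy_ltrans//; last exact: fl.
rewrite sqrrN expr1n mul1r; lra.
Qed.

End left_invariant_kernel.

Section regular_representation.
Context (R : realType) (G : topologicalGroupType) (phi : G -> R).
Hypotheses (Kpsd : positive_definite phi) (phic : continuous phi).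
Let K := gkernel phi.
Let H : completeNormedModType R[i] := rkhs_space Kpsd.

Lemma ltrans_rkhs g (u : rkhs Kpsd) : ltrans g (u : G -> R[i]) \in rkhs_pred Kpsd.
Proof.
apply/asboolP; split.
  exact: (finite_energy_ltrans _ (rkhs_re u)).
exact: (finite_energy_ltrans _ (rkhs_im u)).
Qed.

Definition regrep_fun g (u : H) : H := Rkhs (ltrans_rkhs g u).

Lemma regrep_linear g : linear (regrep_fun g).
Proof. by move=> a u v; apply/val_inj. Qed.

Lemma rkhs_energy_ltrans g (u : H) : rkhs_energy (regrep_fun g u) = rkhs_energy u.
Proof.
by congr (_ + _); [exact: (energy_ltrans _ (rkhs_re u))|exact: (energy_ltrans _ (rkhs_im u))].
Qed.

Lemma regrep_isometry g u : `|regrep_fun g u| = `|u|.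
Proof. by rewrite !rkhs_normE /rkhs_rnorm rkhs_energy_ltrans. Qed.

Lemma regrep1 u : regrep_fun 1%g u = u.
Proof.
by apply/val_inj/funext => x /=; rewrite /ltrans invg1 mul1g.
Qed.

Lemma regrepM g h u : regrep_fun (g * h)%g u = regrep_fun g (regrep_fun h u).
Proof.
by apply/val_inj/funext => x /=; rewrite /ltrans invgM mulgA.
Qed.

Lemma regrep_continuous (u : H) : continuous (fun g => regrep_fun g u).
Proof.
move=> g0; apply/cvg_ballP => eps eps0.
have epsE : eps = ((complex.Re eps)%:C)%C by rewrite RRe_real// gtr0_real.
have e0 : 0 < complex.Re eps by rewrite -ltcR -epsE.
have e20 : 0 < complex.Re eps ^+ 2 / 2 by rewrite divr_gt0// exprn_gt0.
have /cvgrPdist_lt/(_ _ e20) nr := cvg_energy_ltrans Kpsd phic g0 (rkhs_re u).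
have /cvgrPdist_lt/(_ _ e20) ni := cvg_energy_ltrans Kpsd phic g0 (rkhs_im u).
apply: filterS2 nr ni => g; rewrite !sub0r !normrN => /(le_lt_trans (ler_norm _)) nr.
move=> /(le_lt_trans (ler_norm _)) ni.
rewrite epsE; apply: ball_sym; apply/rkhs_ballE.
rewrite -(ltr_pXn2r (ltn0Sn 1)) ?nnegrE ?sqrtr_ge0 ?(ltW e0)// sqr_sqrtr ?rkhs_energy_ge0//.
rewrite /rkhs_energy.
have -> : re (regrep_fun g u - regrep_fun g0 u : rkhs Kpsd) =
  ltrans g (re (u : rkhs Kpsd)) - ltrans g0 (re (u : rkhs Kpsd)) by exact: reB.
have -> : im (regrep_fun g u - regrep_fun g0 u : rkhs Kpsd) =
  ltrans g (im (u : rkhs Kpsd)) - ltrans g0 (im (u : rkhs Kpsd)) by exact: imB.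
lra.
Qed.

Definition regrep : linIsomAction G H :=
  LinIsomAction regrep_linear regrep_isometry regrep1 regrepM regrep_continuous.

End regular_representation.

Section kazhdan_positive_definite.
Context (R : realType) (G : topologicalGroupType).
Implicit Types phi : G -> R.

Lemma qform_subconst phi (a : R) (w : seq (R * G)) :
  qform (gkernel (fun x => phi x - a)) w = qform (gkernel phi) w - a * (\sum_(p <- w) p.1) ^+ 2.
Proof.
rewrite !qformE [in RHS]expr2 mulr_sumr mulr_sumr -sumrB; apply: eq_bigr => r _.
rewrite mulr_suml mulr_sumr -sumrB; apply: eq_bigr => p _.
by rewrite /gkernel; ring.
Qed.

Lemma positive_definite_leval phi g : positive_definite phi -> `|phi g| <= phi 1%g.
Proof.
move=> phipd; have := phipd.2 [:: (1, 1%g); (1, g)]; have := phipd.2 [:: (1, 1%g); (-1, g)].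
have := phipd.1 1%g g; rewrite /gkernel invg1 mul1g mulg1 => gV.
rewrite !qformE !big_cons !big_nil/= /gkernel !invg1 !mul1g !mulg1 mulVg -gV.
by rewrite ler_norml; lra.
Qed.

(** The constants that can be subtracted form a closed set bounded by [phi 1]. *)
Lemma positive_definite_max_const phi : positive_definite phi ->
  exists2 a, positive_definite (fun x => phi x - a) &
    forall e, 0 < e -> ~ positive_definite (fun x => phi x - a - e).
Proof.
move=> phipd; pose A := [set a | positive_definite (fun x => phi x - a)].
have A0 : A 0 by rewrite /A/= (_ : (fun x => _) = phi)//; apply/funext => x; rewrite subr0.
have Aub : has_ubound A.
  exists (phi 1%g) => a Aa; rewrite -subr_ge0.
  by have := psd_kernel_ge0 Aa 1%g; rewrite /gkernel invg1 mul1g.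
have As : A (sup A).
  split=> [x y|w]; first by rewrite /gkernel; congr (_ - _); exact: phipd.1.
  rewrite qform_subconst subr_ge0; set c := (\sum_(p <- w) p.1) ^+ 2.
  have [->|c0] := eqVneq c 0; first by rewrite mulr0; exact: phipd.2.
  have cp : 0 < c by rewrite lt_def c0 sqr_ge0.
  rewrite -ler_pdivlMr//; apply: ge_sup; first by exists 0.
  by move=> a Aa; rewrite ler_pdivlMr// -subr_ge0 -qform_subconst; exact: Aa.2.
exists (sup A) => // e e0 Ae.
have : A (sup A + e) by rewrite /A/= (_ : (fun x => _) = (fun x => phi x - sup A - e))//;
  apply/funext => x; rewrite opprD addrA.
by move=> /(ub_le_sup Aub); lra.
Qed.

(** The Kazhdan inequality is applied to the kernel function at 1 in the space of
    [psi = phi - a], with [a] the largest constant that can be subtracted. There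
    [|k1| ^ 2 = psi 1], [|t k1 - k1| ^ 2 = 2 (phi 1 - phi t)] and
    [phi 1 - phi g <= 2 psi 1]. *)
Lemma kazhdan_set_positive_definite (S : set G) : finite_set S -> kazhdan_set R S ->
  exists2 C : R, 0 <= C & exists s : seq G, forall phi, continuous phi -> positive_definite phi ->
    forall g, phi 1%g - phi g <= C * \sum_(t <- s) (phi 1%g - phi t).
Proof.
move=> /finite_seqP[s Ss] [eps eps0 kaz].
have C0 : 0 <= 4 / eps ^+ 2 by rewrite divr_ge0// sqr_ge0.
exists (4 / eps ^+ 2) => //; exists s => phi phic phipd g.
have [a psipd amax] := positive_definite_max_const phipd.
set psi := fun x => phi x - a in psipd.
have psic : continuous psi by move=> x; apply: cvgB; [exact: phic|exact: cvg_cst].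
have inv (xi : rkhs_space psipd) : (forall h, regrep psipd psic h xi = xi) -> xi = 0.
  move=> xiinv.
  have xiE x : (xi : rkhs psipd) x = (xi : rkhs psipd) 1%g.
    by rewrite -[xi in LHS](xiinv x) /= /ltrans mulVg.
  (* By Cauchy-Schwarz the constant kernel c^2 / (E + 1) lies below that of psi, so
     it could still be subtracted; E + 1 only serves to avoid dividing by 0. *)
  have cst0 (c : R) : finite_energy (gkernel psi) (fun=> c) -> c = 0.
    move=> fc; apply: contrapT => /eqP c0.
    have E0 := energy_ge0 fc; set E := energy (gkernel psi) (fun=> c) in E0.
    have c2 : 0 < c ^+ 2 by rewrite exprn_even_gt0.
    have E1 : 0 < E + 1 by lra.
    have : 0 < c ^+ 2 / (E + 1) by rewrite divr_gt0.
    move=> /amax; apply; split=> [x y|w]; first by rewrite /gkernel; congr (_ - _); exact: psipd.1.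
    rewrite qform_subconst subr_ge0.
    have := sqr_pairing_le psipd w fc; rewrite /pairing -mulr_suml exprMn -/E => h.
    rewrite mulrAC ler_pdivrMr// mulrC (le_trans h)// mulrC ler_wpM2l ?psipd.2//; lra.
  apply/val_inj/funext => x /=; rewrite xiE.
  have r0 : complex.Re ((xi : rkhs psipd) 1%g) = 0.
    apply: cst0; have := rkhs_re (xi : rkhs psipd).
    by congr finite_energy; apply/funext => y; rewrite /re xiE.
  have i0 : complex.Im ((xi : rkhs psipd) 1%g) = 0.
    apply: cst0; have := rkhs_im (xi : rkhs psipd).
    by congr finite_energy; apply/funext => y; rewrite /im xiE.
  by move: r0 i0; case: (rkhs_val _ _) => u v /= -> ->.
pose k1 : G -> R[i] := fun x => ((gkernel psi 1%g x)%:C)%C.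
have k1re : re k1 = kspan (gkernel psi) [:: (1, 1%g)].
  by apply/funext => x; rewrite /re /kspan big_seq1 /= mul1r.
have k1P : k1 \in rkhs_pred psipd.
  apply/asboolP; rewrite k1re; split; first exact: finite_energy_kspan.
  exact: finite_energy0.
pose xi : rkhs_space psipd := Rkhs k1P.
have := kaz (rkhs_space psipd) (rkhs_dot (Kpsd := psipd)) (@rkhs_norm_sqr _ _ _ psipd)
  (regrep psipd psic) inv xi.
have psi1 : psi 1%g = phi 1%g - a by [].
have nxi : rnorm xi = Num.sqrt (psi 1%g).
  rewrite /rnorm rkhs_normE /= /rkhs_rnorm /rkhs_energy.
  rewrite [re _]k1re energy_kspanE// qform1 /gkernel invg1 mul1g.
  by rewrite (_ : im _ = 0) ?energy0 ?addr0//.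
have psigap x : 0 <= phi 1%g - phi x.
  by rewrite subr_ge0 (le_trans (ler_norm _))// positive_definite_leval.
set D := \sum_(t <- s) (phi 1%g - phi t).
have D0 : 0 <= D by apply: sumr_ge0.
have ndisp t : t \in s -> rnorm (regrep psipd psic t xi - xi) <= Num.sqrt (2 * D).
  move=> ts; rewrite /rnorm rkhs_normE /= ler_wsqrtr// /rkhs_energy.
  have -> : im (regrep psipd psic t xi - xi : rkhs psipd) = 0.
    by apply/funext => x; rewrite /im /= subr0.
  rewrite energy0// addr0.
  have -> : re (regrep psipd psic t xi - xi : rkhs psipd) =
      kspan (gkernel psi) ([:: (1, t); (-1, 1%g)]).
    rewrite [LHS]reB; have -> : re (regrep psipd psic t xi : rkhs psipd) = ltrans t (re k1) by [].
    rewrite [re _]k1re ltrans_kspan; apply/funext => x.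
    by rewrite !fctE /kspan !big_cons !big_nil/= mulg1; ring.
  rewrite energy_kspanE// qformE !big_cons !big_nil/=.
  have := phipd.1 t 1%g; rewrite /gkernel invg1 mulg1 !mul1g => tV.
  rewrite ?invg1 ?mulg1 ?mul1g ?mulVg /psi tV.
  have -> : D = (phi 1%g - phi t) + \sum_(u <- rem t s) (phi 1%g - phi u).
    by rewrite /D (perm_big _ (perm_to_rem ts)) big_cons.
  have : 0 <= \sum_(u <- rem t s) (phi 1%g - phi u) by apply: sumr_ge0.
  by lra.
have supD : sup [set rnorm (regrep psipd psic t xi - xi) | t in S] <= Num.sqrt (2 * D).
  have [->|Sn0] := eqVneq S set0; first by rewrite image_set0 sup0 sqrtr_ge0.
  apply: ge_sup.
    by move/set0P: Sn0 => [t St]; exists (rnorm (regrep psipd psic t xi - xi)), t.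
  by move=> _ [t + <-]; rewrite Ss => /ndisp.
move=> /le_trans/(_ supD); rewrite nxi => h.
have p0 : 0 <= psi 1%g by have := psd_kernel_ge0 psipd 1%g; rewrite /gkernel invg1 mul1g.
have {}h : eps ^+ 2 * psi 1%g <= 2 * D.
  rewrite -(sqr_sqrtr p0) -exprMn -[2 * D]sqr_sqrtr ?mulr_ge0//.
  by rewrite ler_pXn2r ?nnegrE ?mulr_ge0 ?sqrtr_ge0// ltW.
have := positive_definite_leval g psipd; rewrite ler_norml => /andP[lg _].
apply: (@le_trans _ _ (2 * psi 1%g)); first by move: lg; rewrite /psi; lra.
rewrite mulrAC ler_pdivlMr ?exprn_gt0//; lra.
Qed.

End kazhdan_positive_definite.

(** * Gaussian kernels and their dyadic superposition *)

Section gaussian_kernel.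
Context (R : realType).
Implicit Types (t x y : R) (z : R[i]).

(** Powers of the inner product of the plane are positive semidefinite: expand them
    by the binomial formula into sums of squares. *)
Lemma power_kernel_ge0 n (w : seq (R * (R * R))) :
  0 <= \sum_(r <- w) \sum_(p <- w)
    r.1 * p.1 * (p.2.1 * r.2.1 + p.2.2 * r.2.2) ^+ n.
Proof.
pose S (i : 'I_n.+1) := \sum_(p <- w) p.1 * (p.2.1 ^+ (n - i) * p.2.2 ^+ i).
suff -> : \sum_(r <- w) \sum_(p <- w) r.1 * p.1 * (p.2.1 * r.2.1 + p.2.2 * r.2.2) ^+ n =
    \sum_(i < n.+1) S i ^+ 2 *+ 'C(n, i).
  by apply: sumr_ge0 => i _; rewrite mulrn_wge0// sqr_ge0.
have -> : \sum_(i < n.+1) S i ^+ 2 *+ 'C(n, i) =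
    \sum_(i < n.+1) \sum_(r <- w) \sum_(p <- w)
      (r.1 * (r.2.1 ^+ (n - i) * r.2.2 ^+ i)) * (p.1 * (p.2.1 ^+ (n - i) * p.2.2 ^+ i)) *+ 'C(n, i).
  apply: eq_bigr => i _; rewrite expr2 mulr_suml -sumrMnl; apply: eq_bigr => r _.
  by rewrite mulr_sumr -sumrMnl.
rewrite [RHS]exchange_big/=; apply: eq_bigr => r _.
rewrite [RHS]exchange_big/=; apply: eq_bigr => p _.
rewrite exprDn mulr_sumr; apply: eq_bigr => i _; rewrite mulrnAr; congr (_ *+ _).
by rewrite !exprMn; ring.
Qed.

Lemma exp_kernel_ge0 (w : seq (R * (R * R))) :
  0 <= \sum_(r <- w) \sum_(p <- w)
    r.1 * p.1 * expR (2 * (p.2.1 * r.2.1 + p.2.2 * r.2.2)).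
Proof.
pose u n := \sum_(r <- w) \sum_(p <- w) r.1 * p.1 *
   series (exp_coeff (2 * (p.2.1 * r.2.1 + p.2.2 * r.2.2))) n.
have cu : u n @[n --> \oo] --> \sum_(r <- w) \sum_(p <- w)
    r.1 * p.1 * expR (2 * (p.2.1 * r.2.1 + p.2.2 * r.2.2)).
  apply: cvg_sumr => r; apply: cvg_sumr => p.
  by apply: cvgMr; exact: is_cvg_series_exp_coeff.
rewrite -(cvg_lim _ cu)//; apply: limr_ge; first by apply/cvg_ex; eexists; exact: cu.
apply: nearW => n; rewrite /u /series/=.
have -> : \sum_(r <- w) \sum_(p <- w) r.1 * p.1 *
      \sum_(0 <= k < n) exp_coeff (2 * (p.2.1 * r.2.1 + p.2.2 * r.2.2)) k =
    \sum_(0 <= k < n) 2 ^+ k / k`!%:R * \sum_(r <- w) \sum_(p <- w)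
      r.1 * p.1 * (p.2.1 * r.2.1 + p.2.2 * r.2.2) ^+ k.
  under [RHS]eq_bigr do rewrite mulr_sumr; rewrite [RHS]exchange_big/=.
  apply: eq_bigr => r _; under [RHS]eq_bigr do rewrite mulr_sumr.
  rewrite [RHS]exchange_big/=; apply: eq_bigr => p _; rewrite mulr_sumr.
  by apply: eq_bigr => k _; rewrite /exp_coeff/= exprMn; ring.
by apply: sumr_ge0 => k _; rewrite mulr_ge0 ?power_kernel_ge0.
Qed.

(** Expand [|x - y| ^ 2]: up to rescaling the combination, the Gaussian kernel is the
    exponential of twice the inner product. *)
Lemma gaussian_kernel_ge0 (w : seq (R * R[i])) :
  0 <= \sum_(r <- w) \sum_(p <- w) r.1 * p.1 * expR (- rnorm (p.2 - r.2) ^+ 2).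
Proof.
pose v := [seq (p.1 * expR (- rnorm p.2 ^+ 2), (complex.Re p.2, complex.Im p.2)) | p <- w].
have := exp_kernel_ge0 v; rewrite big_map; congr (_ <= _).
apply: eq_bigr => r _; rewrite big_map; apply: eq_bigr => p _ /=.
have n2 z : rnorm z ^+ 2 = complex.Re z ^+ 2 + complex.Im z ^+ 2.
  by apply: complexI; rewrite add_Re2_Im2 rnormE rmorphXn.
have -> : - rnorm (p.2 - r.2) ^+ 2 = - rnorm r.2 ^+ 2 + - rnorm p.2 ^+ 2 +
    2 * (complex.Re p.2 * complex.Re r.2 + complex.Im p.2 * complex.Im r.2).
  by rewrite !n2; case: (p.2) (r.2) => a b [a' b'] /=; ring.
by rewrite !expRD; ring.
Qed.

Definition kap t := 1 - expR (- t ^+ 2).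

Lemma kap_ge0 t : 0 <= kap t.
Proof. by rewrite subr_ge0 -expR0 ler_expR oppr_le0 sqr_ge0. Qed.

Lemma kap_le1 t : kap t <= 1.
Proof. by rewrite gerBl expR_ge0. Qed.

Lemma kap_le_sqr t : kap t <= t ^+ 2.
Proof. by rewrite /kap; have := expR_ge1Dx (- t ^+ 2); lra. Qed.

Lemma kap_ge_half t : 1 <= t -> 2^-1 <= kap t.
Proof.
move=> t1; have t2 : 1 <= t ^+ 2 by rewrite exprn_ege1.
rewrite /kap expRN lerBrDr -lerBrDl (_ : 1 - 2^-1 = 2^-1); last by field.
rewrite lef_pV2 ?posrE ?expR_gt0//.
by have := expR_ge1Dx (t ^+ 2); lra.
Qed.

(** For [s <= t] the increment of [kap] is
    [expR (- s ^+ 2) * (1 - expR (- (t - s) (t + s)))], and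
    [2 s expR (- s ^+ 2) <= 1]. *)
Lemma kap_lipschitz s t : 0 <= s -> 0 <= t -> `|kap t - kap s| <= 2 * `|t - s|.
Proof.
wlog st : s t / s <= t.
  move=> H s0 t0; have [/H->//|/ltW ts] := leP s t.
  by rewrite distrC [leRHS](congr1 _ (distrC _ _)); exact: H.
move=> s0 t0; have d0 : 0 <= t - s by rewrite subr_ge0.
have [d1|d1] := leP (t - s) 1; last first.
  have := kap_ge0 t; have := kap_le1 t; have := kap_ge0 s; have := kap_le1 s.
  by rewrite ler_norml ger0_norm//; lra.
have E : kap t - kap s = expR (- s ^+ 2) * (1 - expR (- ((t - s) * (t + s)))).
  have tE : - t ^+ 2 = - s ^+ 2 - (t - s) * (t + s) by ring.
  by rewrite /kap mulrBr mulr1 -expRD -tE; ring.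
have e1 : expR (- s ^+ 2) <= 1 by rewrite -expR0 ler_expR oppr_le0 sqr_ge0.
have e2 : 2 * s * expR (- s ^+ 2) <= 1.
  rewrite expRN ler_pdivrMr ?expR_gt0// mul1r.
  by have := expR_ge1Dx (s ^+ 2); have := sqr_ge0 (s - 1); lra.
have e0 := expR_ge0 (- s ^+ 2).
have m0 : 0 <= (t - s) * (t + s) by rewrite mulr_ge0// addr_ge0.
have ub : 1 - expR (- ((t - s) * (t + s))) <= (t - s) * (t + s).
  by have := expR_ge1Dx (- ((t - s) * (t + s))); lra.
have lb : 0 <= 1 - expR (- ((t - s) * (t + s))) by rewrite subr_ge0 -expR0 ler_expR oppr_le0.
rewrite E ger0_norm ?mulr_ge0// [`|t - s|]ger0_norm//.
apply: le_trans (ler_wpM2l e0 ub) _.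
have -> : expR (- s ^+ 2) * ((t - s) * (t + s)) =
   (t - s) * ((t - s) * expR (- s ^+ 2) + 2 * s * expR (- s ^+ 2)) by ring.
rewrite mulrC ler_wpM2r//; have := ler_wpM2r e0 d1; lra.
Qed.

(** A superposition of rescaled copies of [kap] that is comparable to [x] on
    [[1, 2 ^ N]]: the terms with [2 ^ n < x] are of size [2 ^ n], and the others decay
    like [x ^ 2 / 2 ^ n]. *)
Definition kapsum N x := \sum_(n < N) 2 ^+ n * kap (x / 2 ^+ n).

Lemma kapsumS N x : kapsum N.+1 x = kap x + 2 * kapsum N (x / 2).
Proof.
rewrite /kapsum big_ord_recl expr0 mul1r divr1 mulr_sumr; congr (_ + _).
apply: eq_bigr => i _; rewrite lift0 exprS mulrA; congr (_ * kap _).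
by rewrite invfM mulrA.
Qed.

(** The majorant [2 x ^ 2] for [x <= 1], [3 x - 1] for [x > 1] reproduces itself
    under [kapsumS]. *)
Lemma kapsum_le N x : 0 <= x -> kapsum N x <= 3 * x.
Proof.
suff H : forall x, 0 <= x -> kapsum N x <= (if x <= 1 then 2 * x ^+ 2 else 3 * x - 1).
  move=> x0; apply: le_trans (H x x0) _; case: (leP x 1) => x1; last by lra.
  by have := mulr_ge0 x0 (_ : 0 <= 1 - x); rewrite subr_ge0 => /(_ x1); nra.
elim: N => [|N IH] {}x x0.
  by rewrite /kapsum big_ord0; case: (leP x 1) => x1; [rewrite mulr_ge0 ?sqr_ge0|lra].
rewrite kapsumS; have := IH (x / 2) (divr_ge0 x0 (ler0n _ _)).
have := kap_le1 x; have := kap_le_sqr x.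
case: (leP x 1) => x1; case: (leP (x / 2) 1) => x2; [| lra| |lra]; last by nra.
by rewrite exprMn exprVn; lra.
Qed.

Lemma kapsum_ge N x : 0 <= x -> (Num.min x (2 ^+ N) - 1) / 2 <= kapsum N x.
Proof.
elim: N x => [|N IH] x x0.
  rewrite /kapsum big_ord0 expr0 pmulr_lle0// subr_le0.
  by rewrite ge_min lexx orbT.
rewrite kapsumS; have h := IH (x / 2) (divr_ge0 x0 (ler0n _ _)).
have E : Num.min x (2 ^+ N.+1) = 2 * Num.min (x / 2) (2 ^+ N).
  by rewrite exprS minr_pMr//; congr (Num.min _ _); field.
rewrite E; have [x1|x1] := leP 1 x; first by have := kap_ge_half x1; lra.
have : Num.min (x / 2) (2 ^+ N) <= x / 2 by rewrite ge_min lexx.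
have := kap_ge0 x; have : 0 <= kapsum N (x / 2).
  by apply: sumr_ge0 => n _; rewrite mulr_ge0 ?exprn_ge0 ?kap_ge0.
lra.
Qed.

End gaussian_kernel.

(** * Integrals of nonnegative functions *)

Section nonneg_integral.
Context d (T : measurableType d) (R : realType) (mu : {measure set T -> \bar R}).
Implicit Types (F G : T -> R) (f g : T -> R[i]).

Definition eint F : \bar R := (\int[mu]_w (F w)%:E)%E.
Definition nnmfun F := measurable_fun setT F /\ forall w, 0 <= F w.

Lemma eint_ge0 F : nnmfun F -> (0 <= eint F)%E.
Proof. by move=> [_ F0]; apply: integral_ge0 => w _; rewrite lee_fin. Qed.

Lemma eint_le_ae F G : nnmfun F -> nnmfun G -> {ae mu, forall w, F w <= G w} ->
  (eint F <= eint G)%E.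
Proof.
move=> [mF F0] [mG G0] FG; apply: ae_ge0_le_integral => //.
- by move=> w _; rewrite lee_fin.
- exact/measurable_EFinP.
- by move=> w _; rewrite lee_fin.
- exact/measurable_EFinP.
- by apply: filterS FG => w h _; rewrite lee_fin.
Qed.

Lemma eint_le F G : nnmfun F -> nnmfun G -> (forall w, F w <= G w) ->
  (eint F <= eint G)%E.
Proof. by move=> nF nG FG; apply: eint_le_ae => //; exact: aeW. Qed.

Lemma eint_ae_eq F G : nnmfun F -> nnmfun G -> {ae mu, forall w, F w = G w} ->
  eint F = eint G.
Proof.
move=> nF nG FG; apply/eqP; rewrite eq_le !eint_le_ae//.
  by apply: filterS FG => w ->.
by apply: filterS FG => w ->.
Qed.

Lemma eintD F G : nnmfun F -> nnmfun G ->
  eint (fun w => F w + G w) = (eint F + eint G)%E.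
Proof.
move=> [mF F0] [mG G0]; rewrite /eint -ge0_integralD//.
- by move=> w _; rewrite lee_fin.
- exact/measurable_EFinP.
- by move=> w _; rewrite lee_fin.
- exact/measurable_EFinP.
Qed.

Lemma eintZ (k : R) F : 0 <= k -> nnmfun F ->
  eint (fun w => k * F w) = (k%:E * eint F)%E.
Proof.
move=> k0 [mF F0]; rewrite /eint -ge0_integralZl_EFin//.
- by move=> w _; rewrite lee_fin.
- exact/measurable_EFinP.
Qed.

Lemma eint_cst (k : R) : eint (fun=> k) = (k%:E * mu setT)%E.
Proof. exact: integral_cst. Qed.

Lemma eint_indic A : measurable A -> eint (\1_A) = mu A.
Proof. by move=> mA; rewrite /eint integral_indic// setIT. Qed.

Lemma indic_setE (P : T -> bool) w : \1_[set w | P w] w = (P w)%:R :> R.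
Proof.
rewrite indicE; congr (nat_of_bool _)%:R.
by apply/idP/idP => [|h]; [rewrite inE|rewrite inE].
Qed.

Lemma nnmfunD F G : nnmfun F -> nnmfun G -> nnmfun (fun w => F w + G w).
Proof.
by move=> [mF F0] [mG G0]; split=> [|w]; [exact: measurable_funD|exact: addr_ge0].
Qed.

Lemma nnmfunZ (k : R) F : 0 <= k -> nnmfun F -> nnmfun (fun w => k * F w).
Proof.
by move=> k0 [mF F0]; split=> [|w]; [exact: measurable_funM|exact: mulr_ge0].
Qed.

Lemma nnmfun_cst (k : R) : 0 <= k -> nnmfun (fun=> k).
Proof. by move=> k0; split. Qed.

Lemma nnmfun_indic A : measurable A -> nnmfun (\1_A).
Proof. by move=> mA; split=> [|w]; [exact: measurable_indic|rewrite indicE]. Qed.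

Lemma nnmfun_comp (h : R -> R) F : continuous h -> (forall t, 0 <= t -> 0 <= h t) ->
  nnmfun F -> nnmfun (fun w => h (F w)).
Proof.
move=> ch h0 [mF F0]; split=> [|w]; last exact: h0.
by apply: measurableT_comp => //; exact: continuous_measurable_fun.
Qed.

Lemma nnmfun_powR p F : nnmfun F -> nnmfun (fun w => F w `^ p).
Proof.
move=> [mF F0]; split=> [|w]; last exact: powR_ge0.
exact: (measurableT_comp (measurable_powR p) mF).
Qed.

Lemma nnmfun_rnorm f : cmeasurable f -> nnmfun (fun w => rnorm (f w)).
Proof. by move=> mf; split=> [|w]; [exact: cmeasurable_rnorm|exact: rnorm_ge0]. Qed.

Lemma cmeasurableB f g : cmeasurable f -> cmeasurable g -> cmeasurable (f - g).
Proof.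
move=> mf mg; rewrite addrC -scaleN1r; exact: cmeasurable_lin.
Qed.

Lemma cmeasurableD f g : cmeasurable f -> cmeasurable g -> cmeasurable (f + g).
Proof. by move=> mf mg; rewrite -[f]scale1r; exact: cmeasurable_lin. Qed.

Lemma cmeasurableZ a f : cmeasurable f -> cmeasurable (a *: f).
Proof. by move=> mf; rewrite -[_ *: _]addr0; apply: cmeasurable_lin => //; exact: cmeasurable0. Qed.

Lemma cmeasurableM f g : cmeasurable f -> cmeasurable g -> cmeasurable (fun w => f w * g w).
Proof.
move=> [fr fi] [gr gi]; split.
  have -> : (@complex.Re R \o (fun w => f w * g w)) =
     (fun x => complex.Re (f x) * complex.Re (g x) - complex.Im (f x) * complex.Im (g x)).
    by apply/funext => x /=; case: (f x) (g x) => ? ? [].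
  by apply: measurable_funB; apply: measurable_funM.
have -> : (@complex.Im R \o (fun w => f w * g w)) =
   (fun x => complex.Re (f x) * complex.Im (g x) + complex.Im (f x) * complex.Re (g x)).
  by apply/funext => x /=; case: (f x) (g x) => ? ? [].
by apply: measurable_funD; apply: measurable_funM.
Qed.

Lemma cmeasurable_cst (a : R[i]) : cmeasurable ((fun=> a) : T -> R[i]).
Proof. by split; exact: measurable_cst. Qed.

Lemma cmeasurable_real F : measurable_fun setT F -> cmeasurable (fun w => ((F w)%:C)%C).
Proof. by move=> mF; split=> //; exact: measurable_cst. Qed.

Lemma cmeasurable_comp f (a : {mfun T >-> T}) : cmeasurable f -> cmeasurable (f \o a).
Proof. by move=> [fr fi]; split; [exact: (measurableT_comp fr)|exact: (measurableT_comp fi)]. Qed.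

End nonneg_integral.

(** * A strictly convex gauge of linear growth *)

Section hyperboloid_height.
Context (R : realType).
Implicit Types (z : R[i]) (t : R).

(** The graph of [rho] is the upper sheet of a hyperboloid. *)
Definition height t : R := Num.sqrt (1 + t ^+ 2).
Definition rho z : R := height (rnorm z).

Lemma height_continuous : continuous height.
Proof.
move=> t; apply: continuous_comp; last exact: sqrt_continuous.
by apply: cvgD; [exact: cvg_cst|exact: exprn_continuous].
Qed.

Lemma height_ge0 t : 0 <= height t. Proof. exact: sqrtr_ge0. Qed.

Lemma sqr_height t : height t ^+ 2 = 1 + t ^+ 2.
Proof. by rewrite sqr_sqrtr// addr_ge0// sqr_ge0. Qed.

Lemma height_ge1 t : 1 <= height t.
Proof.
by rewrite -(ler_pXn2r (ltn0Sn 1)) ?nnegrE ?height_ge0// sqr_height expr1n lerDl sqr_ge0.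
Qed.

Lemma height_le_sqr t : height t <= 1 + t ^+ 2 / 2.
Proof.
have t2 := sqr_ge0 t; rewrite -(ler_pXn2r (ltn0Sn 1)) ?nnegrE ?height_ge0//; last by lra.
by rewrite sqr_height sqrrD expr1n mul1r; have := sqr_ge0 (t ^+ 2 / 2); lra.
Qed.

Lemma height_leD t : 0 <= t -> height t <= 1 + t.
Proof.
move=> t0; rewrite -(ler_pXn2r (ltn0Sn 1)) ?nnegrE ?height_ge0//; last by lra.
by rewrite sqr_height sqrrD expr1n mul1r; lra.
Qed.

Lemma ler_height s t : 0 <= s -> s <= t -> height s <= height t.
Proof.
move=> s0 st; rewrite ler_wsqrtr// lerD2l ler_pXn2r// ?nnegrE//.
exact: le_trans st.
Qed.

Lemma sqr_rnorm z : rnorm z ^+ 2 = complex.Re z ^+ 2 + complex.Im z ^+ 2.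
Proof. by apply: complexI; rewrite add_Re2_Im2 rnormE rmorphXn. Qed.

Lemma rnormN z : rnorm (- z) = rnorm z.
Proof. by rewrite /rnorm normrN. Qed.

(** Strict convexity of the upper sheet of the hyperboloid; the cubic weight
    compensates for the curvature decaying at infinity. *)
Lemma rho_midpoint (z1 z2 : R[i]) :
  rnorm (z1 - z2) ^+ 2 <=
    (rho z1 + rho z2) ^+ 3 * (rho z1 + rho z2 - 2 * rho (2^-1 * (z1 + z2))).
Proof.
set r1 := rho z1; set r2 := rho z2; set m := rho (2^-1 * (z1 + z2)).
(* ab is the inner product of the vectors (1, z1) and (1, z2), whose norms are r1
   and r2; their Gram determinant is |z1 - z2|^2 plus a square. *)
pose ab := 1 + complex.Re z1 * complex.Re z2 + complex.Im z1 * complex.Im z2.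
have r1s : r1 ^+ 2 = 1 + (complex.Re z1 ^+ 2 + complex.Im z1 ^+ 2).
  by rewrite sqr_height sqr_rnorm.
have r2s : r2 ^+ 2 = 1 + (complex.Re z2 ^+ 2 + complex.Im z2 ^+ 2).
  by rewrite sqr_height sqr_rnorm.
have ms : (2 * m) ^+ 2 = r1 ^+ 2 + r2 ^+ 2 + 2 * ab.
  have half : (2^-1 : R[i]) = ((2^-1)%:C)%C by rewrite fmorphV rmorph_nat.
  rewrite exprMn sqr_height sqr_rnorm r1s r2s /ab half.
  by case: (z1) (z2) => a b [a' b'] /=; field.
have D : rnorm (z1 - z2) ^+ 2 <= r1 ^+ 2 * r2 ^+ 2 - ab ^+ 2.
  rewrite sqr_rnorm r1s r2s /ab; case: (z1) (z2) => a b [a' b'] /=.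
  rewrite -subr_ge0; have := sqr_ge0 (a * b' - b * a'); congr (_ <= _); ring.
have r10 : 0 <= r1 by exact: height_ge0.
have r20 : 0 <= r2 by exact: height_ge0.
have m0 : 0 <= m by exact: height_ge0.
have abr : ab <= r1 * r2.
  have [ab0|ab0] := leP 0 ab; last by rewrite (le_trans (ltW ab0))// mulr_ge0.
  rewrite -(ler_pXn2r (ltn0Sn 1)) ?nnegrE ?mulr_ge0// exprMn.
  by have := sqr_ge0 (rnorm (z1 - z2)); lra.
have mA : 2 * m <= r1 + r2.
  rewrite -(ler_pXn2r (ltn0Sn 1)) ?nnegrE ?mulr_ge0 ?addr_ge0// ms; lra.
set A := r1 + r2 in mA *; set g := A - 2 * m.
have A0 : 0 <= A by exact: addr_ge0.
have g0 : 0 <= g by rewrite subr_ge0.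
have e0 : 0 <= r1 * r2 - ab by rewrite subr_ge0.
have gA : r1 * r2 - ab <= A * g.
  have : g * (A + 2 * m) = 2 * (r1 * r2 - ab).
    have -> : g * (A + 2 * m) = A ^+ 2 - (2 * m) ^+ 2 by rewrite /g; ring.
    by rewrite ms /A; ring.
  have := ler_wpM2l g0 (_ : A + 2 * m <= A + A); rewrite lerD2l => /(_ mA); lra.
apply: le_trans D _.
have -> : r1 ^+ 2 * r2 ^+ 2 - ab ^+ 2 = (r1 * r2 + ab) * (r1 * r2 - ab) by ring.
apply: (@le_trans _ _ (A ^+ 2 * (r1 * r2 - ab))).
  rewrite ler_wpM2r//; apply: (@le_trans _ _ (2 * (r1 * r2))); first by lra.
  by have := sqr_ge0 (r1 - r2); have := mulr_ge0 r10 r20; rewrite /A; lra.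
have -> : A ^+ 3 * g = A ^+ 2 * (A * g) by ring.
by rewrite ler_wpM2l// sqr_ge0.
Qed.

(** Where the points are at least [e] apart, either one of them is high or the
    midpoint is markedly lower; [L] is the height separating the two cases. *)
Lemma rho_separated (L e : R) (z1 z2 : R[i]) : 0 < L -> 0 < e ->
  (e <= rnorm (z1 - z2))%R%:R + 2 * L ^+ 3 / e ^+ 2 * rho (2^-1 * (z1 + z2)) <=
  (L^-1 + L ^+ 3 / e ^+ 2) * (rho z1 + rho z2).
Proof.
move=> L0 e0; have := rho_midpoint z1 z2.
set A := rho z1 + rho z2; set m := rho _; set D := rnorm _ => H.
have A0 : 0 < A by rewrite addr_gt0// (lt_le_trans ltr01)// height_ge1.
have g0 : 0 <= A - 2 * m.
  have := le_trans (sqr_ge0 D) H; rewrite pmulr_rge0// exprn_gt0//.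
have c0 : 0 < L ^+ 3 / e ^+ 2 by rewrite divr_gt0 ?exprn_gt0.
suff : (e <= D)%R%:R <= L^-1 * A + L ^+ 3 / e ^+ 2 * (A - 2 * m).
  by lra.
have Li : 0 <= L^-1 by rewrite invr_ge0 ltW.
have t1 : 0 <= L^-1 * A by rewrite mulr_ge0// ltW.
have t2 : 0 <= L ^+ 3 / e ^+ 2 * (A - 2 * m) by rewrite mulr_ge0// ltW.
have [eD|_] := leP e D; last by rewrite mulr0n addr_ge0.
have [LA|AL] := leP L A.
  rewrite (_ : 1%:R = L^-1 * L); last by rewrite mulVf ?gt_eqF.
  by rewrite ler_wpDr// ler_pM2l ?invr_gt0.
rewrite ler_wpDl// mulrAC ler_pdivlMr ?exprn_gt0// mul1r.
apply: (@le_trans _ _ (D ^+ 2)); first by rewrite ler_pXn2r ?nnegrE ?(ltW e0)// (le_trans _ eD)// ltW.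
apply: le_trans H _; rewrite ler_wpM2r//.
by rewrite ler_pXn2r ?nnegrE ?(ltW A0) ?(ltW L0) ?(ltW AL).
Qed.

End hyperboloid_height.

(** * Almost everywhere limits of rapidly Cauchy sequences *)

Lemma cvg_half_pow (R : realType) : (2^-1 : R) ^+ n @[n --> \oo] --> (0 : R).
Proof. by apply: cvg_expr; rewrite ger0_norm// invf_lt1// ltr1n. Qed.

Lemma half_powS (R : realType) n : (2^-1 : R) ^+ n = 2 * 2^-1 ^+ n.+1.
Proof. by rewrite exprS mulrA divff// mul1r. Qed.

(** Adding or subtracting the tail [2 / 2 ^ k] makes such a sequence monotone. *)
Lemma half_pow_is_cvg (R : realType) (r : R^nat) n :
  (forall k, (n <= k)%N -> `|r k - r k.+1| <= 2^-1 ^+ k) -> cvgn r.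
Proof.
move=> rk.
pose u k := r (k + n)%N - 2 * 2^-1 ^+ (k + n); pose v k := r (k + n)%N + 2 * 2^-1 ^+ (k + n).
have uS k : u k <= u k.+1.
  have := rk (k + n)%N (leq_addl _ _); have := half_powS R (k + n).
  by rewrite ler_norml /u addSn => ? /andP[]; lra.
have vS k : v k.+1 <= v k.
  have := rk (k + n)%N (leq_addl _ _); have := half_powS R (k + n).
  by rewrite ler_norml /v addSn => ? /andP[]; lra.
have cu : cvgn u.
  apply: nondecreasing_is_cvgn; first exact/nondecreasing_seqP.
  exists (v 0%N) => _ [k _ <-]; apply: (@le_trans _ _ (v k)).
    by rewrite /u /v lerD2l ge0_cp ?mulr_ge0// exprn_ge0.
  by elim: k => // k; exact: le_trans.
have /cvg_ex[l ul] := cu; apply/cvg_ex; exists l; rewrite -(cvg_shiftn n).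
have -> : [sequence r (k + n)%N]_k = u \+ (fun k => 2 * 2^-1 ^+ (k + n)).
  by apply/funext => k /=; rewrite /u subrK.
rewrite -[l]addr0; apply: cvgD => //; rewrite -(mulr0 2); apply: cvgMr.
by rewrite (cvg_shiftn n (fun k => (2^-1 : R) ^+ k)); exact: cvg_half_pow.
Qed.

Section convergence_in_measure.
Context d (T : measurableType d) (R : realType) (mu : {finite_measure set T -> \bar R}).
Implicit Types (f : T -> R[i]) (F : T -> R).

Lemma measurable_set_ge F (a : R) : measurable_fun setT F -> measurable [set w | a <= F w].
Proof.
move=> mF; have := mF measurableT `[a, +oo[%classic (measurable_itv _).
by rewrite setTI; congr measurable; apply/seteqP; split=> w /=; rewrite in_itv/= andbT.
Qed.

Lemma measurable_set_gt F (a : R) : measurable_fun setT F -> measurable [set w | a < F w].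
Proof.
move=> mF; have := mF measurableT `]a, +oo[%classic (measurable_itv _).
by rewrite setTI; congr measurable; apply/seteqP; split=> w /=; rewrite in_itv/= andbT.
Qed.

(** Borel-Cantelli: almost every point is in finitely many of the exceptional sets.
    The limit is written as an upper limit so that it is measurable. *)
Lemma ae_cvg_fast (c : nat -> T -> R[i]) : (forall k, cmeasurable (c k)) ->
  (forall k, (mu [set w | (2^-1 ^+ k <= rnorm (c k w - c k.+1 w))%R] <= ((2^-1 ^+ k)%:E)%E)%E) ->
  exists2 f, cmeasurable f & {ae mu, forall w,
    ((complex.Re (c k w)) @[k --> \oo] --> complex.Re (f w)) /\
    ((complex.Im (c k w)) @[k --> \oo] --> complex.Im (f w))}.
Proof.
move=> mc cS.
pose E k := [set w | 2^-1 ^+ k <= rnorm (c k w - c k.+1 w)].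
have mE k : measurable (E k).
  by apply: measurable_set_ge; exact: (cmeasurable_rnorm (cmeasurableB (mc k) (mc k.+1))).
have E0 : mu (lim_sup_set E) = 0%E.
  apply: lim_sup_set_cvg0 => //; apply: (@le_lt_trans _ _ (2%:E)%E); last exact: ltry.
  apply: lime_le; first by apply: is_cvg_nneseries => k _ _; exact: measure_ge0.
  apply: nearW => n; apply: (@le_trans _ _ (\sum_(0 <= k < n) (2^-1 ^+ k)%:E)%E).
    by apply: lee_sum => k _; exact: cS.
  rewrite sumEFin lee_fin; suff : \sum_(0 <= k < n) (2^-1 : R) ^+ k <= 2 - 2 * 2^-1 ^+ n.
    by move=> /le_trans; apply; rewrite gerBl mulr_ge0// exprn_ge0.
  elim: n => [|n IH]; first by rewrite big_nil expr0 mulr1 subrr.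
  by rewrite big_nat_recr//=; have := half_powS R n; lra.
pose f w : R[i] := ((fine (limn_esup (fun k => (complex.Re (c k w))%:E))) +i*
  (fine (limn_esup (fun k => (complex.Im (c k w))%:E))))%C.
exists f.
  split.
    apply: (measurableT_comp (fine_measurable measurableT)).
    by apply: measurable_fun_limn_esup => k; apply/measurable_EFinP; exact: (mc k).1.
  apply: (measurableT_comp (fine_measurable measurableT)).
  by apply: measurable_fun_limn_esup => k; apply/measurable_EFinP; exact: (mc k).2.
have nE : mu.-negligible (lim_sup_set E).
  apply/negligibleP => //; apply: bigcapT_measurable => n; exact: bigcup_measurable.
apply: (@negligibleS _ _ _ _ _ _ _ nE) => w /=; apply: contra_notP => wE.
have [n nk] : exists n, forall k, (n <= k)%N -> rnorm (c k w - c k.+1 w) < 2^-1 ^+ k.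
  apply: contrapT => /forallNP H; apply: wE => n _.
  have /existsNP[k /not_implyP[nk /negP]] := H n; rewrite -leNgt => ck.
  by exists k.
have lim (P : R[i] -> R) : (forall x, `|P x| <= rnorm x) ->
    (forall x y, P (x - y) = P x - P y) ->
    P (c k w) @[k --> \oo] --> fine (limn_esup (fun k => (P (c k w))%:E)).
  move=> Pn PB; have : cvgn (fun k => P (c k w)).
    apply: (@half_pow_is_cvg _ _ n) => k nk'; rewrite -PB.
    by apply: le_trans (Pn _) _; exact/ltW/nk.
  move=> /cvg_ex[l cl]; have /cvg_limn_einf_sup[_ ->] : (P (c k w))%:E @[k --> \oo] --> l%:E.
    exact/cvg_EFin/cl/nearW.
  exact: cl.
split.
  apply: (lim (@complex.Re R)) => [x|[? ?] [? ?]//].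
  by rewrite -lecR -rnormE; exact: normc_ge_Re.
apply: (lim (@complex.Im R)) => [x|[? ?] [? ?]//].
rewrite -(ler_pXn2r (ltn0Sn 1)) ?nnegrE ?rnorm_ge0// sqr_rnorm real_normK ?num_real//.
by rewrite lerDr sqr_ge0.
Qed.

End convergence_in_measure.

(** * Circumcenters of families bounded in L_1 *)

Section circumcenter.
Context d (T : measurableType d) (R : realType) (mu : {finite_measure set T -> \bar R}).
Context (I : Type) (i0 : I) (g : I -> T -> R[i]) (B : R).
Hypotheses (mg : forall i, cmeasurable (g i))
  (gB : forall i, (eint mu (fun w => rho (g i w)) <= B%:E)%E).
Implicit Types (c : T -> R[i]) (a : R).

Definition rho_dist (f h : T -> R[i]) : \bar R := eint mu (fun w => rho (f w - h w)).

Definition radius_le c a := cmeasurable c /\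
  forall i, (rho_dist c (g i) <= a%:E)%E.

Lemma nnmfun_rho c : cmeasurable c -> nnmfun (fun w => rho (c w)).
Proof.
move=> /nnmfun_rnorm; apply: nnmfun_comp; first exact: height_continuous.
by move=> t _; exact: height_ge0.
Qed.

Let radii := [set a | exists c, radius_le c a].

Let radii_has_inf : has_inf radii.
Proof.
split.
  exists B, 0; split=> [|i]; first exact: cmeasurable0.
  apply: le_trans (gB i); apply: eint_le => [||w].
  - exact: nnmfun_rho (cmeasurableB (cmeasurable0 _ _) (mg i)).
  - exact: nnmfun_rho.
  - by rewrite sub0r /rho rnormN.
exists 0 => a [c [mc ca]]; rewrite -lee_fin; apply: le_trans (ca i0).
exact/eint_ge0/nnmfun_rho/cmeasurableB.
Qed.

Definition min_radius := inf radii.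

Lemma min_radius_le c a : radius_le c a -> min_radius <= a.
Proof. by move=> ca; apply: ge_inf; [exact: radii_has_inf.2|exists c]. Qed.

Lemma min_radius_ge0 : 0 <= min_radius.
Proof.
apply: lb_le_inf; first exact: radii_has_inf.1.
move=> a [c [mc ca]]; rewrite -lee_fin; apply: le_trans (ca i0).
exact/eint_ge0/nnmfun_rho/cmeasurableB.
Qed.

Lemma ex_radius_le e : 0 < e -> exists c, radius_le c (min_radius + e).
Proof.
move=> e0; have [a [c [mc ca]] am] := inf_adherent e0 radii_has_inf.
exists c; split=> // i; apply: le_trans (ca i) _.
by rewrite lee_fin ltW.
Qed.

Lemma radius_leS c a a' : a <= a' -> radius_le c a -> radius_le c a'.
Proof. by move=> aa [mc ca]; split=> // i; apply: le_trans (ca i) _; rewrite lee_fin. Qed.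

Let sep c c' (e : R) := [set w | e <= rnorm (c w - c' w)].

Let msep c c' e : cmeasurable c -> cmeasurable c' -> measurable (sep c c' e).
Proof.
move=> mc mc'; apply: measurable_set_ge.
exact: (cmeasurable_rnorm (cmeasurableB mc mc')).
Qed.

(** The midpoint of two nearly optimal centers cannot do much better than the
    optimum, so strict convexity forces them together. The constants are those of
    [rho_separated] with [L] so large that the contribution [1 / L] of the high
    points to the bound is at most [e / 2]. *)
Lemma near_centers_close e : 0 < e -> exists2 dl, 0 < dl & forall c c',
  radius_le c (min_radius + dl) -> radius_le c' (min_radius + dl) ->
  (mu (sep c c' e) <= e%:E)%E.
Proof.
move=> e0; have m0 := min_radius_ge0; set m := min_radius in m0 *.
pose L := (4 * m + 4) / e; have L0 : 0 < L by rewrite divr_gt0//; lra.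
pose k := L ^+ 3 / e ^+ 2; have k0 : 0 < k by rewrite divr_gt0 ?exprn_gt0.
pose dl := Num.min 1 (e / (8 * k)).
have dl0 : 0 < dl by rewrite lt_min ltr01 divr_gt0// mulr_gt0.
have dl1 : dl <= 1 by rewrite ge_min lexx.
have dlk : 4 * k * dl <= e / 2.
  have : dl <= e / (8 * k) by rewrite ge_min lexx orbT.
  have k40 : 0 <= 4 * k by rewrite mulr_ge0// ltW.
  move=> /(ler_wpM2l k40)/le_trans; apply.
  by rewrite le_eqVlt; apply/orP; left; apply/eqP; field; rewrite gt_eqF.
exists dl => // c c' [mc cm] [mc' cm'].
pose mid : T -> R[i] := (2^-1 : R[i]) *: (c + c').
have mmid : cmeasurable mid by exact/cmeasurableZ/cmeasurableD.
have [i im] : exists i, ((m - dl)%:E < rho_dist mid (g i))%E.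
  apply: contrapT => /forallNP H.
  have /min_radius_le : radius_le mid (m - dl).
    by split=> // i; have /negP := H i; rewrite -leNgt.
  by rewrite -/m; lra.
have sepE w : (\1_(sep c c' e) w : R) = (e <= rnorm (c w - c' w))%R%:R.
  exact: indic_setE.
have n1 := nnmfun_rho (cmeasurableB mc (mg i)).
have n2 := nnmfun_rho (cmeasurableB mc' (mg i)).
have nm := nnmfun_rho (cmeasurableB mmid (mg i)).
have ni := @nnmfun_indic _ _ R _ (msep e mc mc').
have k20 : 0 <= 2 * k by rewrite mulr_ge0// ltW.
have Lk0 : 0 <= L^-1 + k by rewrite addr_ge0 ?invr_ge0 ?(ltW L0) ?(ltW k0).
pose lhs w : R := \1_(sep c c' e) w + 2 * k * rho (mid w - g i w).
pose rhs w : R := (L^-1 + k) * (rho (c w - g i w) + rho (c' w - g i w)).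
have : (eint mu lhs <= eint mu rhs)%E.
  apply: eint_le => [||w].
  - by apply: nnmfunD => //; exact: nnmfunZ.
  - by apply: nnmfunZ => //; exact: nnmfunD.
  rewrite /lhs /rhs sepE; have := rho_separated (c w - g i w) (c' w - g i w) L0 e0.
  have -> : c w - g i w - (c' w - g i w) = c w - c' w by ring.
  rewrite -/k.
  have -> : 2^-1 * (c w - g i w + (c' w - g i w)) = mid w - g i w.
    have -> : mid w = 2^-1 * (c w + c' w) by [].
    by field.
  by have -> : 2 * L ^+ 3 / e ^+ 2 = 2 * k by rewrite /k mulrA.
rewrite /lhs /rhs eintD// ?eintZ ?eintD ?eint_indic//; last 3 first.
- exact: msep.
- exact: nnmfunD.
- exact: nnmfunZ.
have fin : mu (sep c c' e) \is a fin_num by exact: fin_num_measure (msep e mc mc').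
rewrite -(fineK fin) => H.
have : ((fine (mu (sep c c' e)))%:E + (2 * k)%:E * (m - dl)%:E <=
   (L^-1 + k)%:E * ((m + dl)%:E + (m + dl)%:E))%E.
  apply: (le_trans _ (le_trans H _)).
    apply: leeD; first by rewrite (fineK fin).
    by rewrite lee_wpmul2l ?lee_fin// ltW.
  by rewrite lee_wpmul2l ?lee_fin//; exact: leeD (cm i) (cm' i).
rewrite -EFinM -!EFinD -EFinM !lee_fin => {}H.
have LE : L^-1 * (4 * m + 4) = e by rewrite /L; field; rewrite !gt_eqF//; lra.
have Li : 0 <= L^-1 by rewrite invr_ge0 ltW.
have := ler_wpM2l Li dl1; lra.
Qed.

(** Choose nearly optimal centers so fast that they converge almost everywhere;
    Fatou's lemma makes the limit optimal. *)
Lemma ex_circumcenter : exists c, radius_le c min_radius.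
Proof.
have /choice[dl dlP] : forall k : nat, exists dl, 0 < dl /\ forall c c',
    radius_le c (min_radius + dl) -> radius_le c' (min_radius + dl) ->
    (mu (sep c c' (2^-1 ^+ k)) <= (2^-1 ^+ k)%:E)%E.
  move=> k; have e0 : 0 < (2^-1 : R) ^+ k by rewrite exprn_gt0.
  by have [dl dl0 H] := near_centers_close e0; exists dl.
(* A decreasing sequence of tolerances below both dl k and 2^-k. *)
pose D := fix D k : R := if k is k'.+1 then Num.min (D k') (Num.min (dl k) (2^-1 ^+ k))
  else Num.min (dl 0%N) 1.
have D0 k : 0 < D k.
  elim: k => [|k IH] /=; first by rewrite lt_min (dlP _).1 ltr01.
  by rewrite !lt_min IH (dlP _).1 exprn_gt0.
have DS k : D k.+1 <= D k by rewrite /= ge_min lexx.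
have Ddl k : D k <= dl k by case: k => [|k] /=; rewrite !ge_min lexx ?orbT.
have Dp k : D k <= 2^-1 ^+ k by case: k => [|k] /=; rewrite !ge_min lexx ?orbT.
have /choice[c cP] : forall k, exists c, radius_le c (min_radius + D k).
  by move=> k; exact: ex_radius_le.
have mc k : cmeasurable (c k) by exact: (cP k).1.
have [k|f mf fc] := ae_cvg_fast mc (mu := mu).
  apply: (dlP k).2; apply: radius_leS (cP _); first by rewrite lerD2l.
  by rewrite lerD2l (le_trans (DS k)).
exists f; split=> // i.
have nf := nnmfun_rho (cmeasurableB mf (mg i)).
have nc k := nnmfun_rho (cmeasurableB (mc k) (mg i)).
pose F k w : \bar R := (rho (c k w - g i w))%:E.
have mF k : measurable_fun setT (F k) by apply/measurable_EFinP; exact: (nc k).1.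
have F0 k w : setT w -> (0 <= F k w)%E by move=> _; rewrite lee_fin; exact: height_ge0.
have mlim : measurable_fun setT (fun w => limn_einf (F ^~ w)).
  have -> : (fun w => limn_einf (F ^~ w)) = (fun w => - limn_esup (fun k => - F k w))%E.
    apply/funext => w; rewrite -limn_einfN; congr limn_einf.
    by apply/funext => k; exact/esym/oppeK.
  apply: (measurableT_comp (@oppe_measurable R setT)) => //.
  by apply: measurable_fun_limn_esup => k; exact: (measurableT_comp (@oppe_measurable R setT)).
have lim0 w : (0 <= limn_einf (F ^~ w))%E.
  rewrite limn_einf_lim; apply: lime_ge; first exact: is_cvg_einfs.
  by apply: nearW => n; apply: le_ereal_inf_tmp => _ [k _ <-]; exact: F0.
have limE : {ae mu, forall w, (rho (f w - g i w))%:E = limn_einf (F ^~ w)}.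
  apply: filterS fc => w [cr ci].
  have rhoE z : rho z = Num.sqrt (1 + (complex.Re z ^+ 2 + complex.Im z ^+ 2)).
    by rewrite /rho /height sqr_rnorm.
  have ReB (x y : R[i]) : complex.Re (x - y) = complex.Re x - complex.Re y.
    by case: x y => ? ? [].
  have ImB (x y : R[i]) : complex.Im (x - y) = complex.Im x - complex.Im y.
    by case: x y => ? ? [].
  have cF : F k w @[k --> \oo] --> (rho (f w - g i w))%:E.
    apply/cvg_EFin; first exact: nearW.
    rewrite /F/=; under eq_fun do rewrite rhoE ReB ImB.
    rewrite rhoE ReB ImB; apply: continuous_cvg; first exact: sqrt_continuous.
    apply: cvgD; first exact: cvg_cst.
    by apply: cvgD; apply: (continuous_cvg _ (@exprn_continuous _ 2 _));
      apply: cvgB => //; exact: cvg_cst.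
  by rewrite (cvg_limn_einf_sup cF).1.
have -> : rho_dist f (g i) = (\int[mu]_w limn_einf (F ^~ w))%E.
  apply: ge0_ae_eq_integral => //.
  - by apply/measurable_EFinP; exact: nf.1.
  - by move=> w _; rewrite lee_fin; exact: height_ge0.
  - by apply: filterS limE => w ->.
apply: le_trans (fatou mu measurableT mF F0) _.
have mD : (min_radius + 2^-1 ^+ k)%:E @[k --> \oo] --> min_radius%:E.
  apply/cvg_EFin; first exact: nearW.
  by rewrite -[X in _ --> X]addr0; apply: cvgD; [exact: cvg_cst|exact: cvg_half_pow].
rewrite limn_einf_lim -(cvg_lim _ mD)//; apply: lee_lim.
- exact: is_cvg_einfs.
- by apply/cvg_ex; eexists; exact: mD.
apply: nearW => n; apply: (@le_trans _ _ (rho_dist (c n) (g i))).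
  by apply: ereal_inf_lbound; exists n => //=.
apply: le_trans ((cP n).2 i) _.
by rewrite lee_fin lerD2l.
Qed.

Lemma circumcenter_unique c c' : radius_le c min_radius -> radius_le c' min_radius ->
  {ae mu, forall w, c w = c' w}.
Proof.
move=> cm cm'; have [mc _] := cm; have [mc' _] := cm'.
have sep0 k : mu (sep c c' k.+1%:R^-1) = 0%E.
  apply/eqP; rewrite eq_le measure_ge0 andbT; apply/lee_addgt0Pr => e e0.
  pose e' := Num.min e k.+1%:R^-1.
  have e'0 : 0 < e' by rewrite lt_min e0 invr_gt0 ltr0n.
  have [dl dl0 H] := near_centers_close e'0.
  have rl x : radius_le x min_radius -> radius_le x (min_radius + dl).
    by apply: radius_leS; rewrite lerDl ltW.
  rewrite add0e; apply: (@le_trans _ _ (mu (sep c c' e'))).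
    rewrite le_measure ?inE//; [exact: msep|exact: msep|].
    by move=> w; apply: le_trans; rewrite ge_min lexx orbT.
  by apply: le_trans (H _ _ (rl _ cm) (rl _ cm')) _; rewrite lee_fin ge_min lexx.
have : {ae mu, forall w, forall k, ~ sep c c' k.+1%:R^-1 w}.
  apply/ae_foralln => k; exists (sep c c' k.+1%:R^-1); split; [exact: msep|exact: sep0|].
  by move=> w /= /contrapT.
apply: filterS => w H; apply/eqP; rewrite -subr_eq0; apply/eqP/rnorm0_eq0.
apply/eqP; rewrite eq_le rnorm_ge0 andbT leNgt; apply/negP => p.
have [k kp] := ltr_add_invr p; apply: (H k); rewrite /sep/=.
by move: kp; rewrite add0r => /ltW.
Qed.

End circumcenter.

(** * Measure preserving actions *)

Section measure_preserving_action.
Context (R : realType) (G : topologicalGroupType) d (T : measurableType d)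
  (mu : {finite_measure set T -> \bar R}) (act : G -> {mfun T >-> T}).
Hypotheses (aeact : ae_action mu act) (mp : measure_preserving mu act).

Lemma ae_act g (P : T -> Prop) : {ae mu, forall w, P w} -> {ae mu, forall w, P (act g w)}.
Proof.
move=> [A [mA A0 PA]]; exists (act g @^-1` A); split.
- by rewrite -[_ @^-1` _]setTI; exact: (measurable_funPT (act g)).
- by rewrite mp.
- by move=> w /= Pw; apply: PA.
Qed.

Lemma eint_act g F : nnmfun F -> eint mu (fun w => F (act g w)) = eint mu F.
Proof.
move=> [mF F0]; rewrite /eint.
rewrite [RHS](@eq_measure_integral _ _ _ setT (image_measure mu (act g))); last first.
  by move=> A mA _; rewrite -[LHS](mp g mA).
have := ge0_integral_pushforward (measurable_funPT (act g)) mu measurableT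
  (f := fun w => (F w)%:E) (_ : measurable_fun _ _).
rewrite preimage_setT; move=> <-//.
- exact/measurable_EFinP.
- by move=> w _; rewrite lee_fin.
Qed.

Lemma nnmfun_act g (F : T -> R) : nnmfun F -> nnmfun (fun w => F (act g w)).
Proof. by move=> [mF F0]; split=> //; exact: (measurableT_comp mF). Qed.

Section fixed_point.
Context (chi : G -> T -> R[i]) (unchi : unimodular_family mu chi).

Lemma rnorm_chi g : {ae mu, forall w, forall z, rnorm (chi g w * z) = rnorm z}.
Proof.
have [_] := unchi g; apply: filterS => w c1 z.
by rewrite rnormM {1}/rnorm c1/= mul1r.
Qed.

(** The affine maps permute the family and preserve [rho_dist], so they carry its
    circumcenter to a circumcenter, which is the same by uniqueness. *)
Lemma equivariant_center (f beta : G -> T -> R[i]) (B : R) :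
  (forall g, cmeasurable (f g)) -> (forall g, cmeasurable (beta g)) ->
  (forall g, (eint mu (fun w => rho (f g w)) <= B%:E)%E) ->
  (forall g h, {ae mu, forall w, f (g * h)%g w = chi g w * f h (act g^-1%g w) + beta g w}) ->
  exists c, [/\ cmeasurable c,
    forall g, {ae mu, forall w, c w = chi g w * c (act g^-1%g w) + beta g w} &
    forall c' a, radius_le mu f c' a -> forall g, (rho_dist mu c (f g) <= a%:E)%E].
Proof.
move=> mf mb fB feq.
have [c cm] := ex_circumcenter 1%g mf fB.
have [mc cd] := cm; exists c; split=> //.
- move=> g; pose tc w := chi g w * c (act g^-1%g w) + beta g w.
  have mtc : cmeasurable tc.
    apply: cmeasurableD => //; apply: cmeasurableM; first exact: (unchi g).1.
    exact: cmeasurable_comp.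
  apply: (circumcenter_unique 1%g mf fB cm); split=> // h.
  rewrite -(mulVKg g h); apply: le_trans (cd (g^-1 * h)%g).
  have nn := nnmfun_rho (cmeasurableB mc (mf (g^-1 * h)%g)).
  rewrite /rho_dist -(eint_act g^-1%g nn); apply: eint_le_ae.
  + exact: nnmfun_rho (cmeasurableB mtc (mf _)).
  + exact: (nnmfun_act g^-1%g nn).
  apply: filterS2 (feq g (g^-1 * h)%g) (rnorm_chi g) => w -> cz.
  rewrite /tc opprD addrACA subrr addr0 -mulrBr /rho cz.
  by [].
- move=> c' a /(min_radius_le 1%g mf fB) ma g; apply: le_trans (cd g) _.
  by rewrite lee_fin.
Qed.

End fixed_point.

(** Every superlevel set is null or conull; the value is the supremum of the levels
    whose superlevel set is conull. *)
Lemma ergodic_const (F : T -> R) : ergodic mu act -> measurable_fun setT F ->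
  (forall g, {ae mu, forall w, F w = F (act g^-1%g w)}) ->
  exists k, {ae mu, forall w, F w = k}.
Proof.
move=> erg mF Finv; have [mu0|mun0] := eqVneq (mu setT) 0%E.
  by exists 0; exists setT; split.
pose A t := [set w | t < F w].
have mA t : measurable (A t) by exact: measurable_set_gt.
have mAC t : measurable (~` A t) by exact: measurableC.
have Adich t : mu (A t) = 0%E \/ mu (~` A t) = 0%E.
  apply: erg => // g; apply/negligibleP.
    by apply: measurableU; apply: measurableD => //;
      rewrite -[_ @^-1` _]setTI; exact: (measurable_funPT (act g^-1%g)).
  apply: negligibleS (Finv g) => w /= H E; move: H; rewrite /A/= -E.
  by case=> -[].
have nulldown s t : s <= t -> mu (~` A t) = 0%E -> mu (~` A s) = 0%E.
  move=> st; apply: subset_measure0 => // w; apply: contra_not => /=.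
  exact: le_lt_trans.
pose S := [set t | mu (~` A t) = 0%E].
have cover (H : nat -> set T) : (forall n, measurable (H n)) ->
    (forall w, exists n, H n w) -> exists n, mu (H n) <> 0%E.
  move=> mH cH; apply: contrapT => /forallNP H0.
  have : mu (\bigcup_n H n) = 0%E.
    apply/negligibleP; first exact: bigcupT_measurable.
    apply: negligible_bigcup => n; apply/negligibleP => //.
    by have /contrapT := H0 n.
  have -> : \bigcup_n H n = setT.
    by apply/seteqP; split=> // w _; have [n] := cH w; exists n.
  by move/eqP; rewrite (negbTE mun0).
have lt_bound w : `|F w| < (Num.bound `|F w|)%:R by exact/archi_boundP/normr_ge0.
have [n1 /= Sn1] : exists n : nat, mu (A (- n%:R)) <> 0%E.
  apply: cover => [n|w]; first exact: mA.
  by exists (Num.bound `|F w|); have := lt_bound w; rewrite ltr_norml => /andP[].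
have [n2 /= Sn2] : exists n : nat, mu (~` A n%:R) <> 0%E.
  apply: cover => [n|w]; first exact: mAC.
  exists (Num.bound `|F w|); rewrite /A/=; apply/negP; rewrite -leNgt.
  by have := lt_bound w; rewrite ltr_norml => /andP[_ /ltW].
have S1 : S (- n1%:R) by have [] := Adich (- n1%:R).
have Sub : ubound S n2%:R.
  move=> t St; rewrite leNgt; apply/negP => tn.
  by apply: Sn2; apply: nulldown St; exact: ltW.
have hS : has_sup S by split; [exists (- n1%:R)|exists n2%:R].
exists (sup S).
have lo k : mu (~` A (sup S - k.+1%:R^-1)) = 0%E.
  have k0 : 0 < (k.+1%:R^-1 : R) by rewrite invr_gt0 ltr0n.
  by have [t St /ltW kt] := sup_adherent k0 hS; exact: nulldown kt St.
have hi k : mu (A (sup S + k.+1%:R^-1)) = 0%E.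
  have [//|St] := Adich (sup S + k.+1%:R^-1).
  have := ub_le_sup hS.2 St; rewrite gerDl leNgt invr_gt0 ltr0n//.
have L : {ae mu, forall w, forall k, ~ (~` A (sup S - k.+1%:R^-1)) w}.
  apply/ae_foralln => k; exists (~` A (sup S - k.+1%:R^-1)).
  by split; [exact: mAC|exact: lo|move=> w /= /contrapT].
have H : {ae mu, forall w, forall k, ~ A (sup S + k.+1%:R^-1) w}.
  apply/ae_foralln => k; exists (A (sup S + k.+1%:R^-1)).
  by split; [exact: mA|exact: hi|move=> w /= /contrapT].
apply: filterS2 L H => w L H; apply/eqP; rewrite eq_le; apply/andP; split.
  rewrite leNgt; apply/negP; rewrite -subr_gt0 => p.
  have [k kp] := ltr_add_invr p; apply: (H k); rewrite /A/=.
  by move: kp; rewrite add0r ltrBrDl.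
rewrite leNgt; apply/negP; rewrite -subr_gt0 => p.
have [k kp] := ltr_add_invr p; apply: (L k); rewrite /A/=; apply/negP; rewrite -leNgt.
by move: kp; rewrite add0r => /ltW; rewrite lerBrDr [in X in _ -> X]lerBrDr addrC.
Qed.

End measure_preserving_action.

(** * Integrals of bounded functions *)

Section bounded_integral.
Context d (T : measurableType d) (R : realType) (mu : {finite_measure set T -> \bar R}).
Implicit Types (F : T -> R).

Definition rint F : R := fine (eint mu F).
Definition bmfun (M : R) F := measurable_fun setT F /\ forall w, `|F w| <= M.

Lemma bmfun_integrable M F : bmfun M F -> mu.-integrable setT (EFin \o F).
Proof.
move=> [mF FM]; apply: (le_integrable measurableT (g := EFin \o cst M)).
- exact/measurable_EFinP.
- by move=> w _; rewrite lee_fin (le_trans (FM w))// ler_norm.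
- exact: finite_measure_integrable_cst.
Qed.

Lemma eint_fin F M : nnmfun F -> (eint mu F <= M%:E)%E -> eint mu F = (rint F)%:E.
Proof.
move=> nF FM; rewrite /rint fineK// ge0_fin_numE ?eint_ge0//.
by apply: le_lt_trans FM _; exact: ltry.
Qed.

Lemma eint_bmfun M F : nnmfun F -> bmfun M F -> eint mu F = (rint F)%:E.
Proof.
move=> nF /bmfun_integrable bF; rewrite /rint fineK//.
exact: integrable_fin_num.
Qed.

(** Exchanging finite sums and integrals is how positive definiteness of an integral
    is read off its integrand. *)
Lemma rint_sum (I : Type) (s : seq I) (a M : I -> R) (F : I -> T -> R) :
  (forall i, bmfun (M i) (F i)) ->
  \sum_(i <- s) a i * rint (F i) = rint (fun w => \sum_(i <- s) a i * F i w).
Proof.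
move=> bF; suff [] : mu.-integrable setT (EFin \o (fun w => \sum_(i <- s) a i * F i w)) /\
  \sum_(i <- s) a i * rint (F i) = rint (fun w => \sum_(i <- s) a i * F i w) by [].
elim: s => [|i s [Is IE]].
  split.
    rewrite (_ : EFin \o _ = EFin \o cst 0); first exact: finite_measure_integrable_cst.
    by apply/funext => w /=; rewrite big_nil.
  rewrite big_nil /rint; under [X in eint _ X]eq_fun do rewrite big_nil.
  by rewrite eint_cst mul0e.
have E : (fun w => \sum_(j <- i :: s) a j * F j w) =
    (fun w => a i * F i w + \sum_(j <- s) a j * F j w).
  by apply/funext => w; rewrite big_cons.
have Fi := bmfun_integrable (bF i).
have Fa : mu.-integrable setT (EFin \o (fun w => a i * F i w)).
  rewrite (_ : _ \o _ = (fun w => (a i)%:E * (EFin \o F i) w)%E); last by [].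
  exact: integrableZl.
rewrite E big_cons IE; split.
  exact: (integrableD measurableT Fa Is).
rewrite /rint /eint -!/(Rintegral _ _ _) -RintegralZl// -RintegralD//.
Qed.

Lemma rint_ge0 F : (forall w, 0 <= F w) -> 0 <= rint F.
Proof. by move=> F0; apply: fine_ge0; apply: integral_ge0 => w _; rewrite lee_fin. Qed.

Lemma rintB M F H : bmfun M F -> bmfun M H -> rint F - rint H = rint (fun w => F w - H w).
Proof.
move=> bF bH; rewrite /rint /eint -!/(Rintegral _ _ _) -RintegralB//.
- exact: (bmfun_integrable bF).
- exact: (bmfun_integrable bH).
Qed.

Lemma eint_fatou (F : nat -> T -> R) (f : T -> R) M : (forall n, nnmfun (F n)) -> nnmfun f ->
  (forall n, (eint mu (F n) <= M%:E)%E) ->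
  (forall w, exists N, forall n, (N <= n)%N -> F n w = f w) ->
  (eint mu f <= M%:E)%E.
Proof.
move=> nF nf FM Ff.
have cF w : (F n w)%:E @[n --> \oo] --> (f w)%:E.
  have [N FN] := Ff w; apply: cvg_near_cst; exists N => // n /= Nn.
  by rewrite FN.
have E : eint mu f = (\int[mu]_w limn_einf (fun n => (F n w)%:E))%E.
  by apply: eq_integral => w _; rewrite (cvg_limn_einf_sup (cF w)).1.
rewrite E; apply: le_trans (fatou mu measurableT _ _) _.
- by move=> n; apply/measurable_EFinP; exact: (nF n).1.
- by move=> n w _; rewrite lee_fin; exact: (nF n).2.
rewrite limn_einf_lim; apply: lime_le; first exact: is_cvg_einfs.
apply: nearW => n; apply: le_trans (FM n).
by apply: ereal_inf_lbound; exists n => //=.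
Qed.

End bounded_integral.

Section integral_continuity.
Context d (T : measurableType d) (R : realType) (mu : {finite_measure set T -> \bar R}).
Context (X : topologicalType) (b : X -> T -> R[i]) (mb : forall g, cmeasurable (b g)).

Definition L1_continuous := forall g0 (e : R), 0 < e -> \forall g \near g0,
  (eint mu (fun w => rnorm (b g w - b g0 w)) <= e%:E)%E.

Lemma continuous_rint (L M : R) (F : X -> T -> R) : L1_continuous -> 0 <= L ->
  (forall g, bmfun M (F g)) ->
  (forall g g0, {ae mu, forall w, `|F g w - F g0 w| <= L * rnorm (b g w - b g0 w)}) ->
  continuous (fun g => rint mu (F g)).
Proof.
move=> cb L0 bF FL g0; apply/cvgrPdist_le => e e0.
have L1 : 0 < L + 1 by rewrite ltr_wpDl.
have eL : 0 < e / (L + 1) by rewrite divr_gt0.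
apply: filterS (cb g0 _ eL) => g bg.
rewrite distrC (rintB mu (bF g) (bF g0)).
have bB : bmfun (M + M) (fun w => F g w - F g0 w).
  split; first by apply: measurable_funB; [exact: (bF g).1|exact: (bF g0).1].
  by move=> w; rewrite (le_trans (ler_normB _ _))// lerD//; [exact: (bF g).2|exact: (bF g0).2].
apply: le_trans (le_normr_Rintegral measurableT (bmfun_integrable mu bB)) _.
have nB : nnmfun (fun w => `|F g w - F g0 w|).
  by split=> [|w //]; exact: (measurableT_comp _ bB.1).
have bN : bmfun (M + M) (fun w => `|F g w - F g0 w|).
  by split=> [|w]; [exact: nB.1|rewrite normr_id; exact: bB.2].
rewrite -lee_fin -[X in X%:E]/(rint mu (fun w => `|F g w - F g0 w|)) -(eint_bmfun mu nB bN).
have nb := nnmfun_rnorm (cmeasurableB (mb g) (mb g0)).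
apply: le_trans (eint_le_ae nB (nnmfunZ L0 nb) (FL g g0)) _.
rewrite eintZ//; apply: le_trans (lee_wpmul2l _ bg) _; first by rewrite lee_fin.
rewrite -EFinM lee_fin mulrA ler_pdivrMr// mulrC ler_wpM2l ?ltW//; lra.
Qed.

End integral_continuity.

(** * Cocycles are bounded in L_1 *)

Lemma rnorm_real (R : realType) (x : R) : rnorm (x%:C%C : R[i]) = `|x|.
Proof. by rewrite /rnorm normc_def /= expr0n addr0 sqrtr_sqr. Qed.

Lemma rnorm_dist (R : realType) (x y : R[i]) : `|rnorm x - rnorm y| <= rnorm (x - y).
Proof.
have H (u v : R[i]) : rnorm u - rnorm v <= rnorm (u - v).
  by rewrite lerBlDr -{1}[u](subrK v) ler_rnormD.
have h1 := H x y; have := H y x; rewrite -(rnormN (y - x)) opprB => h2.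
by rewrite ler_norml h1 andbT; lra.
Qed.

Section bounded_cocycle.
Context (R : realType) (G : topologicalGroupType) d (T : measurableType d)
  (mu : {finite_measure set T -> \bar R}) (act : G -> {mfun T >-> T}).
Hypotheses (aeact : ae_action mu act) (mp : measure_preserving mu act).
Context (chi : G -> T -> R[i]) (unchi : unimodular_family mu chi).
Context (C : R) (s : seq G).
Hypotheses (C0 : 0 <= C) (kaz : forall phi : G -> R, continuous phi -> positive_definite phi ->
  forall g, phi 1%g - phi g <= C * \sum_(t <- s) (phi 1%g - phi t)).
Context (b : G -> T -> R[i]) (mb : forall g, cmeasurable (b g)).
Hypotheses (bM : forall g h, {ae mu, forall w,
    b (g * h)%g w = b g w + chi g w * b h (act g^-1%g w)})
  (bc : L1_continuous mu b)
  (b1 : forall g, (eint mu (fun w => rnorm (b g w)) < +oo)%E).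

Let gauss (n : nat) (z : R[i]) : R := expR (- (rnorm z / 2 ^+ n) ^+ 2).

Let measurable_gauss n (f : T -> R[i]) : cmeasurable f -> nnmfun (fun w => gauss n (f w)).
Proof.
move=> mf; split=> [|w]; last exact: expR_ge0.
apply: (measurableT_comp (f := fun t : R => expR (- (t / 2 ^+ n) ^+ 2))); last exact: cmeasurable_rnorm.
apply: continuous_measurable_fun => t.
apply: (@continuous_comp _ _ _ (fun t : R => - (t / 2 ^+ n) ^+ 2) expR); last exact: continuous_expR.
apply: cvgN; apply: (continuous_cvg _ (@exprn_continuous _ 2 _)).
by apply: cvgMl; exact: cvg_id.
Qed.

Let gauss_bmfun n (f : T -> R[i]) : cmeasurable f -> bmfun 1 (fun w => gauss n (f w)).
Proof.
move=> mf; split; first exact: (measurable_gauss n mf).1.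
by move=> w; rewrite ger0_norm ?expR_ge0// -expR0 ler_expR oppr_le0 sqr_ge0.
Qed.

Lemma cocycle1 : {ae mu, forall w, b 1%g w = 0}.
Proof.
have H : {ae mu, forall w, b 1%g (act 1%g w) = 0}.
  apply: filterS2 (bM 1%g 1%g) (rnorm_chi unchi 1%g) => w.
  rewrite mulg1 invg1 => /eqP; rewrite addrC -subr_eq subrr eq_sym => /eqP h c.
  by apply: rnorm0_eq0; rewrite -c h rnorm0.
by apply: filterS2 aeact.1 H => w ->.
Qed.

Let phi n g := rint mu (fun w => gauss n (b g w)).

Let phi_kernel n x y : phi n (x^-1 * y)%g = rint mu (fun w => gauss n (b y w - b x w)).
Proof.
rewrite /phi /rint; congr fine.
have nn := measurable_gauss n (mb (x^-1 * y)%g).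
rewrite -(eint_act mp x^-1%g nn); apply: eint_ae_eq.
- exact: (nnmfun_act act x^-1%g nn).
- exact: (measurable_gauss n (cmeasurableB (mb y) (mb x))).
apply: filterS2 (bM x (x^-1 * y)%g) (rnorm_chi unchi x) => w.
rewrite mulVKg => -> c; rewrite [b x w + _]addrC addrK /gauss.
by rewrite c.
Qed.

Let phi_pd n : positive_definite (phi n).
Proof.
split=> [x y|v].
  by rewrite /gkernel !phi_kernel; congr rint; apply/funext => w; rewrite /gauss -rnormN opprB.
rewrite qformE /gkernel.
have -> : \sum_(r <- v) \sum_(p <- v) r.1 * p.1 * phi n (p.2^-1 * r.2)%g =
    rint mu (fun w => \sum_(x <- [seq (r, p) | r <- v, p <- v]) x.1.1 * x.2.1 *
      gauss n (b x.1.2 w - b x.2.2 w)).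
  rewrite -(@rint_sum _ _ _ mu _ _ (fun x : (R * G) * (R * G) => x.1.1 * x.2.1) (fun=> 1)); last first.
    by move=> x; exact: (gauss_bmfun n (cmeasurableB (mb _) (mb _))).
  by rewrite big_allpairs; apply: eq_bigr => r _; apply: eq_bigr => p _; rewrite phi_kernel.
apply: rint_ge0 => w; rewrite big_allpairs.
have := gaussian_kernel_ge0 [seq (p.1, (2 ^- n)%:C%C * b p.2 w) | p <- v].
rewrite big_map; congr (_ <= _); apply: eq_bigr => r _; rewrite big_map; apply: eq_bigr => p _ /=.
congr (_ * expR (- (_ ^+ 2))).
have pn : 0 < (2 ^- n : R) by rewrite invr_gt0 exprn_gt0.
rewrite -mulrBr rnormM mulrC; have -> : rnorm ((2 ^- n)%:C%C : R[i]) = 2 ^- n.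
  by rewrite rnorm_real ger0_norm// ltW.
by rewrite -rnormN opprB.
Qed.

Let gaussE n z : gauss n z = 1 - kap (rnorm z / 2 ^+ n).
Proof. by rewrite /kap subKr. Qed.

Let phi_continuous n : continuous (phi n).
Proof.
apply: (continuous_rint mb (L := 2) (M := 1) bc) => //; first by move=> g; exact: gauss_bmfun.
move=> g g0; apply: aeW => w.
have -> : gauss n (b g w) - gauss n (b g0 w) =
    kap (rnorm (b g0 w) / 2 ^+ n) - kap (rnorm (b g w) / 2 ^+ n) by rewrite !gaussE; ring.
have p n' : 0 < (2 ^+ n' : R) by rewrite exprn_gt0.
apply: le_trans (kap_lipschitz _ _) _; rewrite ?divr_ge0 ?rnorm_ge0 ?(ltW (p _))//.
rewrite ler_pM2l// -mulrBl normrM [X in _ * X]ger0_norm ?invr_ge0 ?(ltW (p _))//.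
apply: (@le_trans _ _ `|rnorm (b g0 w) - rnorm (b g w)|).
  by rewrite ler_piMr// invf_le1// exprn_ege1// ler1n.
by rewrite distrC rnorm_dist.
Qed.

Let phi_gap n g : phi n 1%g - phi n g = rint mu (fun w => kap (rnorm (b g w) / 2 ^+ n)).
Proof.
rewrite (rintB mu (gauss_bmfun n (mb 1%g)) (gauss_bmfun n (mb g))).
rewrite /rint; congr fine; apply: ae_eq_integral => //.
- apply/measurable_EFinP; apply: measurable_funB; exact: (measurable_gauss n (mb _)).1.
- rewrite (_ : (fun w => _) = (fun w => (1 - gauss n (b g w))%:E)).
    by apply/measurable_EFinP; apply: measurable_funB => //; exact: (measurable_gauss n (mb _)).1.
  by apply/funext => w; rewrite gaussE subKr.
apply: filterS cocycle1 => w b1w _; congr EFin.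
by rewrite !gaussE b1w rnorm0 mul0r /kap expr0n oppr0 expR0; ring.
Qed.

Let kap_bmfun n g : bmfun 1 (fun w => kap (rnorm (b g w) / 2 ^+ n)).
Proof.
split=> [|w]; last by rewrite ger0_norm ?kap_ge0// kap_le1.
rewrite (_ : (fun w => _) = (fun w => (1 - gauss n (b g w)))).
  by apply: measurable_funB => //; exact: (measurable_gauss n (mb _)).1.
by apply/funext => w; rewrite gaussE subKr.
Qed.

Let kapsum_rint N g : \sum_(n < N) 2 ^+ n * (phi n 1%g - phi n g) =
  rint mu (fun w => kapsum N (rnorm (b g w))).
Proof.
under eq_bigr do rewrite phi_gap.
by rewrite (rint_sum mu _ _ (fun n : 'I_N => kap_bmfun n g)).
Qed.

Let nnmfun_kapsum N g : nnmfun (fun w => kapsum N (rnorm (b g w))).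
Proof.
split=> [|w]; last by apply: sumr_ge0 => n _; rewrite mulr_ge0 ?kap_ge0// exprn_ge0.
apply: measurable_sum => n; apply: measurable_funM => //; exact: (kap_bmfun n g).1.
Qed.

(** Sum the gap inequality of the Gaussian functions [phi n] over [n] with weights
    [2 ^ n]: by [kapsumS] and its bounds both sides become comparable to integrals of
    [rnorm (b g)], truncated at [2 ^ N] on the left; then let [N] grow. *)
Lemma bounded_cocycle : exists M, forall g, (eint mu (fun w => rnorm (b g w)) <= M%:E)%E.
Proof.
pose I g := rint mu (fun w => rnorm (b g w)).
have IE g : eint mu (fun w => rnorm (b g w)) = (I g)%:E.
  rewrite /I /rint fineK// ge0_fin_numE//; exact/eint_ge0/nnmfun_rnorm.
pose M0 := C * \sum_(t <- s) 3 * I t.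
have kapM N g : rint mu (fun w => kapsum N (rnorm (b g w))) <= M0.
  rewrite -kapsum_rint.
  apply: (@le_trans _ _ (\sum_(n < N) 2 ^+ n * (C * \sum_(t <- s) (phi n 1%g - phi n t)))).
    apply: ler_sum => n _; rewrite ler_wpM2l ?exprn_ge0//.
    by apply: kaz; [exact: phi_continuous|exact: phi_pd].
  under eq_bigr do rewrite mulrCA; rewrite -mulr_sumr ler_wpM2l//.
  under eq_bigr do rewrite mulr_sumr; rewrite exchange_big/=; apply: ler_sum => t _.
  rewrite kapsum_rint -lee_fin.
  have nr := nnmfun_rnorm (mb t).
  have le3 : (eint mu (fun w => kapsum N (rnorm (b t w))) <= (3 * I t)%:E)%E.
    rewrite EFinM -IE -eintZ//; apply: eint_le => //; first exact: nnmfunZ.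
    by move=> w; apply: kapsum_le; exact: rnorm_ge0.
  by rewrite -(eint_fin (nnmfun_kapsum N t) le3).
exists (fine (mu setT) + 2 * M0) => g.
pose F N w := Num.min (rnorm (b g w)) (2 ^+ N).
have nF N : nnmfun (F N).
  split=> [|w]; last by rewrite le_min rnorm_ge0 exprn_ge0.
  by apply: measurable_minr => //; exact: cmeasurable_rnorm.
apply: (@eint_fatou _ _ _ mu F) => //; first exact: nnmfun_rnorm.
  move=> N.
  have nk := nnmfun_kapsum N g.
  apply: (@le_trans _ _ (eint mu (fun w => 1 + 2 * kapsum N (rnorm (b g w))))).
    apply: eint_le => //; first by apply: nnmfunD; [exact: nnmfun_cst|exact: nnmfunZ].
    by move=> w; have := kapsum_ge N (rnorm_ge0 (b g w)); rewrite /F; lra.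
  have n1 : nnmfun ((fun=> 1) : T -> R) by exact: nnmfun_cst.
  have n2 : nnmfun (fun w => 2 * kapsum N (rnorm (b g w))) by exact: nnmfunZ.
  rewrite (eintD mu n1 n2) eintZ//.
  have fm : mu setT \is a fin_num by exact: fin_num_measure.
  have -> : eint mu (fun=> 1) = (fine (mu setT))%:E by rewrite eint_cst mul1e fineK.
  apply: (@leeD _ _ (fine (mu setT))%:E _ (2 * M0)%:E); first by [].
  rewrite [leRHS]EFinM lee_wpmul2l//.
  have kb : bmfun (3 * 2 ^+ N * 0 + \sum_(n < N) 2 ^+ n) (fun w => kapsum N (rnorm (b g w))).
    split; first exact: nk.1.
    move=> w; rewrite mulr0 add0r ger0_norm ?nk.2//; apply: ler_sum => n _.
    by rewrite ler_piMr ?exprn_ge0// kap_le1.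
  by rewrite (eint_bmfun mu nk kb) lee_fin.
move=> w; have [N _ HN] : exists2 N : nat, True & rnorm (b g w) <= 2 ^+ N.
  exists (Num.bound (rnorm (b g w))) => //.
  apply: (le_trans (ltW (archi_boundP (rnorm_ge0 _)))).
  by rewrite -natrX ler_nat ltnW// ltn_expl.
exists N => n Nn; rewrite /F; apply/min_idPl; apply: le_trans HN _.
by rewrite ler_eXn2l// ltr1n.
Qed.

End bounded_cocycle.

(** * The spectral gap of the Koopman representation *)

Section koopman.
Context (R : realType) (G : topologicalGroupType) d (T : measurableType d)
  (mu : {finite_measure set T -> \bar R}) (act : G -> {mfun T >-> T}).
Hypotheses (aeact : ae_action mu act) (mp : measure_preserving mu act).
Context (chi : G -> T -> R[i]) (unchi : unimodular_family mu chi).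
Context (C : R) (s : seq G).
Hypotheses (C0 : 0 <= C) (kaz : forall phi : G -> R, continuous phi -> positive_definite phi ->
  forall g, phi 1%g - phi g <= C * \sum_(t <- s) (phi 1%g - phi t)).
Hypothesis chi_cont : forall f : T -> R, nnmfun f -> bmfun 1 f ->
  L1_continuous mu (fun g w => chi g w * (f (act g^-1%g w))%:C%C).

Section one_function.
Context (f : T -> R) (nf : nnmfun f) (bf : bmfun 1 f).

Let fg g w := f (act g^-1%g w).
Let nfg g : nnmfun (fg g). Proof. exact: (nnmfun_act act g^-1%g nf). Qed.
Let bfg g : bmfun 1 (fg g).
Proof. by split=> [|w]; [exact: (nfg g).1|exact: bf.2]. Qed.

Let nfgM g h : nnmfun (fun w => fg g w * fg h w).
Proof.
split=> [|w]; first by apply: measurable_funM; exact: (nfg _).1.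
by rewrite mulr_ge0// (nfg _).2.
Qed.

Let bfgM g h : bmfun 1 (fun w => fg g w * fg h w).
Proof.
split=> [|w]; first exact: (nfgM g h).1.
by rewrite normrM mulr_ile1// (bfg _).2.
Qed.

Let phi g := rint mu (fun w => fg 1%g w * fg g w).

Let fg1 : {ae mu, forall w, fg 1%g w = f w}.
Proof. by apply: filterS aeact.1 => w; rewrite /fg invg1 => ->. Qed.

Let phi_kernel x y : phi (x^-1 * y)%g = rint mu (fun w => fg x w * fg y w).
Proof.
rewrite /phi /rint; congr fine.
rewrite -(eint_act mp x^-1%g (nfgM _ _)); apply: eint_ae_eq => //.
  exact: (nnmfun_act act x^-1%g (nfgM _ _)).
have f1x := ae_act mp x^-1%g fg1.
apply: filterS2 (aeact.2 (x^-1 * y)^-1%g x^-1%g) f1x => w.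
by move=> E ->; rewrite /fg -E invgM invgK -mulgA mulgV mulg1.
Qed.

Let phi_pd : positive_definite phi.
Proof.
split=> [x y|v].
  by rewrite /gkernel !phi_kernel; congr rint; apply/funext => w; rewrite mulrC.
rewrite qformE /gkernel.
have -> : \sum_(r <- v) \sum_(p <- v) r.1 * p.1 * phi (p.2^-1 * r.2)%g =
    rint mu (fun w => \sum_(x <- [seq (r, p) | r <- v, p <- v]) x.1.1 * x.2.1 *
      (fg x.2.2 w * fg x.1.2 w)).
  rewrite -(@rint_sum _ _ _ mu _ _ (fun x : (R * G) * (R * G) => x.1.1 * x.2.1) (fun=> 1)); last first.
    by move=> x; exact: bfgM.
  by rewrite big_allpairs; apply: eq_bigr => r _; apply: eq_bigr => p _; rewrite phi_kernel.
apply: rint_ge0 => w; rewrite big_allpairs.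
have -> : \sum_(r <- v) \sum_(p <- v) r.1 * p.1 * (fg p.2 w * fg r.2 w) =
    (\sum_(r <- v) r.1 * fg r.2 w) ^+ 2.
  rewrite expr2 mulr_suml; apply: eq_bigr => r _; rewrite mulr_sumr.
  by apply: eq_bigr => p _; ring.
exact: sqr_ge0.
Qed.

Let phi_continuous : continuous phi.
Proof.
pose b g w := chi g w * ((f (act g^-1%g w))%:C)%C.
have mb g : cmeasurable (b g).
  apply: cmeasurableM; first exact: (unchi g).1.
  by apply: cmeasurable_real; exact: (nfg g).1.
apply: (continuous_rint mb (L := 1) (M := 1) (chi_cont nf bf)) => // g g0.
apply: filterS2 (rnorm_chi unchi g) (rnorm_chi unchi g0) => w cg cg0.
rewrite mul1r -mulrBr normrM; apply: (@le_trans _ _ `|fg g w - fg g0 w|).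
  by rewrite ler_piMl// (bfg _).2.
have E h : rnorm (chi h w * ((f (act h^-1%g w))%:C)%C) = rnorm (((f (act h^-1%g w))%:C)%C) ->
    fg h w = rnorm (b h w).
  by rewrite /b => ->; rewrite rnorm_real ger0_norm// nf.2.
by rewrite (E g)// (E g0)// rnorm_dist.
Qed.

Definition koopman_sqdist g := rint mu (fun w => (f (act g^-1%g w) - f w) ^+ 2).

Let phi_gap g : phi 1%g - phi g = 2^-1 * koopman_sqdist g.
Proof.
have gg : phi 1%g = rint mu (fun w => fg g w * fg g w) by rewrite -phi_kernel mulVg.
have E : koopman_sqdist g = rint mu (fun w => \sum_(x <- [:: (1, (g, g)); (1, (1, 1)%g); (-2, (1%g, g))])
     x.1 * (fg x.2.1 w * fg x.2.2 w)).
  rewrite /koopman_sqdist /rint; congr fine; apply: eint_ae_eq.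
  - split=> [|w]; last exact: sqr_ge0.
    by apply: measurable_funX; apply: measurable_funB; [exact: (nfg g).1|exact: nf.1].
  - split=> [|w].
      by apply: measurable_sum => x; apply: measurable_funM => //; exact: (nfgM _ _).1.
    rewrite !big_cons big_nil/=.
    by have := sqr_ge0 (fg g w - fg 1%g w); rewrite sqrrB; lra.
  by apply: filterS fg1 => w f1; rewrite !big_cons big_nil/= f1 /fg; ring.
rewrite E -(@rint_sum _ _ _ mu _ _ (fun x : R * (G * G) => x.1) (fun=> 1)); last first.
  by move=> x; exact: bfgM.
by rewrite !big_cons big_nil/= -gg /phi; field.
Qed.

(** The matrix coefficient [phi g] of [f] in the Koopman representation is positive
    definite, and [phi 1 - phi g] is half the squared displacement of [f]. *)
Lemma koopman_gap g : koopman_sqdist g <= C * \sum_(t <- s) koopman_sqdist t.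
Proof.
have := kaz phi_continuous phi_pd g; rewrite phi_gap.
under eq_bigr do rewrite phi_gap; rewrite -mulr_sumr; lra.
Qed.

(** The circumcenter of the orbit of [f] is invariant, hence a constant [m], and its
    radius is at most that of [f] itself, [mu setT + V / 2] as
    [height t <= 1 + t ^ 2 / 2]. Now [m] is at distance at least 1/2 from 0 or from
    1, so on [f = 0] or on [f = 1] the integrand exceeds 1 by at least 1/10. *)
Lemma koopman_level (V : R) : ergodic mu act -> (forall g, koopman_sqdist g <= V) ->
  (mu (f @^-1` [set 1%R]) <= mu (f @^-1` [set 0%R]))%E ->
  (mu (f @^-1` [set 1%R]) <= (5 * V)%:E)%E.
Proof.
move=> erg fV m10.
pose F g w : R[i] := ((fg g w)%:C)%C.
have mF g : cmeasurable (F g) by apply: cmeasurable_real; exact: (nfg g).1.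
(* The orbit is equivariant for the linear action without multiplier. *)
have un1 : unimodular_family mu (fun (g : G) (w : T) => 1 : R[i]).
  move=> g; split; first exact: cmeasurable_cst.
  by apply: aeW => w; rewrite normr1.
pose muT := fine (mu setT).
have ET (k : R) : eint mu ((fun=> k) : T -> R) = (k * muT)%:E.
  by rewrite eint_cst EFinM /muT fineK//; exact: fin_num_measure.
have FB g : (eint mu (fun w => rho (F g w)) <= (2 * muT)%:E)%E.
  apply: (@le_trans _ _ (eint mu ((fun=> 2) : T -> R))); last by rewrite ET.
  apply: eint_le; [exact: nnmfun_rho|exact: nnmfun_cst|].
  move=> w; apply: le_trans (height_leD (rnorm_ge0 _)) _; rewrite /F rnorm_real.
  by have := (bfg g).2 w; lra.
have Feq g h : {ae mu, forall w, F (g * h)%g w = 1 * F h (act g^-1%g w) + 0}.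
  apply: filterS (aeact.2 h^-1%g g^-1%g) => w; rewrite -invgM => E.
  by rewrite mul1r addr0 /F /fg E.
have [c [mc cinv cmin]] := equivariant_center mp un1 mF
  (fun=> cmeasurable_cst T 0) FB Feq.
have {}cinv g : {ae mu, forall w, c w = c (act g^-1%g w)}.
  by apply: filterS (cinv g) => w; rewrite mul1r addr0.
have [kr ckr] : exists k, {ae mu, forall w, complex.Re (c w) = k}.
  apply: (ergodic_const erg mc.1) => g.
  by apply: filterS (cinv g) => w /= {1}->.
have [ki cki] : exists k, {ae mu, forall w, complex.Im (c w) = k}.
  apply: (ergodic_const erg mc.2) => g.
  by apply: filterS (cinv g) => w /= {1}->.
pose m : R[i] := (kr +i* ki)%C.
have cm : {ae mu, forall w, c w = m}.
  by apply: filterS2 ckr cki => w; case: (c w) => x y /= -> ->.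
have V0 : 0 <= V by apply: le_trans (fV 1%g); apply: rint_ge0 => w; exact: sqr_ge0.
pose f0 w : R[i] := ((f w)%:C)%C.
have mf0 : cmeasurable f0 by apply: cmeasurable_real; exact: nf.1.
have rad : radius_le mu F f0 (muT + 2^-1 * V).
  split=> // g.
  have nsq : nnmfun (fun w => (f (act g^-1%g w) - f w) ^+ 2).
    split=> [|w]; last exact: sqr_ge0.
    by apply: measurable_funX; apply: measurable_funB; [exact: (nfg g).1|exact: nf.1].
  have bsq : bmfun (2 ^+ 2) (fun w => (f (act g^-1%g w) - f w) ^+ 2).
    split=> [|w]; first exact: nsq.1.
    rewrite normrX ler_pXn2r ?nnegrE// (le_trans (ler_normB _ _))//.
    by have := bf.2 (act g^-1%g w); have := bf.2 w; lra.
  have n2 : nnmfun (fun w => 2^-1 * (f (act g^-1%g w) - f w) ^+ 2) by exact: nnmfunZ.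
  have n1 : nnmfun ((fun=> 1) : T -> R) by exact: nnmfun_cst.
  apply: (@le_trans _ _ (eint mu (fun w => 1 + 2^-1 * (f (act g^-1%g w) - f w) ^+ 2))).
    apply: eint_le; [exact: nnmfun_rho (cmeasurableB mf0 (mF g))|exact: nnmfunD|].
    move=> w; rewrite /f0 /F /fg -rmorphB/= /rho rnorm_real.
    apply: le_trans (height_le_sqr _) _; rewrite real_normK ?num_real// -sqrrN opprB.
    by rewrite mulrC.
  rewrite (eintD mu n1 n2) eintZ// ET mul1r (eint_bmfun mu nsq bsq) -EFinM -EFinD lee_fin.
  by rewrite lerD2l ler_wpM2l//; exact: fV.
have H := cmin _ _ rad 1%g.
have mset (x : R) : measurable (f @^-1` [set x]).
  have := nf.1 measurableT [set x] (measurable_set1 x); rewrite setTI.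
  by [].
have low (x : R) : `|x| <= 1 -> 2^-1 <= rnorm (m - (x%:C)%C) ->
    (mu (f @^-1` [set x]) <= (5 * V)%:E)%E.
  move=> x1 mx.
  have h10 : 11 / 10 <= height (2^-1) :> R.
    rewrite -(ler_pXn2r (ltn0Sn 1)) ?nnegrE ?height_ge0 ?divr_ge0// sqr_height; lra.
  have nI := @nnmfun_indic _ _ R _ (mset x).
  have n1 : nnmfun ((fun=> 1) : T -> R) by exact: nnmfun_cst.
  have nI2 : nnmfun (fun w => 10^-1 * (\1_(f @^-1` [set x]) w : R)) by exact: nnmfunZ.
  pose low_fun w : R := 1 + 10^-1 * \1_(f @^-1` [set x]) w.
  have : (eint mu low_fun <= (muT + 2^-1 * V)%:E)%E.
    apply: le_trans H; apply: eint_le_ae; [exact: nnmfunD| |].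
      exact: nnmfun_rho (cmeasurableB mc (mF _)).
    apply: filterS2 cm fg1 => w -> f1w; rewrite /low_fun /F f1w indicE.
    have [fx|_] := boolP (w \in (f @^-1` [set x])); last by rewrite mulr0 addr0 height_ge1.
    move: fx; rewrite inE/= => ->; rewrite /rho.
    have := ler_height (_ : 0 <= 2^-1) mx; rewrite invr_ge0 ler0n => /(_ isT); lra.
  rewrite /low_fun (eintD mu n1 nI2) eintZ// ET mul1r eint_indic//.
  have mfin : mu (f @^-1` [set x]) \is a fin_num by exact: fin_num_measure.
  move=> le_low; have {le_low} : (muT%:E + (10^-1)%:E * mu (f @^-1` [set x]) <= (muT + 2^-1 * V)%:E)%E.
    exact: le_low.
  by rewrite -(fineK mfin) -EFinM -EFinD !lee_fin; lra.
have [m0|m0] := leP 2^-1 (rnorm (m - (0%:C)%C)).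
  by apply: le_trans m10 _; apply: low m0; rewrite normr0.
apply: low; first by rewrite normr1.
have := rnorm_dist ((1%:C)%C : R[i]) (m - (0%:C)%C).
have := rnorm_dist m ((1%:C)%C : R[i]).
move: m0; rewrite subr0 rnorm_real normr1 !ler_norml => m0 /andP[h1 _] _; lra.
Qed.

End one_function.
End koopman.

(** * Dyadic levels *)

Section dyadic.
Context (R : realType) (p : R) (p1 : 1 <= p).
Implicit Types (x y e r : R).

Definition ramp x := Num.min (Num.max (x - 1) 0) 1.

Lemma ramp_ge0 x : 0 <= ramp x.
Proof. by rewrite /ramp le_min le_max lexx orbT ler01. Qed.

Lemma ramp_le1 x : ramp x <= 1.
Proof. by rewrite /ramp ge_min lexx orbT. Qed.

Lemma ramp_le x : x <= 1 -> ramp x = 0.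
Proof.
move=> x1; rewrite /ramp (max_idPr _) ?subr_le0//.
by apply/min_idPl; exact: ler01.
Qed.

Lemma ramp_ge x : 2 <= x -> ramp x = 1.
Proof.
move=> x2; rewrite /ramp (max_idPl _); last by lra.
by apply/min_idPr; lra.
Qed.

Lemma ramp_lipschitz x y : `|ramp x - ramp y| <= `|x - y|.
Proof.
wlog xy : x y / x <= y.
  move=> H; have [/H//|/ltW/H] := leP x y.
  by rewrite distrC => /le_trans; apply; rewrite distrC.
have mid z : 1 <= z <= 2 -> ramp z = z - 1.
  move=> /andP[z1 z2]; rewrite /ramp (max_idPl _); last by lra.
  by apply/min_idPl; lra.
rewrite distrC [leRHS]distrC [leRHS]ger0_norm ?subr_ge0// ler_norml.
have [x1|x1] := leP x 1; [rewrite (ramp_le x1)|have [x2|x2] := leP x 2;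
  [rewrite (mid x); last by rewrite x2 ltW|rewrite (ramp_ge (ltW x2))]];
(have [y1|y1] := leP y 1; [rewrite (ramp_le y1)|have [y2|y2] := leP y 2;
  [rewrite (mid y); last by rewrite y2 ltW|rewrite (ramp_ge (ltW y2))]]); lra.
Qed.

(** The square of the displacement is at most [e ^ 2] when [r <= e], vanishes when
    neither [x] nor [y] exceeds 1, and is at most 1 anyway. *)
Lemma ramp_sqr_le x y r e : 0 <= e -> `|x - y| <= r ->
  (ramp x - ramp y) ^+ 2 <= e ^+ 2 * ((1 < x)%R%:R + (1 < y)%R%:R) + (e < r)%R%:R.
Proof.
move=> e0 xyr; have := ramp_ge0 x; have := ramp_ge0 y; have := ramp_le1 x; have := ramp_le1 y.
move=> y1 x1 y0 x0; have [er|re] := ltP e r.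
  have : (ramp x - ramp y) ^+ 2 <= 1.
    rewrite -real_normK ?num_real// expr_le1// ler_norml; lra.
  have : 0 <= e ^+ 2 * ((1 < x)%R%:R + (1 < y)%R%:R) by rewrite mulr_ge0 ?sqr_ge0 ?addr_ge0.
  by rewrite /=; lra.
rewrite addr0; have d : (ramp x - ramp y) ^+ 2 <= e ^+ 2.
  rewrite -real_normK ?num_real// ler_pXn2r ?nnegrE//.
  by apply: le_trans (ramp_lipschitz _ _) _; exact: le_trans xyr re.
have [x2|x2] := ltP 1 x; first by rewrite mulrDr mulr1 (le_trans d)// lerDl mulr_ge0 ?sqr_ge0.
have [y2|y2] := ltP 1 y; first by rewrite mulrDr mulr1 (le_trans d)// lerDr mulr_ge0 ?sqr_ge0.
by rewrite !ramp_le// subrr expr0n/= addr0 mulr0.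
Qed.

Let P := 2 `^ p.

Lemma dyadic_base_ge2 : 2 <= P.
Proof. by rewrite -[leLHS]powRr1// ler_powR// ler1n. Qed.

Let P0 : 0 <= P. Proof. exact: powR_ge0. Qed.

Lemma powR_pow2 n : (2 ^+ n) `^ p = P ^+ n.
Proof.
elim: n => [|n IH]; first by rewrite !expr0 powR1.
by rewrite !exprS powRM ?exprn_ge0// IH.
Qed.

Lemma powR_half x : 0 <= x -> x `^ p = P * (x / 2) `^ p.
Proof. by move=> x0; rewrite /P -powRM ?divr_ge0// mulrC divfK. Qed.

(** A geometric sum dominated by its last term, since [P] is at least 2; the
    subtracted indicator makes the induction on [N] close. *)
Lemma dyadic_sum_le N x : 0 <= x -> \sum_(n < N) P ^+ n * (2 ^+ n < x)%R%:R <= 2 * x `^ p.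
Proof.
suff H : forall x, 0 <= x -> \sum_(n < N) P ^+ n * (2 ^+ n < x)%R%:R <=
    2 * x `^ p - (1 < x)%R%:R.
  by move=> x0; apply: le_trans (H x x0) _; rewrite gerBl.
have pw1 y : 1 < y -> 1 <= y `^ p.
  by move=> y1; have := @ge0_ler_powR _ p (le_trans ler01 p1) 1 y;
    rewrite powR1 !nnegrE; apply => //; lra.
elim: N => [|N IH] {}x x0.
  rewrite big_ord0; have [x1|x1] := ltP 1 x; first by have := pw1 _ x1; rewrite /=; lra.
  by rewrite subr0 mulr_ge0 ?powR_ge0.
rewrite big_ord_recl expr0 mul1r.
have -> : \sum_(i < N) P ^+ lift ord0 i * (2 ^+ lift ord0 i < x)%R%:R =
    P * \sum_(i < N) P ^+ i * (2 ^+ i < x / 2)%R%:R.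
  rewrite mulr_sumr; apply: eq_bigr => i _; rewrite lift0 exprS mulrA.
  by congr (_ * (nat_of_bool _)%:R); rewrite ltr_pdivlMr// exprSr.
have := ler_wpM2l P0 (IH (x / 2) (divr_ge0 x0 (ler0n _ _))).
rewrite mulrBr mulrCA -powR_half//; have P2 := dyadic_base_ge2.
have [x1|x1] := ltP 1 x.
  have [x2|x2] := ltP 1 (x / 2); rewrite /= ?mulr1; first by lra.
  rewrite mulr0 subr0 => _.
  have -> : \sum_(i < N) P ^+ i * (2 ^+ i < x / 2)%R%:R = 0.
    apply: big1 => i _; have -> : (2 ^+ i < x / 2)%R = false; last by rewrite mulr0.
    by apply/negbTE; rewrite -leNgt (le_trans x2)// exprn_ege1// ler1n.
  by have := pw1 _ x1; lra.
have -> : (1 < x / 2)%R = false by apply/negbTE; rewrite -leNgt; lra.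
by rewrite /=; lra.
Qed.

Lemma truncated_pow_le m N x : 0 <= x -> (Num.min x (2 ^+ (m + N))) `^ p <=
  P ^+ m + \sum_(n < N) P ^+ (m + n).+1 * (2 ^+ (m + n) < x)%R%:R.
Proof.
move=> x0; elim: N => [|N IH].
  rewrite big_ord0 addr0 addn0 -powR_pow2 ge0_ler_powR ?nnegrE ?exprn_ge0//.
  - exact: le_trans p1.
  - by rewrite le_min x0 exprn_ge0.
  - by rewrite ge_min lexx orbT.
rewrite big_ord_recr/= addrA; have [xN|xN] := ltP (2 ^+ (m + N)) x.
  rewrite mulr1; apply: (@le_trans _ _ (P ^+ (m + N).+1)).
    rewrite -powR_pow2 -addnS ge0_ler_powR ?nnegrE ?exprn_ge0//.
    - exact: le_trans p1.
    - by rewrite le_min x0 exprn_ge0.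
    - by rewrite ge_min lexx orbT.
  rewrite lerDr addr_ge0 ?exprn_ge0//; apply: sumr_ge0 => n _.
  by rewrite mulr_ge0 ?exprn_ge0.
rewrite mulr0 addr0; apply: le_trans IH.
rewrite (min_idPl xN) (min_idPl _)//; apply: le_trans xN _.
by rewrite ler_eXn2l ?ltr1n// leq_add2l.
Qed.

End dyadic.

(** * Integrability of the solution *)

Section integrability_of_solution.
Context (R : realType) (G : topologicalGroupType) d (T : measurableType d)
  (mu : {finite_measure set T -> \bar R}) (act : G -> {mfun T >-> T}).
Hypotheses (aeact : ae_action mu act) (mp : measure_preserving mu act)
  (erg : ergodic mu act).
Context (chi : G -> T -> R[i]) (unchi : unimodular_family mu chi).
Context (C : R) (s : seq G).
Hypotheses (C0 : 0 <= C) (kaz : forall phi : G -> R, continuous phi -> positive_definite phi ->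
  forall g, phi 1%g - phi g <= C * \sum_(t <- s) (phi 1%g - phi t)).
Hypothesis chi_cont : forall f : T -> R, nnmfun f -> bmfun 1 f ->
  L1_continuous mu (fun g w => chi g w * (f (act g^-1%g w))%:C%C).
Context (p : R) (p1 : 1 <= p).
Context (b : G -> T -> R[i]) (mb : forall g, cmeasurable (b g)).
Hypothesis bp : forall g, (eint mu (fun w => (rnorm (b g w) `^ p)%R) < +oo)%E.
Context (c : T -> R[i]) (mc : cmeasurable c).
Hypothesis cb : forall g, {ae mu, forall w, c w = chi g w * c (act g^-1%g w) + b g w}.

Let u w : R := rnorm (c w).
Let nu : nnmfun u. Proof. exact: nnmfun_rnorm. Qed.
Let E n := [set w | 2 ^+ n < u w].
Let mE n : measurable (E n). Proof. by apply: measurable_set_gt; exact: nu.1. Qed.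
Let m n : R := fine (mu (E n)).
Let mEf n : mu (E n) = (m n)%:E.
Proof. by rewrite /m fineK//; exact: fin_num_measure. Qed.
Let f n w := ramp (u w / 2 ^+ n).

Let pow2_gt0 n : 0 < (2 ^+ n : R). Proof. by rewrite exprn_gt0. Qed.

Let ramp_continuous : continuous (@ramp R).
Proof.
move=> x; apply/cvgrPdist_le => e e0; near=> y.
apply: le_trans (ramp_lipschitz _ _) _; near: y.
by have /cvgrPdist_le/(_ _ e0) : y @[y --> x] --> x by exact: cvg_id.
Unshelve. all: by end_near. Qed.

Let nf n : nnmfun (f n).
Proof.
split=> [|w]; last exact: ramp_ge0.
apply: (@measurableT_comp _ _ _ _ _ _ (@ramp R)).
  exact: continuous_measurable_fun.
by apply: measurable_funM => //; exact: nu.1.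
Qed.

Let bf n : bmfun 1 (f n).
Proof. by split=> [|w]; [exact: (nf n).1|rewrite ger0_norm ?ramp_ge0 ?ramp_le1]. Qed.

Let u_le g : {ae mu, forall w, `|u (act g^-1%g w) - u w| <= rnorm (b g w)}.
Proof.
apply: filterS2 (cb g) (rnorm_chi unchi g) => w cw ch.
rewrite /u -(ch (c (act g^-1%g w))) [in X in _ - X]cw.
apply: le_trans (rnorm_dist _ _) _.
by rewrite opprD addrA subrr sub0r rnormN.
Qed.

(** [u] is finite everywhere, so high levels have small measure. *)
Lemma ex_small_level : exists n0, forall n, (n0 <= n)%N ->
  (mu (f n @^-1` [set 1%R]) <= mu (f n @^-1` [set 0%R]))%E.
Proof.
have mset n (x : R) : measurable (f n @^-1` [set x]).
  by have := (nf n).1 measurableT [set x] (measurable_set1 x); rewrite setTI.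
have cvE : mu (~` E n) @[n --> \oo] --> mu setT.
  have -> : [set: T] = \bigcup_n ~` E n.
    apply/seteqP; split=> // w _; exists (Num.bound (u w)) => //.
    rewrite /E/=; apply/negP; rewrite -leNgt.
    apply: (le_trans (ltW (archi_boundP (nu.2 w)))).
    by rewrite -natrX ler_nat ltnW// ltn_expl.
  apply: nondecreasing_cvg_mu => [n||].
  - exact: measurableC.
  - by apply: bigcup_measurable => n _; exact: measurableC.
  - apply/nondecreasing_seqP => n; apply/subsetPset => w; apply: contra_not.
    by apply: lt_trans; rewrite ltr_eXn2l ?ltr1n.
have fT : mu setT \is a fin_num by exact: fin_num_measure.
have [T0|T0] := eqVneq (mu setT) 0%E.
  exists 0%N => n _; have -> : mu (f n @^-1` [set 1%R]) = 0%E.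
    by apply: subset_measure0 T0.
  exact: measure_ge0.
have Tp : 0 < fine (mu setT) by rewrite fine_gt0// lt0e T0 measure_ge0/= ltey_eq fT.
have : fine (mu (~` E n)) @[n --> \oo] --> fine (mu setT).
  by apply: fine_cvg; rewrite fineK.
move=> /cvgrPdist_lt/(_ (fine (mu setT) / 2)).
rewrite divr_gt0// => /(_ isT)[n0 _ H]; exists n0 => n nn0.
have CE : fine (mu (~` E n)) = fine (mu setT) - m n.
  have mU : (mu setT = mu (E n) + mu (~` E n))%E.
    by rewrite -measureU ?setUCr// ?setICr//; exact: measurableC.
  have fC : mu (~` E n) \is a fin_num by apply: fin_num_measure; exact: measurableC.
  by rewrite mU mEf -(fineK fC) -EFinD /=; ring.
apply: (@le_trans _ _ (mu (E n))).
  rewrite le_measure ?inE// => w /=; rewrite /f => f1; rewrite /E/= ltNge; apply/negP => un.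
  by move: f1; rewrite ramp_le ?ler_pdivrMr ?mul1r// => /eqP; rewrite eq_sym oner_eq0.
apply: (@le_trans _ _ (mu (~` E n))); last first.
  rewrite le_measure ?inE//; first exact: measurableC.
  by move=> w /negP; rewrite -leNgt /f/= => un; rewrite ramp_le ?ler_pdivrMr ?mul1r.
have fC : mu (~` E n) \is a fin_num by apply: fin_num_measure; exact: measurableC.
rewrite mEf -(fineK fC) lee_fin CE.
by have := H n nn0; rewrite /= CE opprB addrC subrK ger0_norm ?fine_ge0//; lra.
Qed.

Let v e g w : R := rnorm (b g w) / e.
Let B e n g := [set w | 2 ^+ n < v e g w].
Let mv e g : measurable_fun setT (v e g).
Proof. by apply: measurable_funM => //; exact: cmeasurable_rnorm. Qed.
Let mB e n g : measurable (B e n g). Proof. exact: measurable_set_gt. Qed.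
Let beta e n g : R := fine (mu (B e n g)).
Let betaE e n g : mu (B e n g) = (beta e n g)%:E.
Proof. by rewrite /beta fineK//; exact: fin_num_measure. Qed.

Let koopman_sqdist_level e n g : 0 < e ->
  koopman_sqdist mu act (f n) g <= 2 * e ^+ 2 * m n + beta e n g.
Proof.
move=> e0; have e20 : 0 <= e ^+ 2 by exact: sqr_ge0.
have nsq : nnmfun (fun w => (f n (act g^-1%g w) - f n w) ^+ 2).
  split=> [|w]; last exact: sqr_ge0.
  apply: measurable_funX; apply: measurable_funB; last exact: (nf n).1.
  exact: (nnmfun_act act g^-1%g (nf n)).1.
pose I w : R := \1_(E n) w.
have nI : nnmfun I by exact: nnmfun_indic.
have nIg : nnmfun (fun w => I (act g^-1%g w)) by exact: nnmfun_act.
pose J w : R := \1_(B e n g) w.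
have nJ : nnmfun J by exact: nnmfun_indic.
have IE w : I w = (2 ^+ n < u w)%R%:R by exact: indic_setE.
have JE w : J w = (2 ^+ n < v e g w)%R%:R by exact: indic_setE.
have n1 : nnmfun (fun w => I (act g^-1%g w) + I w) by exact: nnmfunD.
have n2 : nnmfun (fun w => e ^+ 2 * (I (act g^-1%g w) + I w)) by exact: nnmfunZ.
have : (eint mu (fun w => ((f n (act g^-1%g w) - f n w) ^+ 2)%R) <=
    eint mu (fun w => (e ^+ 2 * (I (act g^-1%g w) + I w) + J w)%R))%E.
  apply: eint_le_ae; [exact: nsq|exact: nnmfunD|].
  apply: filterS (u_le g) => w uw; rewrite !IE JE.
  have -> : (2 ^+ n < v e g w)%R = (e < rnorm (b g w) / 2 ^+ n)%R.
    by rewrite /v !ltr_pdivlMr// mulrC.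
  have -> : (2 ^+ n < u (act g^-1%g w))%R = (1 < u (act g^-1%g w) / 2 ^+ n)%R.
    by rewrite ltr_pdivlMr// mul1r.
  have -> : (2 ^+ n < u w)%R = (1 < u w / 2 ^+ n)%R by rewrite ltr_pdivlMr// mul1r.
  apply: ramp_sqr_le; first exact: ltW.
  by rewrite -mulrBl normrM [X in _ * X]gtr0_norm ?invr_gt0// ler_pM2r ?invr_gt0.
have Ei : eint mu I = (m n)%:E by rewrite -mEf; exact: eint_indic.
have Ej : eint mu J = (beta e n g)%:E by rewrite -betaE; exact: eint_indic.
rewrite (eintD mu n2 nJ) eintZ// (eintD mu nIg nI) (eint_act mp _ nI) Ei Ej.
rewrite -[((m n)%:E + _)%E]EFinD -EFinM -EFinD.
move=> H; rewrite -lee_fin -(eint_fin nsq H); apply: le_trans H _.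
by rewrite lee_fin; lra.
Qed.

(** On [E n.+1] the ramp [f n] is 1, so [koopman_level] compares two consecutive
    levels of [u], the displacement of [f n] being controlled by [E n] and by the
    level sets of the cocycle. *)
Lemma level_decay e n0 : 0 < e ->
  (forall n, (n0 <= n)%N -> (mu (f n @^-1` [set 1%R]) <= mu (f n @^-1` [set 0%R]))%E) ->
  forall n, (n0 <= n)%N ->
  m n.+1 <= 5 * (C * \sum_(t <- s) (2 * e ^+ 2 * m n + beta e n t)).
Proof.
move=> e0 small n nn0.
pose V := C * \sum_(t <- s) (2 * e ^+ 2 * m n + beta e n t).
have fV g : koopman_sqdist mu act (f n) g <= V.
  apply: le_trans (koopman_gap aeact mp unchi kaz chi_cont (nf n) (bf n) g) _.
  by rewrite ler_wpM2l// ler_sum// => t _; exact: koopman_sqdist_level.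
have := koopman_level aeact mp (nf n) (bf n) erg fV (small n nn0).
rewrite -lee_fin -mEf; apply: le_trans.
rewrite le_measure ?inE//.
  by have := (nf n).1 measurableT [set 1] (measurable_set1 _); rewrite setTI.
move=> w; rewrite /E/= /f => un; rewrite ramp_ge// ler_pdivlMr//.
by rewrite -exprS ltW.
Qed.

Let P : R := 2 `^ p.

Let P0 : 0 < P. Proof. exact: powR_gt0. Qed.

Let beta_sum e N g : 0 < e ->
  \sum_(n < N) P ^+ n * beta e n g <= 2 * rint mu (fun w => v e g w `^ p).
Proof.
move=> e0; have nv : nnmfun (v e g).
  by split=> [|w]; [exact: mv|rewrite divr_ge0 ?rnorm_ge0// ltW].
have nvp := nnmfun_powR p nv.
have v_fin : (eint mu (fun w => v e g w `^ p)%R < +oo)%E.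
  have -> : (fun w => v e g w `^ p) = (fun w => e^-1 `^ p * rnorm (b g w) `^ p).
    by apply/funext => w; rewrite /v powRM ?rnorm_ge0 ?invr_ge0 ?(ltW e0)// mulrC.
  rewrite eintZ ?powR_ge0//; last exact/nnmfun_powR/nnmfun_rnorm.
  by rewrite lte_mul_pinfty ?lee_fin ?powR_ge0.
have vE : eint mu (fun w => v e g w `^ p)%R = (rint mu (fun w => v e g w `^ p))%:E.
  by rewrite /rint fineK// ge0_fin_numE ?eint_ge0.
have JE n w : (\1_(B e n g) w : R) = (2 ^+ n < v e g w)%R%:R.
  exact: indic_setE.
have bJ n : bmfun 1 (\1_(B e n g) : T -> R).
  by split=> [|w]; [exact: measurable_indic|rewrite JE ger0_norm// lern1 leq_b1].
have rJ n : rint mu (\1_(B e n g)) = beta e n g by rewrite /rint eint_indic.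
under eq_bigr do rewrite -rJ.
rewrite (rint_sum mu _ _ (fun n : 'I_N => bJ n)) -lee_fin EFinM -vE -eintZ//.
have nS : nnmfun (fun w => \sum_(n < N) P ^+ n * (\1_(B e n g) w : R)).
  split=> [|w].
    by apply: measurable_sum => n; apply: measurable_funM => //; exact: (bJ n).1.
  by apply: sumr_ge0 => n _; rewrite mulr_ge0 ?exprn_ge0 ?(ltW P0)// JE.
have le2 : (eint mu (fun w => \sum_(n < N) P ^+ n * (\1_(B e n g) w : R))%R <=
    (2 * rint mu (fun w => v e g w `^ p))%:E)%E.
  rewrite EFinM -vE -eintZ//; apply: eint_le => //; first exact: nnmfunZ.
  move=> w; under eq_bigr do rewrite JE.
  by apply: dyadic_sum_le => //; exact: nv.2.
by rewrite -(eint_fin nS le2) eintZ// vE -EFinM.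
Qed.

(** With [e] chosen so that the coefficient of [a n] in the recursion is 1/2, the
    recursion for [a n = P ^ n * mu (E n)] sums to a bound on the partial sums of
    [a], and [u ^ p] is at most [P ^ n0] plus [P] times the sum of the [P ^ n] over
    the levels [n >= n0] below [u]. *)
Lemma solution_integrable : (eint mu (fun w => (rnorm (c w) `^ p)%R) < +oo)%E.
Proof.
have [n0 small] := ex_small_level.
pose sz : R := (size s)%:R; have sz0 : 0 <= sz by [].
(* The coefficient of a n below is 10 (C sz) P e^2, at most 1/2 for this e. *)
pose e : R := (20 * (C * sz + 1) * P)^-1.
have Csz : 0 <= C * sz by rewrite mulr_ge0.
have P2 : 2 <= P := dyadic_base_ge2 p1.
have e0 : 0 < e by rewrite invr_gt0 !mulr_gt0// ltr_wpDl.
have e1 : e <= 1.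
  rewrite invf_le1; last by rewrite !mulr_gt0// ltr_wpDl.
  have : 1 * 1 <= (C * sz + 1) * P by apply: ler_pM => //; lra.
  lra.
have eP : e * (20 * (C * sz + 1) * P) = 1 by rewrite mulVf// gt_eqF// -invr_gt0.
pose a n := P ^+ n * m n.
pose K := 5 * C * P.
pose t n := \sum_(g <- s) beta e n g.
have m0 n : 0 <= m n by exact: fine_ge0.
have a0 n : 0 <= a n by rewrite mulr_ge0// exprn_ge0// ltW.
have decay n : (n0 <= n)%N -> a n.+1 <= 2^-1 * a n + K * (P ^+ n * t n).
  move=> nn0; have := level_decay e0 small nn0.
  have -> : \sum_(g <- s) (2 * e ^+ 2 * m n + beta e n g) = sz * (2 * e ^+ 2 * m n) + t n.
    by rewrite big_split/= big_const_seq count_predT iter_addr addr0 -[_ *+ size s]mulr_natl.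
  move=> /(ler_wpM2l (exprn_ge0 n.+1 (ltW P0))); rewrite -/(a n.+1) => /le_trans; apply.
  have -> : P ^+ n.+1 * (5 * (C * (sz * (2 * e ^+ 2 * m n) + t n))) =
      (10 * (C * sz) * P * e ^+ 2) * a n + K * (P ^+ n * t n).
    by rewrite /a /K exprS; ring.
  rewrite lerD2r ler_wpM2r//.
  have h1 : 10 * (C * sz) * P * e ^+ 2 <= 10 * (C * sz) * P * e.
    rewrite ler_wpM2l ?mulr_ge0 ?(ltW P0)// expr2 ger_pMl//.
  apply: le_trans h1 _; have : 0 <= P * e by rewrite mulr_ge0 ?(ltW P0) ?(ltW e0).
  by lra.
pose b1 g := rint mu (fun w => v e g w `^ p).
pose K2 := \sum_(g <- s) 2 * b1 g.
have K0 : 0 <= K by rewrite /K !mulr_ge0 ?(ltW P0).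
have tsum N : \sum_(n < N) P ^+ n * t n <= K2.
  under eq_bigr do rewrite mulr_sumr; rewrite exchange_big/=; apply: ler_sum => g _.
  exact: beta_sum.
have tn0 n : 0 <= P ^+ n * t n.
  by rewrite mulr_ge0 ?exprn_ge0 ?(ltW P0)//; apply: sumr_ge0 => g _; exact: fine_ge0.
(* Keeping twice the last term on the left makes the induction one use of decay. *)
have asum N : \sum_(k < N) a (n0 + k)%N + 2 * a (n0 + N)%N <=
    2 * a n0 + 2 * K * \sum_(k < N) P ^+ (n0 + k) * t (n0 + k)%N.
  elim: N => [|N IH]; first by rewrite !big_ord0 addn0 add0r mulr0 addr0.
  rewrite !big_ord_recr/= addnS.
  by have := decay (n0 + N)%N (leq_addr _ _); lra.
have tsum' N : \sum_(k < N) P ^+ (n0 + k) * t (n0 + k)%N <= K2.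
  apply: le_trans (tsum (n0 + N)%N); rewrite big_split_ord/= ler_wpDl//.
  by apply: sumr_ge0.
pose M1 := 2 * a n0 + 2 * K * K2.
have aM N : \sum_(k < N) a (n0 + k)%N <= M1.
  apply: (@le_trans _ _ (\sum_(k < N) a (n0 + k)%N + 2 * a (n0 + N)%N)).
    by rewrite lerDl mulr_ge0.
  apply: le_trans (asum N) _; rewrite lerD2l ler_wpM2l// mulr_ge0//.
have fT : mu setT \is a fin_num by exact: fin_num_measure.
suff : (eint mu (fun w => (rnorm (c w) `^ p)%R) <= (P ^+ n0 * fine (mu setT) + P * M1)%:E)%E.
  by move=> /le_lt_trans; apply; exact: ltry.
pose F N w := (Num.min (u w) (2 ^+ (n0 + N))) `^ p.
have nF N : nnmfun (F N).
  apply: nnmfun_powR; split=> [|w]; last by rewrite le_min nu.2 exprn_ge0.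
  by apply: measurable_minr => //; exact: nu.1.
apply: (@eint_fatou _ _ _ mu F) => //; first exact: nnmfun_powR.
- move=> N.
  have IE n w : (\1_(E n) w : R) = (2 ^+ n < u w)%R%:R.
    exact: indic_setE.
  have bI n : bmfun 1 (\1_(E n) : T -> R).
    by split=> [|w]; [exact: measurable_indic|rewrite IE ger0_norm// lern1 leq_b1].
  pose Lev w : R := \sum_(k < N) P ^+ (n0 + k).+1 * (\1_(E (n0 + k)%N) w : R).
  have Lev0 w : 0 <= Lev w.
    by apply: sumr_ge0 => k _; rewrite mulr_ge0 ?exprn_ge0 ?(ltW P0)// IE.
  have nLev : nnmfun Lev.
    split=> //; apply: measurable_sum => k; apply: measurable_funM => //.
  have rLev : rint mu Lev = \sum_(k < N) P ^+ (n0 + k).+1 * m (n0 + k)%N.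
    rewrite /Lev -(rint_sum mu _ _ (fun k : 'I_N => bI (n0 + k)%N)).
    by apply: eq_bigr => k _; rewrite /rint eint_indic.
  have bLev : bmfun (\sum_(k < N) P ^+ (n0 + k).+1) Lev.
    split; first exact: nLev.1.
    move=> w; rewrite ger0_norm//; apply: ler_sum => k _.
    by rewrite ler_piMr ?exprn_ge0 ?(ltW P0)// IE lern1 leq_b1.
  have n1 : nnmfun ((fun=> P ^+ n0) : T -> R) by apply: nnmfun_cst; rewrite exprn_ge0// ltW.
  apply: (@le_trans _ _ (eint mu (fun w => P ^+ n0 + Lev w))).
    apply: eint_le => //; first exact: nnmfunD.
    move=> w; apply: le_trans (truncated_pow_le p1 n0 N (nu.2 w)) _.
    by rewrite lerD2l /Lev; under [leRHS]eq_bigr do rewrite IE.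
  rewrite (eintD mu n1 nLev) (eint_bmfun mu nLev bLev).
  have -> : eint mu ((fun=> P ^+ n0) : T -> R) = (P ^+ n0 * fine (mu setT))%:E.
    by rewrite eint_cst EFinM fineK.
  rewrite -EFinD lee_fin lerD2l rLev.
  under eq_bigr do rewrite exprS -mulrA; rewrite -mulr_sumr ler_pM2l//.
- move=> w; exists (Num.bound (u w)) => n Nn; rewrite /F; congr (_ `^ _).
  apply/min_idPl; apply: (le_trans (ltW (archi_boundP (nu.2 w)))).
  rewrite -natrX ler_nat; apply: (@leq_trans (2 ^ Num.bound (u w))).
    by rewrite ltnW// ltn_expl.
  by rewrite leq_exp2l// (leq_trans Nn)// leq_addl.
Qed.

End integrability_of_solution.

(** * Representatives of elements of L_p *)

Section complex_Lp_facts.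
Context d (T : measurableType d) (R : realType) (mu : {finite_measure set T -> \bar R}).
Context (p : R) (p1 : 1 <= p).
Implicit Types (f : T -> R[i]) (x y : Lp mu p1).

Let p0 : 0 < p. Proof. exact: lt_le_trans p1. Qed.

Lemma cLnormE f : cLnorm mu p f = ((eint mu (fun w => (rnorm (f w) `^ p)%R)) `^ p^-1)%E.
Proof.
rewrite /cLnorm unlock /Lnorm; congr (_ `^ _)%E; apply: eq_integral => w _.
by rewrite /= ger0_norm ?rnorm_ge0.
Qed.

Lemma mem_cLfun f : cmeasurable f ->
  (eint mu (fun w => (rnorm (f w) `^ p)%R) < +oo)%E -> f \in cLfun mu p1.
Proof.
move=> mf lf; apply/asboolP; split=> //; rewrite cLnormE.
exact: poweR_lty.
Qed.

Lemma eint_pow_le f (e : R) : cmeasurable f -> 0 <= e -> (cLnorm mu p f <= e%:E)%E ->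
  (eint mu (fun w => (rnorm (f w) `^ p)%R) <= (e `^ p)%:E)%E.
Proof.
move=> mf e0; rewrite cLnormE; set I := eint _ _ => Ie.
have I0 : (0 <= I)%E by apply: eint_ge0; exact/nnmfun_powR/nnmfun_rnorm.
have -> : I = ((I `^ p^-1) `^ p)%E by rewrite -poweRrM mulVf ?gt_eqF// poweRe1.
rewrite -poweR_EFin; apply: gt0_ler_poweR => //; first exact: ltW.
  by rewrite in_itv/= leey andbT poweR_ge0.
by rewrite in_itv/= leey andbT lee_fin.
Qed.

Lemma ler_1DpowR (t : R) : 0 <= t -> t <= 1 + t `^ p.
Proof.
move=> t0; have [t1|t1] := leP t 1; first by rewrite ler_wpDr// powR_ge0.
rewrite ler_wpDl// -[leLHS]powRr1// ler_powR// ltW//.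
Qed.

(** On a finite measure space smallness in L_p forces smallness in L_1: integrate
    [t <= 1 + t ^ p] at [t = rnorm (f w) / e]. *)
Lemma eint_rnorm_le f (e : R) : cmeasurable f -> 0 < e -> (cLnorm mu p f <= e%:E)%E ->
  (eint mu (fun w => rnorm (f w)) <= (e * (fine (mu setT) + 1))%:E)%E.
Proof.
move=> mf e0 fe; have := eint_pow_le mf (ltW e0) fe => {}fe.
have nf := nnmfun_rnorm mf; have np := nnmfun_powR p nf.
have ei0 : 0 <= (e^-1) `^ p by exact: powR_ge0.
have n1 : nnmfun ((fun=> 1) : T -> R) by exact: nnmfun_cst.
have nz := nnmfunZ ei0 np.
apply: (@le_trans _ _ (eint mu (fun w => e * (1 + e^-1 `^ p * rnorm (f w) `^ p)))).
  apply: eint_le => //; first by apply: nnmfunZ (ltW e0) (nnmfunD n1 nz).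
  move=> w; rewrite -powRM ?invr_ge0 ?rnorm_ge0 ?(ltW e0)//.
  rewrite -ler_pdivrMl//; apply: ler_1DpowR.
  by rewrite mulr_ge0 ?rnorm_ge0// invr_ge0 ltW.
rewrite (eintZ mu (ltW e0) (nnmfunD n1 nz)) (eintD mu n1 nz) (eintZ mu ei0 np).
have fm : mu setT \is a fin_num by exact: fin_num_measure.
have -> : eint mu (fun=> 1) = (fine (mu setT))%:E by rewrite eint_cst mul1e fineK.
rewrite EFinM lee_wpmul2l ?lee_fin ?(ltW e0)// EFinD leeD2l//.
apply: le_trans (lee_wpmul2l _ fe) _; first by rewrite lee_fin.
by rewrite -EFinM lee_fin -powRM ?invr_ge0 ?(ltW e0)// mulVf ?gt_eqF// powR1.
Qed.

Lemma Lp_fun_cmeasurable x : cmeasurable x.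
Proof. by have /asboolP[] := cLfunP (repr x). Qed.

Lemma cLnorm_Lp_fun x : cLnorm mu p x = (rnorm x)%:E.
Proof. by rewrite -[LHS](cLfun_fin (repr x)). Qed.

Lemma Lp_funK (f : cLfunType mu p1) : {ae mu, forall w, (\pi_(Lp mu p1)%qT f : Lp mu p1) w = f w}.
Proof. by apply/Lp_eqP; rewrite reprK. Qed.

Lemma Lp_funD x y : {ae mu, forall w, (x + y : Lp mu p1) w = x w + y w}.
Proof.
rewrite (_ : x + y = \pi_(Lp mu p1)%qT (repr x + repr y)).
  exact: (Lp_funK (repr x + repr y)).
by rewrite raddfD /= !reprK.
Qed.

Lemma Lp_funB x y : {ae mu, forall w, (x - y : Lp mu p1) w = x w - y w}.
Proof.
rewrite (_ : x - y = \pi_(Lp mu p1)%qT (repr x - repr y)).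
  exact: (Lp_funK (repr x - repr y)).
by rewrite raddfB /= !reprK.
Qed.

Lemma Lp_fun_inj x y : {ae mu, forall w, x w = y w} -> x = y.
Proof. by move=> /Lp_eqP; rewrite !reprK. Qed.

Lemma continuous_L1 (X : topologicalType) (x : X -> Lp mu p1) : continuous x ->
  L1_continuous mu (fun t => x t : T -> R[i]).
Proof.
move=> cx t0 e e0.
have k0 : 0 < fine (mu setT) + 1 by rewrite ltr_wpDl// fine_ge0.
pose dl := e / (fine (mu setT) + 1).
have dl0 : 0 < dl by rewrite divr_gt0.
have dlC : 0 < (dl%:C)%C by rewrite ltcR.
have /cvgrPdist_le/(_ _ dlC) := cx t0; apply: filterS => t.
rewrite distrC rnormE lecR => xt.
have mb := cmeasurableB (Lp_fun_cmeasurable (x t)) (Lp_fun_cmeasurable (x t0)).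
have -> : e = dl * (fine (mu setT) + 1) by rewrite divfK// gt_eqF.
apply: eint_rnorm_le => //.
rewrite -(cLnorm_ae p (Lp_funB (x t) (x t0)) (Lp_fun_cmeasurable _) mb).
by rewrite cLnorm_Lp_fun lee_fin.
Qed.

Lemma L1_continuous_ae (X : topologicalType) (b b' : X -> T -> R[i]) :
  (forall t, cmeasurable (b t)) -> (forall t, cmeasurable (b' t)) ->
  (forall t, {ae mu, forall w, b t w = b' t w}) ->
  L1_continuous mu b -> L1_continuous mu b'.
Proof.
move=> mb mb' bb' cb t0 e e0; apply: filterS (cb t0 e e0) => t.
congr (_ <= _)%E; apply: eint_ae_eq; [exact/nnmfun_rnorm/cmeasurableB|exact/nnmfun_rnorm/cmeasurableB|].
by apply: filterS2 (bb' t) (bb' t0) => w -> ->.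
Qed.

End complex_Lp_facts.

(** * Fixed points of affine actions *)

Section fixed_points.
Context (R : realType) (G : topologicalGroupType) d (T : measurableType d)
  (mu : {finite_measure set T -> \bar R}) (p : R) (p1 : 1 <= p)
  (pi : linIsomAction G (Lp mu p1)) (act : G -> {mfun T >-> T}) (chi : G -> T -> R[i]).

(** By uniqueness of densities the Radon-Nikodym factor of a measure preserving
    action is 1. *)
Lemma BL_arises_from_action : BL_action pi act chi -> measure_preserving mu act ->
  arises_from_action pi act chi.
Proof.
move=> [aeact _ unchi piE] mp; split=> // g f.
suff dens : {ae mu, forall w, ('d (image_measure mu (act g)) '/d mu) w = 1%E}.
  by apply: filterS2 (piE g f) dens => w -> ->; rewrite /= powR1 mulr1.
have dom : image_measure mu (act g) `<< mu.
  apply/null_content_dominatesP => A mA A0.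
  by rewrite -A0; exact: mp.
suff : ae_eq mu setT ('d (image_measure mu (act g)) '/d mu) (cst 1%E).
  by apply: filterS => w; apply.
apply: integral_ae_eq => //; first exact: Radon_Nikodym_integrable.
move=> E _ mE; rewrite -Radon_Nikodym_integral// integral_cst// mul1e.
exact: mp.
Qed.

Hypotheses (arises : arises_from_action pi act chi) (erg : ergodic mu act).

Let bounded_orbit_L1_continuous (f : T -> R) : nnmfun f -> bmfun 1 f ->
  L1_continuous mu (fun g w => chi g w * (f (act g^-1%g w))%:C%C).
Proof.
move=> nf bf; have [_ mp unchi piE] := arises.
have mf : cmeasurable (fun w => (f w)%:C%C) by exact: cmeasurable_real nf.1.
have Lf : (fun w => (f w)%:C%C) \in cLfun mu p1.
  apply: mem_cLfun => //; apply: (@le_lt_trans _ _ (eint mu (fun=> 1))).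
    apply: eint_le; [exact/nnmfun_powR/nnmfun_rnorm|exact: nnmfun_cst|] => w.
    have f1 : rnorm (f w)%:C%C <= 1 by rewrite rnorm_real bf.2.
    have := ge0_ler_powR (le_trans ler01 p1) (rnorm_ge0 _) ler01 f1.
    by rewrite powR1.
  by rewrite eint_cst mul1e ltey_eq fin_num_measure.
pose F : Lp mu p1 := \pi_(Lp mu p1)%qT (CLfun Lf).
have cF := continuous_L1 (@lia_continuous _ _ _ pi F).
apply: L1_continuous_ae cF => [g|g|g]; first exact: Lp_fun_cmeasurable.
  apply: cmeasurableM; first exact: (unchi g).1.
  exact: (cmeasurable_comp (act g^-1%g) mf).
have H := ae_act mp g^-1%g (Lp_funK (CLfun Lf)).
by apply: filterS2 (piE g F) H => w -> ->.
Qed.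

Context (S : set G) (finS : finite_set S) (kazS : kazhdan_set R S).

(** The cocycle is bounded in L_1, hence in the gauge [rho]; the circumcenter of its
    values is a solution of the fixed point equation almost everywhere, and lies in
    L_p. *)
Lemma affine_fixed_point (b : Z1 pi) : exists x, forall g, pi g x + b g = x.
Proof.
have [aeact mp unchi piE] := arises.
have [C C0 [s kaz]] := kazhdan_set_positive_definite finS kazS.
have /asboolP[cb bM'] := Z1P b.
pose c g : T -> R[i] := Lp_fun (b g).
have mb g : cmeasurable (c g) by exact: Lp_fun_cmeasurable.
have bM g h : {ae mu, forall w, c (g * h)%g w = c g w + chi g w * c h (act g^-1%g w)}.
  rewrite /c bM'; apply: filterS2 (Lp_funD (b g) (pi g (b h))) (piE g (b h)) => w -> ->.
  by [].
have bp g : (eint mu (fun w => (rnorm (c g w) `^ p)%R) < +oo)%E.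
  have l : (cLnorm mu p (c g) <= (rnorm (b g))%:E)%E by rewrite cLnorm_Lp_fun.
  by apply: le_lt_trans (eint_pow_le p1 (mb g) (rnorm_ge0 _) l) _; exact: ltry.
have bc : L1_continuous mu c by exact: continuous_L1.
have b1 g : (eint mu (fun w => rnorm (c g w)) < +oo)%E.
  have np := nnmfun_powR p (nnmfun_rnorm (mb g)).
  have n1 : nnmfun ((fun=> 1) : T -> R) by exact: nnmfun_cst.
  apply: (@le_lt_trans _ _ (eint mu (fun w => 1 + rnorm (c g w) `^ p))).
    apply: eint_le; [exact: nnmfun_rnorm|exact: nnmfunD|].
    by move=> w; apply: ler_1DpowR => //; exact: rnorm_ge0.
  rewrite (eintD mu n1 np) eint_cst mul1e lte_add_pinfty//.
  by rewrite ltey_eq fin_num_measure.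
have [M bdM] := bounded_cocycle aeact mp unchi C0 kaz mb bM bc b1.
have rhoM g : (eint mu (fun w => rho (c g w)) <= (fine (mu setT) + M)%:E)%E.
  have n1 : nnmfun ((fun=> 1) : T -> R) by exact: nnmfun_cst.
  have nr := nnmfun_rnorm (mb g).
  apply: (@le_trans _ _ (eint mu (fun w => 1 + rnorm (c g w)))).
    apply: eint_le; [exact: nnmfun_rho|exact: nnmfunD|].
    by move=> w; apply: height_leD; exact: rnorm_ge0.
  have fm : mu setT \is a fin_num by exact: fin_num_measure.
  rewrite (eintD mu n1 nr).
  have -> : eint mu (fun=> 1) = (fine (mu setT))%:E by rewrite eint_cst mul1e fineK.
  by rewrite EFinD leeD2l.
have feq g h : {ae mu, forall w, c (g * h)%g w = chi g w * c h (act g^-1%g w) + c g w}.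
  by apply: filterS (bM g h) => w ->; rewrite addrC.
have [x [mx xinv _]] := equivariant_center mp unchi mb mb rhoM feq.
have chi_cont := bounded_orbit_L1_continuous.
have xp := solution_integrable aeact mp erg unchi C0 kaz chi_cont p1 mb bp mx xinv.
have Lx : x \in cLfun mu p1 by exact: mem_cLfun.
pose X : Lp mu p1 := \pi_(Lp mu p1)%qT (CLfun Lx).
exists X => g; apply: Lp_fun_inj.
have XE : {ae mu, forall w, X w = chi g w * X (act g^-1%g w) + c g w}.
  have H := ae_act mp g^-1%g (Lp_funK (CLfun Lx)).
  apply: filterS3 H (xinv g) (Lp_funK (CLfun Lx)) => w Hw xw Xw.
  by rewrite [LHS]Xw /= xw; congr (_ * _ + _); exact/esym/Hw.
by apply: filterS3 (Lp_funD (pi g X) (b g)) (piE g X) XE => w -> -> ->.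
Qed.

(** If [x] is fixed then [b g = x - pi g x] is the coboundary of [- x]. *)
Lemma H1_eq0 (z : H1 pi) : z = 0.
Proof.
elim/quotW: z => b; apply/eqP.
rewrite -(raddf0 \pi_(H1 pi)%qT) -Quotient.idealrBE subr0; apply/asboolP.
have [x xb] := affine_fixed_point b.
exists (- x) => g; rewrite -[- x]sub0r linIsomActionB linIsomAction0.
by rewrite !sub0r opprK -{2}(xb g) addKr.
Qed.

End fixed_points.

Theorem theorem1 (R : realType) (G : topologicalGroupType)
    (d : measure_display) (T : measurableType d)
    (mu : {finite_measure set T -> \bar R}) (p : R) (p1 : 1 <= p)
    (pi : linIsomAction G (Lp mu p1))
    (act : G -> {mfun T >-> T}) (chi : G -> T -> R[i]) :
  (exists2 S : set G, finite_set S & kazhdan_set R S) ->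
  standard_borel R T ->
  (if p == 2 then arises_from_action pi act chi else BL_action pi act chi) ->
  measure_preserving mu act ->
  ergodic mu act ->
  (forall c : H1 pi, c = 0) /\
  (forall alpha : G -> Lp mu p1 -> Lp mu p1,
     affine_action_with_linear_part pi alpha ->
     exists x, forall g, alpha g x = x).
Proof.
move=> [S finS kazS] _ arises_or_BL mp erg.
have arises : arises_from_action pi act chi.
  by move: arises_or_BL; case: ifP => // _ /BL_arises_from_action; apply.
split; first exact: (H1_eq0 arises erg finS kazS).
move=> alpha [b alphaE]; have [x xb] := affine_fixed_point arises erg finS kazS b.
by exists x => g; rewrite alphaE.
Qed.
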